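(* Let $\alpha\in(0,1)$. Assume: (1) (i) for every $p>1$, $\sup_{t\in[0,T]}\|\sigma_t\|_p<\infty$ and there is a constant $C(p)$ with $\|\widetilde\sigma_t-\widetilde\sigma_s\|_p\le C(p)|t-s|^{1/2}$ for all $s,t\in[0,T]$; (ii) $\sup_{t\in[0,T]}\|b_t\|_p<\infty$ for every $p>1$; (iii) $\sigma_t\neq0$ a.s. for every $t\in[0,T]$, and $\sup_{t\in[0,T]}\|\sigma_t^{-1}\|_p<\infty$ for every $p>1$. (2) (i) $S_{n,j-1}>0$ a.s. and $\sup_{n\in\mathbb N}\sup_{j\in I_n}\|S_{n,j-1}^{-1}\|_p<\infty$ for every $p>1$; (ii) there exist constants $\gamma_0>0$ and $c>0$ such that $\sup_{n\in\mathbb N}\sup_{j\in I_n}n^{\gamma_0}\big\|1_{\{j\in\mathcal L_n^c\}}\big(\sigma_{t_{j-1}}^2-c\,S_{n,j-1}\big)\big\|_p<\infty$ for every $p>1$. (3) There exists a constant $\xi\ge0$ such that $\|\#\mathfrak L_n\|_p=O(n^{\xi})$ as $n\to\infty$ for every $p>1$. Suppose that $\xi<\frac12$, that $\kappa_n=O(n^{1/2})$, and that $\beta_0<\min\{\gamma_0,\frac12-\xi\}$. Then $$\big\|\mathbb V_n(\alpha)-\Theta\big\|_p=O(n^{-\beta_0})\qquad(n\to\infty)$$ for every $p>1$.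
   Context: Setting. Fix $T>0$ and a filtered probability space $(\Omega,\mathcal F,P)$ with filtration $(\mathcal F_t)_{t\in[0,T]}$; $\|\cdot\|_p$ is the $L^p(P)$-norm. $X_t=X_0+\int_0^tb_s\,ds+\int_0^t\sigma_s\,dw_s+J_t$, $t\in[0,T]$, is a real semimartingale, where $X_0$ is $\mathcal F_0$-measurable, $b$ and $\sigma$ are càdlàg adapted processes, $w$ is a standard Wiener process with respect to the filtration, and $J_t=\sum_{s\in(0,t]}\Delta J_s$ is finitely active, i.e. $\sum_{t\in[0,T]}1_{\{\Delta J_t\ne0\}}<\infty$ a.s. Put $\Theta=\int_0^T\sigma_t^2\,dt$, $t_j=t_j^n=jT/n$, $h=T/n$, $I_n=\{1,\dots,n\}$, $\Delta_jU=U_{t_j}-U_{t_{j-1}}$ for a process $U$. Jumps. $N_t=\sum_{s\in(0,t]}1_{\{\Delta J_s\ne0\}}$, $J^\sigma_t=\sum_{s\in(0,t]}\Delta\sigma_s$, $\widetilde\sigma=\sigma-J^\sigma$, $N^\sigma_t=\sum_{s\in(0,t]}1_{\{\Delta J^\sigma_s\ne0\}}$, with $N^\sigma_T<\infty$ a.s., and $\overline N=N+N^\sigma$. For an interval $A$, $\overline N(A)$ is the number of points of $\overline N$ in $A$. The jump parts $J$ and $J^\sigma$ (hence $X,\sigma,\overline N,\Theta$) are allowed to depend on $n$, this dependence being suppressed from the notation; all bounds on $\sigma,\widetilde\sigma,b$ are understood to be uniform in $n$. $\mathfrak L_n=\{j\in I_n:\Delta_j\overline N\ne0\}$. Local windows.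 $\kappa_n$ are nonnegative integers with $2\kappa_n+1\le n$. Set $\underline j_n=1$ if $j\le\kappa_n$, $\underline j_n=j-\kappa_n$ if $\kappa_n+1\le j\le n-\kappa_n$, $\underline j_n=n-2\kappa_n$ if $j\ge n-\kappa_n+1$. $\mathtt I_{n,j}=(t_{\underline j_n-1},t_{\underline j_n+2\kappa_n}]$ and $\mathcal L_n=\{j\in I_n:\overline N(\mathtt I_{n,j})\ne0\}$; $\mathcal L_n^c=I_n\setminus\mathcal L_n$. Global realized volatility. Given random variables $S_{n,j-1}$ ($j\in I_n$, $n\in\mathbb N$), put $V_j=|S_{n,j-1}^{-1/2}\Delta_jX|$, $s_n(\alpha)=\lfloor n(1-\alpha)\rfloor$, $V_{(1)}\le\dots\le V_{(n)}$ the order statistics of $\{V_k\}_{k\in I_n}$ (with $V_{(0)}:=0$), $\mathcal J_n(\alpha)=\{j\in I_n:V_j<V_{(s_n(\alpha))}\}$, $K_{n,j}=1_{\{|\Delta_jX|\le n^{-1/4}\}}$. For $\zeta\sim N(0,1)$, $c(\alpha)$ is defined by $P[\zeta^2\le c(\alpha)]=1-\alpha$, and $q(\alpha)=E[\zeta^21_{\{|\zeta|\le c(\alpha)^{1/2}\}}]$. Finally $$\mathbb V_n(\alpha)=\sum_{j\in\mathcal J_n(\alpha)}q(\alpha)^{-1}|\Delta_jX|^2K_{n,j}.$$ *)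

(* Defs.v *)
From HB Require Import structures.
From mathcomp Require Import all_boot all_order all_algebra.
From mathcomp Require Import all_classical all_reals all_analysis.

Set Implicit Arguments.
Unset Strict Implicit.
Unset Printing Implicit Defensive.

Import Order.TTheory GRing.Theory Num.Theory.
Import numFieldNormedType.Exports.

Local Open Scope classical_set_scope.
Local Open Scope ring_scope.

Section Paths.
Context {R : realType}.
Implicit Types (f : R -> R) (A : set R) (T : R).

Definition cadlag (T : R) (f : R -> R) : Prop :=
  (forall t, 0 <= t < T -> f x @[x --> t^'+] --> f t) /\
  (forall t, 0 < t <= T -> cvg (f x @[x --> t^'-])).

Definition jump (f : R -> R) (s : R) : R := f s - lim (f x @[x --> s^'-]).

Definition jump_number (f : R -> R) (A : set R) : \bar R :=
  counting (A `&` [set s | jump f s != 0]).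

(* This finitely supported sum takes the junk value 0 when f has infinitely
   many jumps in ]0, t]: finiteness of jump_number must be assumed of f itself,
   not of jump_sum f. *)
Definition jump_sum (f : R -> R) (t : R) : R :=
  \sum_(s \in `]0, t]) jump f s.

End Paths.

Section Processes.
Context {R : realType} {d : measure_display} {Omega : measurableType d}.
Variables (P : probability Omega R) (T : R) (F : R -> set (set Omega)).
Implicit Types (U w M : R -> Omega -> R).

Definition filtration : Prop :=
  (forall t, 0 <= t <= T -> sigma_algebra setT (F t) /\ F t `<=` measurable) /\
  (forall s t, 0 <= s -> s <= t -> t <= T -> F s `<=` F t).

Definition measurable_wrt (G : set (set Omega)) (Y : Omega -> R) : Prop :=
  forall B : set R, measurable B -> G (Y @^-1` B).

Definition cadlag_adapted U : Prop :=
  (forall t, 0 <= t <= T -> measurable_wrt (F t) (U t)) /\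
  (forall omega, cadlag T (U ^~ omega)).

Definition wiener_process w : Prop :=
  [/\ forall t, 0 <= t <= T -> measurable_wrt (F t) (w t),
      {ae P, forall omega, w 0 omega = 0},
      {ae P, forall omega, {within `[0, T], continuous (w ^~ omega)}},
      forall s t, 0 <= s -> s < t -> t <= T ->
        forall B : set R, measurable B ->
          P ((w t \- w s)%R @^-1` B) = normal_prob 0 (Num.sqrt (t - s)) B &
      forall s t, 0 <= s -> s < t -> t <= T ->
        forall (A : set Omega) (B : set R), F s A -> measurable B ->
          P (A `&` (w t \- w s)%R @^-1` B) = (P A * P ((w t \- w s)%R @^-1` B))%E].

Definition cvg_proba0 (Y : nat -> Omega -> \bar R) : Prop :=
  forall eps : R, 0 < eps ->
    P [set omega | (eps%:E <= Y k omega)%E] @[k --> \oo] --> 0%E.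

(* The data of the step process
   \sum_(i < se_size) se_coef i * 1_(]se_time i, se_time i.+1]). *)
Record step_data := StepData {
  se_size : nat;
  se_time : nat -> R;
  se_coef : nat -> Omega -> R }.

Definition simple_predictable (H : step_data) : Prop :=
  [/\ 0 <= se_time H 0, se_time H (se_size H) <= T &
      forall i, (i < se_size H)%N ->
        se_time H i <= se_time H i.+1 /\
        measurable_wrt (F (se_time H i)) (se_coef H i)].

Definition step_process (H : step_data) (t : R) (omega : Omega) : R :=
  \sum_(i < se_size H)
     se_coef H i omega * \1_(`]se_time H i, se_time H i.+1]) t.

Definition step_integral w (H : step_data) (t : R) (omega : Omega) : R :=
  \sum_(i < se_size H)
     se_coef H i omega *
       (w (Num.min (se_time H i.+1) t) omega - w (Num.min (se_time H i) t) omega).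

(* M is a continuous version of \int_0^. sigma dw, defined as the limit in
   probability of the integrals of simple predictable processes H k with
   \int_0^T (H k - sigma)^2 dt --> 0 in probability. For a cadlag adapted sigma
   such H exist (step processes along refining grids) and the limit does not
   depend on them, so M is determined up to indistinguishability. *)
Definition ito_integral w (sigma M : R -> Omega -> R) : Prop :=
  [/\ forall t, 0 <= t <= T -> measurable_fun setT (M t),
      {ae P, forall omega, {within `[0, T], continuous (M ^~ omega)}} &
      forall H : nat -> step_data,
        (forall k, simple_predictable (H k)) ->
        cvg_proba0 (fun k omega =>
          \int[lebesgue_measure]_(t in `[0%R, T])
             ((step_process (H k) t omega - sigma t omega) ^+ 2)%:E)%E ->
        forall t, 0 <= t <= T ->
          cvg_proba0 (fun k omega =>
            `|step_integral w (H k) t omega - M t omega|%:E)].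

End Processes.

(* u n = O(v n) as n tends to infinity; u may take infinite values for small n. *)
Definition is_bigO {R : realType} (u : nat -> \bar R) (v : nat -> R) : Prop :=
  exists C : R, \forall n \near \oo, (u n <= (C * v n)%:E)%E.

Section Grid.
Context {R : realType}.
Variables (T : R) (n : nat).
Implicit Types (J s x : R -> R) (j : nat).

Definition grid j : R := j%:R * T / n%:R.

Definition increment (u : R -> R) j : R := u (grid j) - u (grid j.-1).

(* In the next three definitions J and s are a path of the jump part of X and a
   path of sigma. *)
Definition Nbar_on J s (A : set R) : \bar R :=
  (jump_number J A + jump_number (jump_sum s) A)%E.

Definition Nbar J s (t : R) : \bar R := Nbar_on J s `]0, t].

Definition in_frakL J s j : bool :=
  (Nbar J s (grid j) - Nbar J s (grid j.-1))%E != 0%E.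

Definition card_frakL J s : nat := (\sum_(1 <= j < n.+1 | in_frakL J s j) 1)%N.

Definition jlow (kappa : nat) j : nat :=
  if (j <= kappa)%N then 1%N
  else if (j <= n - kappa)%N then (j - kappa)%N
  else (n - kappa.*2)%N.

Definition window (kappa : nat) j : set R :=
  `]grid (jlow kappa j).-1, grid (jlow kappa j + kappa.*2)].

Definition in_calL (kappa : nat) J s j : bool :=
  Nbar_on J s (window kappa j) != 0%E.

(* In what follows x is a path of X and S j is the value of S_{n,j}. *)
Definition Vstat (S : nat -> R) x j : R :=
  `|(Num.sqrt (S j.-1))^-1 * increment x j|.

Definition sorted_V (S : nat -> R) x : seq R :=
  sort <=%R [seq Vstat S x j | j <- iota 1 n].

Definition ordV (S : nat -> R) x (k : nat) : R := nth 0 (0 :: sorted_V S x) k.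

Definition s_trunc (alpha : R) : nat := Num.truncn (n%:R * (1 - alpha)).

Definition in_J (alpha : R) (S : nat -> R) x j : bool :=
  Vstat S x j < ordV S x (s_trunc alpha).

Definition Ktrunc x j : R := (`|increment x j| <= n%:R `^ (- 4^-1))%R%:R.

Definition global_RV (alpha q : R) (S : nat -> R) x : R :=
  \sum_(1 <= j < n.+1 | in_J alpha S x j)
     q^-1 * `|increment x j| ^+ 2 * Ktrunc x j.

End Grid.

(* Uniquely determines c = c(alpha) when 0 < alpha < 1. *)
Definition is_c_alpha {R : realType} (alpha c : R) : Prop :=
  normal_prob 0 1 [set z : R | z ^+ 2 <= c] = (1 - alpha)%:E.

(* q(alpha), as a function of c = c(alpha). *)
Definition q_of_c {R : realType} (c : R) : R :=
  \int[normal_prob 0 1]_z (z ^+ 2 * \1_[set y : R | `|y| <= Num.sqrt c] z).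

(* Main.v *)
(* Even moments turn each hypothesis into a bound |Y_{n,j}| <= n^(a + eps), uniform in j, valid off
   an event of probability O(n^-L) for every L. On an interval free of jumps sigma moves by
   O(h^(1/2)) in L^p, because sigma tilde does. The Ito integral over it is a limit in probability
   of left-point sums, that is, of martingale transforms, whose even moments obey a discrete
   Gronwall inequality; hence the increment of X is sigma_{t_{j-1}} times that of w, up to
   n^(-1 + eps). Consequently V_j / (c h)^(1/2) is within n^-beta of |zeta_j|, where
   zeta_j = h^(-1/2) Delta_j w and beta < min(gamma0, 1/2 - xi), except for the indices of calL_n,
   at most 4 kappa_n + 1 times as many as those of frakL_n. As the empirical distribution of the
   |zeta_j| fluctuates by n^(-1/2 + eps), the order statistic is within 2 n^-beta of c(alpha)^(1/2),
   and J_n(alpha) differs from {|zeta_j| <= c(alpha)^(1/2)} in at most O(n^(1 - beta)) further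
   indices. This allows one to replace V_n(alpha) by
   h q^-1 \sum_j sigma_{t_{j-1}}^2 zeta_j^2 1_{|zeta_j| <= c(alpha)^(1/2)}, and then by Theta. On the
   exceptional event the truncation K_{n,j} gives the crude bound V_n(alpha) <= n^(1/2) / q. *)

(* Whether an interval is free of jumps is not known at its left end, so the corresponding indicator
   cannot multiply an Ito integrand. At a refinement point [s] it is replaced by the indicator of no
   jump up to [s], which is adapted and also equals 1 on the event in question. The [S n j] may
   depend on the Wiener increments in any way. Probability therefore serves only to produce
   simultaneous bounds off a small event; the comparison of the order statistics is then
   deterministic, path by path. The rate 1/2 - xi has two sources. About n^xi intervals carry jumps,
   and after truncation each contributes at most n^(-1/2). About n^(xi + 1/2) windows are touched by
   jumps, because kappa_n = O(n^(1/2)); their indices may be ranked wrongly, at a cost of about 1/n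
   each, and they shift the quantile by their proportion n^(xi - 1/2). Working with an exponent beta
   > beta0 absorbs all factors n^eps. *)
Require Import Defs.
From HB Require Import structures.
From mathcomp Require Import all_boot all_order all_algebra.
From mathcomp Require Import all_classical all_reals all_analysis.
From mathcomp Require Import measurable_realfun zify ring lra.
Import Order.TTheory GRing.Theory Num.Theory.
Import numFieldNormedType.Exports.
Local Open Scope classical_set_scope.
Local Open Scope ring_scope.

Set Implicit Arguments.
Unset Strict Implicit.
Unset Printing Implicit Defensive.

(** * Cadlag paths and their jumps *)

Section Mesh.
Context {R : realType}.
Implicit Types (f : R -> R) (a b t T e : R) (k i : nat).

(** Serves at two scales: as the observation grid of [0, T], and as the refinement of one
    observation interval, on which Riemann and Ito sums are taken. *)
Definition mesh a b k i : R := a + i%:R * ((b - a) / k%:R).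

Lemma mesh0 a b k : mesh a b k 0 = a.
Proof. by rewrite /mesh mul0r addr0. Qed.

Lemma mesh_last a b k : (0 < k)%N -> mesh a b k k = b.
Proof.
move=> k0; rewrite /mesh mulrCA divff ?mulr1; first by rewrite addrC subrK.
by rewrite pnatr_eq0 -lt0n.
Qed.

Lemma meshS a b k i : mesh a b k i.+1 = mesh a b k i + (b - a) / k%:R.
Proof. by rewrite /mesh -natr1 mulrDl mul1r addrA. Qed.

Lemma mesh_le a b k i j : a <= b -> (i <= j)%N -> mesh a b k i <= mesh a b k j.
Proof.
move=> ab ij; rewrite lerD2l ler_wpM2r ?ler_nat//.
by rewrite divr_ge0 ?subr_ge0.
Qed.

Lemma mesh_ge a b k i : a <= b -> a <= mesh a b k i.
Proof. by move=> ab; rewrite -{1}(mesh0 a b k) mesh_le. Qed.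

Lemma mesh_le_last a b k i : a <= b -> (i <= k)%N -> mesh a b k i <= b.
Proof.
case: k => [|k] ab ik; last by rewrite -{2}(@mesh_last a b k.+1)// mesh_le.
by move: ik; rewrite leqn0 => /eqP ->; rewrite mesh0.
Qed.

Lemma mesh_itv a b k i : a <= b -> (i <= k)%N -> a <= mesh a b k i <= b.
Proof. by move=> ab ik; rewrite mesh_ge ?mesh_le_last. Qed.

Lemma mesh_locate a b k t : (0 < k)%N -> a < t -> t <= b ->
  exists2 i, (i < k)%N & mesh a b k i < t /\ t <= mesh a b k i.+1.
Proof.
move=> k0 at_ tb.
have ex : exists i, t <= mesh a b k i by exists k; rewrite mesh_last.
case: (ex_minnP ex) => -[|i] ti imin.
  by move: ti; rewrite mesh0 leNgt at_.
exists i; first by apply: imin; rewrite mesh_last.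
by split=> //; rewrite ltNge; apply/negP => /imin; rewrite ltnn.
Qed.

Lemma mesh_fine a b e : a <= b -> 0 < e ->
  \forall k \near \oo, (0 < k)%N /\ (b - a) / k%:R < e.
Proof.
move=> ab e0; near=> k; have k0 : (0 < k)%N by near: k; exists 1%N.
split=> //; rewrite ltr_pdivrMr ?ltr0n// mulrC -ltr_pdivrMr//.
near: k; exists (Num.truncn ((b - a) / e)).+1 => //= k.
have /andP[_ /lt_le_trans h] : (Num.truncn ((b - a) / e))%:R <= (b - a) / e < (Num.truncn ((b - a) / e)).+1%:R.
  by apply: truncn_itv; rewrite divr_ge0 ?subr_ge0// ltW.
by move=> hk; apply: h; rewrite ler_nat.
Unshelve. all: by end_near. Qed.

Lemma cadlag_right T f t e : cadlag T f -> 0 <= t < T -> 0 < e ->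
  exists2 d, 0 < d & forall x, t <= x -> x < t + d -> `|f x - f t| < e.
Proof.
move=> [rc _] tT e0.
have /cvgrPdist_lt/(_ _ e0) := rc _ tT.
rewrite near_withinE => -[d /= d0 H]; exists d => // x tx xd.
have [->|xt] := eqVneq x t; first by rewrite subrr normr0.
have tx' : t < x by rewrite lt_neqAle eq_sym xt.
by rewrite distrC; apply: H => //=; rewrite distrC ger0_norm ?subr_ge0// ltrBlDl.
Qed.

Lemma cadlag_left T f t e : cadlag T f -> 0 < t <= T -> 0 < e ->
  exists2 d, 0 < d & forall x, t - d < x -> x < t ->
    `|f x - lim (f x @[x --> t^'-])| < e.
Proof.
move=> [_ lc] tT e0.
have /cvgrPdist_lt/(_ _ e0) := lc _ tT.
rewrite near_withinE => -[d /= d0 H]; exists d => // x tx xd.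
rewrite distrC; apply: H => //=.
by rewrite ger0_norm ?subr_ge0 ?(ltW xd)// ltrBlDl -ltrBlDr.
Qed.

Lemma cadlag_left_nojump T f t e : cadlag T f -> 0 < t <= T -> 0 < e ->
  jump f t = 0 ->
  exists2 d, 0 < d & forall x, t - d < x -> x <= t -> `|f x - f t| < e.
Proof.
move=> cf tT e0 /eqP; rewrite subr_eq0 => /eqP ft.
have [d d0 H] := cadlag_left cf tT e0; exists d => // x tx.
rewrite le_eqVlt => /predU1P[->|xt]; first by rewrite subrr normr0.
by rewrite ft; exact: H.
Qed.

(** By compactness of [0, T]: near each [t] right-continuity bounds the path on one side, and the
    left limit bounds it on the other. *)
Lemma cadlag_bounded T f : 0 <= T -> cadlag T f ->
  exists2 M, 0 < M & forall t, 0 <= t <= T -> `|f t| <= M.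
Proof.
move=> T0 cf.
have /compact_near_coveringP/near_covering_withinP := @segment_compact R 0 T.
move=> /(_ nat \oo (fun k x => `|f x| <= k%:R) _).
case=> [t /=|k _ /(_ k (leqnn k)) H]; last first.
  exists k.+1%:R => // t tT; apply: (@le_trans _ _ k%:R); last by rewrite ler_nat.
  by apply: H; rewrite /= in_itv.
rewrite in_itv/= => /andP[t0 tT].
have [d1 d10 H1] : exists2 d, 0 < d & forall x, t < x -> x < t + d -> x <= T -> `|f x| < `|f t| + 1.
  have [tT'|Tt] := ltP t T; last first.
    by exists 1 => // x tx _ xT; move: (lt_le_trans tx xT); rewrite ltNge Tt.
  have [||d d0 H] := @cadlag_right T f t 1 cf; rewrite ?t0//.
  exists d => // x tx xd _; have := H x (ltW tx) xd.
  by rewrite -(ltrD2l `|f t|); apply: le_lt_trans; rewrite -{1}(subrK (f t) (f x)) addrC ler_normD.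
have [d2 d20 H2] : exists2 d, 0 < d & exists M, forall x, t - d < x -> x < t -> 0 <= x -> `|f x| < M.
  have [t0'|Tt] := ltP 0 t; last first.
    by exists 1 => //; exists 1 => // x _ xt x0; move: (le_lt_trans x0 xt); rewrite ltNge Tt.
  have [||d d0 H] := @cadlag_left T f t 1 cf; rewrite ?t0'//.
  exists d => //; exists (`|lim (f x @[x --> t^'-])| + 1) => // x tx xd _; have := H x tx xd.
  rewrite -(ltrD2l `|lim (f x @[x --> t^'-])|); apply: le_lt_trans.
  by rewrite -{1}(subrK (lim (f x @[x --> t^'-])) (f x)) addrC ler_normD.
case: H2 => M H2.
pose K := (Num.truncn (`|f t| + 1 + `|M|)).+1.
have HK : `|f t| + 1 + `|M| < K%:R.
  have h : 0 <= `|f t| + 1 + `|M| by rewrite !addr_ge0.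
  by have /andP[_] := truncn_itv h.
exists ([set x : R | t - d2 < x < t + d1], [set k | (K <= k)%N]).
  split; last by exists K.
  exists (Num.min d1 d2); first by rewrite /= lt_min d10 d20.
  move=> x /=; rewrite lt_min !ltr_norml => /andP[/andP[? ?] /andP[? ?]].
  by apply/andP; split; lra.
move=> [x k] /= [/andP[tx xt] Kk] /[!in_itv]/= /andP[x0 xT].
apply: (@le_trans _ _ K%:R); last by rewrite ler_nat.
apply/ltW/(le_lt_trans _ HK).
have [xt'|xt'|->] := ltgtP x t.
- apply: ltW; apply: (lt_le_trans (H2 _ tx xt' x0)); apply: (le_trans (ler_norm _)).
  by rewrite lerDr addr_ge0.
- by apply: ltW; apply: (lt_le_trans (H1 _ xt' xt xT)); rewrite lerDl.
- by rewrite -addrA lerDl addr_ge0.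
Qed.

(** Open at [a], because a jump at [a] is already contained in [f a] and does not affect the
    increments of [f] after [a]. *)
Definition nojump f a b := forall r, a < r -> r <= b -> jump f r = 0.

(** Without jumps [f] is continuous on the compact interval [a, b], hence uniformly continuous. *)
Lemma nojump_osc T f a b e : cadlag T f -> 0 <= a -> a < b -> b <= T ->
  nojump f a b -> 0 < e ->
  \forall k \near \oo, forall i, (i < k)%N ->
    `|f (mesh a b k i.+1) - f (mesh a b k i)| <= e.
Proof.
move=> cf a0 ab bT nj e0.
have /compact_near_coveringP/near_covering_withinP := @segment_compact R a b.
(* [x] ranges over [a, b] and [y] over the points within one mesh step of [x]; the covering argument
   makes the choice of [k] uniform in [x]. *)
move=> /(_ nat \oo (fun k x => forall y, a <= y <= b -> `|y - x| <= (b - a) / k%:R -> `|f y - f x| <= e) _).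
case=> [t /=|k _ H]; last first.
  exists k.+1 => //= m km i im; apply: (H m (ltnW km)) => /=.
  - by rewrite in_itv/= mesh_itv// ?ltW// ltnW.
  - by rewrite mesh_itv// ltW.
  - by rewrite meshS addrC addKr ger0_norm// divr_ge0// subr_ge0 ltW.
rewrite in_itv/= => /andP[at_ tb].
have [d1 d10 H1] : exists2 d, 0 < d & forall x, t <= x -> x < t + d -> x <= b -> `|f x - f t| < e / 2.
  have [tT'|Tt] := ltP t b; last first.
    exists 1 => // x tx _ xT; have -> : x = t by apply/le_anti; rewrite tx (le_trans xT).
    by rewrite subrr normr0 divr_gt0.
  have [||d d0 H] := @cadlag_right T f t (e/2) cf; rewrite ?(le_trans a0 at_)//.
  - by rewrite (lt_le_trans tT').
  - by rewrite divr_gt0.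
  - by exists d => // x tx xd _; exact: H x tx xd.
have [d2 d20 H2] : exists2 d, 0 < d & forall x, t - d < x -> x <= t -> a <= x -> `|f x - f t| < e / 2.
  have [t0'|Tt] := ltP a t; last first.
    exists 1 => // x _ xt ax; have -> : x = t by apply/le_anti; rewrite xt (le_trans Tt).
    by rewrite subrr normr0 divr_gt0.
  have [|||d d0 H] := @cadlag_left_nojump T f t (e/2) cf.
  - by rewrite (le_lt_trans a0 t0') (le_trans tb bT).
  - by rewrite divr_gt0.
  - exact: nj.
  - by exists d => // x tx xd _; exact: H x tx xd.
have H x : t - Num.min d1 d2 < x -> x < t + Num.min d1 d2 -> a <= x <= b -> `|f x - f t| < e / 2.
  move=> tx xt /andP[ax xb]; have [xt'|xt'] := leP t x.
  - by apply: H1 => //; apply: (lt_le_trans xt); rewrite lerD2l ge_min lexx.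
  - by apply: H2 (ltW xt') ax; apply: le_lt_trans tx; rewrite lerD2l lerN2 ge_min lexx orbT.
have m0 : 0 < Num.min d1 d2 by rewrite lt_min d10 d20.
move: (Num.min d1 d2) m0 H => d d0 H.
have [K _ HK] : \forall k \near \oo, (0 < k)%N /\ (b - a) / k%:R < d / 2.
  by apply: mesh_fine; rewrite ?divr_gt0// ltW.
exists ([set x : R | t - d / 2 < x < t + d / 2], [set k | (K <= k)%N]).
  split; last by exists K.
  exists (d / 2); first by rewrite /= divr_gt0.
  by move=> x /=; rewrite ltr_norml => /andP[? ?]; apply/andP; split; lra.
move=> [x k] /= [/andP[tx xt] /HK [k0 kd]] /[!in_itv]/= xab y yab yx.
have hx : `|f x - f t| < e / 2 by apply: H => //; lra.
have hy : `|f y - f t| < e / 2.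
  by move: (le_lt_trans yx kd); rewrite ltr_norml => /andP[? ?]; apply: H => //; lra.
move: hx hy; rewrite ler_norml !ltr_norml => /andP[? ?] /andP[? ?].
by apply/andP; split; lra.
Qed.
End Mesh.

Section Jumps.
Context {R : realType}.
Implicit Types (f : R -> R) (a b t T e : R) (k i : nat).

(* With nojump_osc, expresses the absence of jumps through countably many values of f,
   whence its measurability in omega. *)
Lemma osc_nojump T f a b : cadlag T f -> 0 <= a -> a < b -> b <= T ->
  (forall m, \forall k \near \oo, forall i, (i < k)%N ->
    `|f (mesh a b k i.+1) - f (mesh a b k i)| <= m.+1%:R^-1) ->
  nojump f a b.
Proof.
move=> cf a0 ab bT osc r ar rb; rewrite /jump.
set L := lim _; apply/eqP; rewrite -normr_le0; apply/ler_addgt0Pl => e e0.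
rewrite addr0; have e3 : 0 < e / 3 by rewrite divr_gt0.
have [||d1 d10 H1] := @cadlag_left R T f r (e / 3) cf; rewrite ?(le_lt_trans a0 ar) ?(le_trans rb)//.
have [d2 d20 H2] : exists2 d, 0 < d & forall x, r <= x -> x < r + d -> x <= b -> `|f x - f r| < e / 3.
  have [rb'|br] := ltP r b; last first.
    exists 1 => // x rx _ xb; have -> : x = r by apply/le_anti; rewrite rx (le_trans xb).
    by rewrite subrr normr0.
  have [||d d0 H] := @cadlag_right R T f r (e/3) cf; rewrite ?(ltW (le_lt_trans a0 ar)) ?(lt_le_trans rb')//.
  by exists d => // x rx xd _; exact: H.
near \oo => m; near \oo => k.
have [k0 kd] : (0 < k)%N /\ (b - a) / k%:R < Num.min d1 d2.
  by near: k; apply: mesh_fine; [exact: ltW|rewrite lt_min d10 d20].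
have oscm : forall i, (i < k)%N -> `|f (mesh a b k i.+1) - f (mesh a b k i)| <= m.+1%:R^-1.
  by near: k; exact: osc.
(* The cell of [r] starts strictly before [r] and ends at or after it, so the two values at its ends
   approximate the left limit [L] and [f r]. *)
have [i ik [ir ri]] := mesh_locate k0 ar rb.
have := H1 (mesh a b k i) _ ir; have := H2 (mesh a b k i.+1) ri _.
have := mesh_le_last (ltW ab) ik.
move: ri ir kd; rewrite !meshS lt_min => ri ir /andP[k1 k2] hb.
move=> /(_ ltac:(lra) hb); rewrite ltr_norml => /andP[? ?].
move=> /(_ ltac:(lra)); rewrite ltr_norml -/L => /andP[? ?].
have : `|f (mesh a b k i.+1) - f (mesh a b k i)| <= e / 3.
  apply: (@le_trans _ _ m.+1%:R^-1).
    exact: oscm.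
  by apply/ltW; near: m; exact: (near_infty_natSinv_lt (PosNum e3)).
rewrite meshS ler_norml => /andP[? ?]; rewrite ler_norml; apply/andP; split; lra.
Unshelve. all: by end_near. Qed.

Lemma finite_jumps f A : (jump_number f A < +oo)%E ->
  finite_set (A `&` [set s | jump f s != 0]).
Proof. by rewrite /jump_number /counting; case: asboolP. Qed.

Lemma jump_number_eq0 f a b :
  (jump_number f `]a, b] == 0%E) <-> nojump f a b.
Proof.
split=> [|nj].
  rewrite /jump_number /counting; case: asboolP => // fs.
  rewrite eqe pnatr_eq0 finmap.cardfs_eq0 => /eqP /(fset_set_set0 fs) J0 r ar rb.
  apply/eqP/negPn/negP => j0; suff : (set0 : set R) r by [].
  by rewrite -J0; split => //=; rewrite in_itv/= ar.
rewrite /jump_number (_ : _ `&` _ = set0) ?/counting; last first.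
  apply/seteqP; split=> // r [] /=; rewrite in_itv/= => /andP[ar rb].
  by rewrite nj// eqxx.
by case: asboolP => [?|]; [rewrite fset_set0|move=> H; exfalso; apply: H].
Qed.

Lemma finite_jump_number f A : finite_set (A `&` [set s | jump f s != 0]) ->
  (jump_number f A \is a fin_num).
Proof. by rewrite /jump_number /counting; case: asboolP. Qed.

Lemma jump_numberD f a b c : a <= b -> b <= c -> (jump_number f `]a, c] < +oo)%E ->
  jump_number f `]a, c] = (jump_number f `]a, b] + jump_number f `]b, c])%E.
Proof.
move=> ab bc /finite_jumps fs.
have E : `]a, c]%classic `&` [set s | jump f s != 0] =
   (`]a, b]%classic `&` [set s | jump f s != 0]) `|` (`]b, c]%classic `&` [set s | jump f s != 0]).
  rewrite -setIUl; congr (_ `&` _); apply/seteqP; split=> r /=; rewrite !in_itv/=.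
    by move=> /andP[ar rc]; case: (leP r b) => rb; [left|right]; rewrite ?ar.
  by case=> /andP[h1 h2]; apply/andP; split=> //; [exact: le_trans bc|exact: le_lt_trans h1].
have fs1 := sub_finite_set (@subsetUl _ _ _) (eq_ind _ finite_set fs _ E).
have fs2 := sub_finite_set (@subsetUr _ _ _) (eq_ind _ finite_set fs _ E).
rewrite /jump_number /counting; do 3 case: asboolP => //.
move=> _ _ _; rewrite E fset_setU// -EFinD -natrD; congr (_%:R%:E).
apply/eqP; rewrite finmap.leq_card_fsetU.
apply/finmap.fdisjointP => r; rewrite !in_fset_set// => /set_mem[/= + _].
rewrite in_itv/= => /andP[_ rb]; apply/negP => /set_mem[/=].
by rewrite in_itv/= => /andP[br _] _; move: rb; rewrite leNgt br.
Qed.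

Lemma jump_sum_nojump f a b : a <= b -> nojump f a b -> jump_sum f b = jump_sum f a.
Proof.
move=> ab nj; apply/esym/fsbig_widen => r /=; rewrite !in_itv/=.
  by move=> /andP[-> /le_trans -> //].
move=> [/andP[r0 rb] /negP]; rewrite r0/= -ltNge => ar; exact: nj.
Qed.

Lemma finite_gap (D : set R) r : finite_set D ->
  exists2 d, 0 < d & forall x, r - d < x -> x < r -> ~ D x.
Proof.
move=> fD; have fD' : finite_set (D `\ r) by exact: finite_setD.
have /closed_openC/(_ r) : closed (D `\ r).
  by apply: (iffLR accessible_finite_set_closed _ _ fD'); exact/hausdorff_accessible/Rhausdorff.
move=> H; have : (~` (D `\ r)) r by move=> [_ /=].
move/H => -[d /= d0 Hd]; exists d => // x rx xr Dx.
have : (~` (D `\ r)) x.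
  by apply: Hd => /=; rewrite ger0_norm ?subr_ge0 ?ltW//; lra.
by apply; split=> //= xr'; move: xr; rewrite xr' ltxx.
Qed.

(** As the jumps are finitely many, [jump_sum f] is constant just to the left of [r]; its left limit
    is its value at a nearby [x0], and passing to [r] adds the single term of [r]. *)
Lemma jump_jump_sum T f r : (jump_number f `]0%R, T] < +oo)%E -> 0 < r -> r <= T ->
  jump (jump_sum f) r = jump f r.
Proof.
move=> /finite_jumps fD r0 rT; set D := (_ `&` _) in fD.
have [d0 d00 Hd] := finite_gap r fD.
(* Taking [d] at most [r] keeps [x0] positive, inside the range of summation. *)
pose d := Num.min d0 r; pose x0 := r - d / 2.
have dp : 0 < d by rewrite lt_min d00 r0.
have [dd0 dr] : d <= d0 /\ d <= r by split; rewrite ge_min lexx ?orbT.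
have x00 : 0 < x0 by rewrite /x0; lra.
have x0r : x0 < r by rewrite /x0; lra.
have nj x y : r - d < x -> x <= y -> y < r -> nojump f x y.
  move=> rx xy yr s xs sy; apply/eqP/negPn/negP => js; apply: (Hd s) => //; rewrite ?(le_lt_trans sy)//; first lra.
  by split => //=; rewrite in_itv/=; apply/andP; split; lra.
have cst x : r - d < x -> x < r -> jump_sum f x = jump_sum f x0.
  move=> rx xr; have [xx0|xx0] := leP x x0.
  - by rewrite -(jump_sum_nojump xx0)//; apply: nj.
  - by apply: jump_sum_nojump; [exact: ltW|apply: nj => //; [rewrite /x0; lra|exact: ltW]].
have -> : jump (jump_sum f) r = jump_sum f r - jump_sum f x0.
  rewrite /jump; congr (_ - _); apply: cvg_lim => //; apply: cvg_near_cst.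
  rewrite near_withinE; exists d => // x /= xd xr; apply: cst => //.
  by move: xd; rewrite ger0_norm ?subr_ge0 ?ltW//; lra.
pose A := `]0, x0]%classic `&` [set s | jump f s != 0].
have fA : finite_set A.
  apply: sub_finite_set fD => s [/=]; rewrite in_itv/= => /andP[s0 sx] js.
  by split=> //=; rewrite in_itv/= s0/=; lra.
have fA' : finite_set (r |` A) by rewrite finite_setU; split.
have -> : jump_sum f r = \sum_(s \in r |` A) jump f s.
  apply/esym/fsbig_widen => s /=.
    by case=> [->|[/=]]; rewrite /= !in_itv/= ?r0 ?lexx// => /andP[-> sx0] _ /=; lra.
  rewrite in_itv/= => -[/andP[s0 sr] nA]; apply/eqP/negPn/negP => js; apply: nA.
  have [->|sr'] := eqVneq s r; [by left|right]; split=> //=; rewrite in_itv/= s0/=.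
  rewrite leNgt; apply/negP => x0s; move/eqP: js; apply.
  have sr2 : s < r by rewrite lt_neqAle sr' sr.
  by apply: (nj x0 s) => //; rewrite /x0 ?ltW//; lra.
rewrite (fsbigD1 r)//=; last by left.
have -> : (r |` A) `\ r = A.
  apply/seteqP; split=> [s [[->|//] /=]|s As]; first by move=> /(_ erefl).
  split; [by right|move=> sr; case: As => /=; rewrite in_itv/= sr => /andP[_]].
  by rewrite leNgt x0r.
rewrite (_ : \sum_(s \in A) _ = jump_sum f x0) ?addrK//.
apply: fsbig_widen => s /=; first by case.
move=> [s0 nA]; apply/eqP/negPn/negP => js; apply: nA; split=> //.
Qed.

Lemma nojump_jump_sum T f a b : (jump_number f `]0%R, T] < +oo)%E -> 0 <= a -> b <= T ->
  nojump (jump_sum f) a b <-> nojump f a b.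
Proof.
move=> fj a0 bT; split=> nj r ar rb; rewrite -?(nj r ar rb).
  by rewrite (jump_jump_sum fj)// ?(le_lt_trans a0 ar)// (le_trans rb).
by rewrite (jump_jump_sum fj)// ?(le_lt_trans a0 ar)// (le_trans rb).
Qed.

Lemma jump_number_jump_sum T f : (jump_number f `]0%R, T] < +oo)%E ->
  (jump_number (jump_sum f) `]0%R, T] < +oo)%E.
Proof.
move=> fj; suff -> : jump_number (jump_sum f) `]0%R, T] = jump_number f `]0, T] by [].
rewrite /jump_number; congr counting; apply/seteqP; split=> r [/=] /andP[r0 r1] jr;
  split=> //=; [by apply/andP| |by apply/andP|]; move: jr;
  by rewrite (jump_jump_sum fj)//; move: r0 r1; rewrite !bnd_simp.
Qed.

(** [Nbar_on] counts the jumps of [jump_sum s]; by [jump_jump_sum] they are those of [s], and the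
    later arguments can be phrased with [nojump] only. *)
Lemma Nbar_on_eq0 T j s a b : (jump_number s `]0%R, T] < +oo)%E -> 0 <= a -> b <= T ->
  Nbar_on j s `]a, b] = 0%E <-> nojump j a b /\ nojump s a b.
Proof.
move=> fs a0 bT; rewrite /Nbar_on.
have ge0 (g : R -> R) A : (0 <= jump_number g A)%E.
  by rewrite /jump_number /counting; case: asboolP.
have := jump_number_eq0 j a b; have := jump_number_eq0 (jump_sum s) a b.
have := nojump_jump_sum fs a0 bT => h1 h2 h3; split.
  move=> /eqP; rewrite padde_eq0// => /andP[/h3 ? /h2/h1 ?] //.
by move=> [/h3/eqP -> /h1/h2/eqP ->]; rewrite adde0.
Qed.

(** Both counts from 0 are finite, so their extended-real difference is a genuine one and additivity
    over adjacent intervals applies. *)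
Lemma in_frakLE T n j s i : (jump_number j `]0%R, T] < +oo)%E ->
  (jump_number s `]0%R, T] < +oo)%E -> 0 <= T -> (0 < i <= n)%N ->
  in_frakL T n j s i =
  (Nbar_on j s `]grid T n i.-1, grid T n i] != 0%E).
Proof.
move=> fj /jump_number_jump_sum fs T0 /andP[i0 iN]; rewrite /in_frakL; congr (_ != _).
have n0 : (0 < n)%N by exact: leq_trans iN.
have g0 : 0 <= grid T n i.-1 by rewrite /grid divr_ge0 ?mulr_ge0.
have g1 : grid T n i.-1 <= grid T n i.
  by rewrite /grid ler_wpM2r ?invr_ge0// ler_wpM2r// ler_nat leq_pred.
have g2 : grid T n i <= T.
  by rewrite /grid ler_pdivrMr ?ltr0n// mulrC ler_wpM2l// ler_nat.
have fin (g : R -> R) : (jump_number g `]0%R, T] < +oo)%E -> forall a b, 0 <= a -> b <= T -> jump_number g `]a, b] \is a fin_num.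
  move=> /finite_jumps fg a b a0 bT; apply/finite_jump_number/(sub_finite_set _ fg).
  by move=> r [/=] /andP[ar rb] jr; split=> //=; apply/andP; split; [exact: le_lt_trans ar|exact: le_trans bT].
have fj' := fin _ fj; have fs' := fin _ fs.
rewrite /Nbar /Nbar_on.
rewrite (@jump_numberD j 0 (grid T n i.-1) (grid T n i))//; last by rewrite -ge0_fin_numE ?fj'// /jump_number /counting; case: asboolP.
rewrite (@jump_numberD (jump_sum s) 0 (grid T n i.-1) (grid T n i))//; last by rewrite -ge0_fin_numE ?fs'// /jump_number /counting; case: asboolP.
have := fj' 0 (grid T n i.-1) (lexx _) (le_trans g1 g2).
have := fs' 0 (grid T n i.-1) (lexx _) (le_trans g1 g2).
have := fj' (grid T n i.-1) (grid T n i) g0 g2.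
have := fs' (grid T n i.-1) (grid T n i) g0 g2.
move: (jump_number _ _) (jump_number (jump_sum s) _) (jump_number j _) (jump_number j _) => [x||] [y||] [z||] [u||]//= _ _ _ _.
by rewrite -!EFinD; congr EFin; ring.
Qed.

End Jumps.

(** * Riemann sums and step approximations of cadlag paths *)

Section Riemann.
Context {R : realType}.
Implicit Types (f : R -> R) (g : nat -> R) (a b t T e : R) (k i : nat).
Let mu := @lebesgue_measure R.

(** For [a = 0] this is the shape of [step_process] on a uniform grid. Hence the same facts serve
    Riemann sums, with values at right ends, and Ito integrands, with values at left ends. *)
Definition stepf a b k g t : R :=
  \sum_(i < k) g i * \1_(`]mesh a b k i, mesh a b k i.+1]) t.

Lemma stepfE a b k g i t : a <= b -> (i < k)%N ->
  mesh a b k i < t -> t <= mesh a b k i.+1 -> stepf a b k g t = g i.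
Proof.
move=> ab ik it ti; rewrite /stepf (bigD1 (Ordinal ik))//= indicE mem_set/=; last first.
  by rewrite /= in_itv/= it ti.
rewrite mulr1 big1 ?addr0// => j ji; rewrite indicE memNset ?mulr0//=.
rewrite in_itv/= => /andP[jt tj]; move/eqP: ji; apply; apply/val_inj => /=.
apply/eqP; rewrite eqn_leq; apply/andP; split.
  rewrite leqNgt; apply/negP => ij; move: (lt_le_trans jt ti).
  by rewrite ltNge (mesh_le _ ab).
rewrite leqNgt; apply/negP => ij; move: (lt_le_trans it tj).
by rewrite ltNge (mesh_le _ ab).
Qed.

Lemma measurable_stepf a b k g (D : set (measurableTypeR R)) : measurable_fun D (stepf a b k g).
Proof.
apply: measurable_sum => i; apply: measurable_funM => //.
Qed.

Lemma itv_oc_mesh_sub a b k i : a <= b -> (i < k)%N ->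
  `]mesh a b k i, mesh a b k i.+1]%classic `<=` `]a, b]%classic.
Proof.
move=> ab ik t /=; rewrite !in_itv/= => /andP[it ti].
by rewrite (le_lt_trans (mesh_ge _ _ ab) it) (le_trans ti)// mesh_le_last.
Qed.

Lemma integrable_indic_itv (D : set (measurableTypeR R)) (x y : R) : measurable D ->
  mu.-integrable D (EFin \o \1_(`]x, y]%classic : set R)).
Proof.
move=> mD; apply: (integrableS measurableT) => //.
apply/integrableP; split; first by apply/measurable_EFinP; exact: measurable_indic.
under eq_integral do rewrite /= ger0_norm//.
rewrite integral_indic//= setIT lebesgue_measure_itv/=.
by case: ifP => // _; rewrite -EFinB ltry.
Qed.

Lemma integral_stepf a b k g : a <= b ->
  (\int[mu]_(t in `]a, b]) (stepf a b k g t)%:E = ((b - a) / k%:R * \sum_(i < k) g i)%:E)%E.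
Proof.
move=> ab; have mD : measurable (`]a, b]%classic : set (measurableTypeR R)) by [].
under eq_integral do rewrite -sumEFin.
rewrite integral_sum//; last first.
  move=> i; have := integrableZl mD (g i) (integrable_indic_itv (mesh a b k i) (mesh a b k i.+1) mD).
  exact.
rewrite mulr_sumr -sumEFin; apply: eq_bigr => i _.
under eq_integral do rewrite EFinM.
rewrite integralZl//; last exact: integrable_indic_itv.
rewrite integral_indic// setIidl; last exact: itv_oc_mesh_sub.
rewrite /= lebesgue_measure_itv/= lte_fin meshS.
case: ifPn => h.
  by rewrite -EFinB -EFinM; congr EFin; rewrite [_ + (b-a)/_]addrC addrK mulrC.
rewrite mule0; congr EFin; rewrite (_ : (b - a) / k%:R = 0) ?mul0r//; apply/le_anti.
by rewrite divr_ge0 ?subr_ge0// andbT; move: h; rewrite ltrDl -leNgt.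
Qed.

(** The right end of the cell of [t] approaches [t] from the right, so convergence holds at jump
    times as well. This is why the Riemann sums take right ends. *)
Lemma stepf_right_cvg T f a b t : cadlag T f -> 0 <= a -> b <= T -> a < t -> t <= b ->
  stepf a b k (fun i => f (mesh a b k i.+1)) t @[k --> \oo] --> f t.
Proof.
move=> cf a0 bT at_ tb; have ab : a < b by exact: lt_le_trans tb.
apply/cvgrPdist_lt => e e0.
have [d d0 H] : exists2 d, 0 < d & forall x, t <= x -> x < t + d -> x <= b -> `|f x - f t| < e.
  have [tb'|bt] := ltP t b; last first.
    exists 1 => // x tx _ xb; have -> : x = t by apply/le_anti; rewrite tx (le_trans xb).
    by rewrite subrr normr0.
  have [||d d0 H] := @cadlag_right R T f t e cf; rewrite ?(ltW (le_lt_trans a0 at_)) ?(lt_le_trans tb')//.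
  by exists d => // x tx xd _; exact: H.
near=> k; have [k0 kd] : (0 < k)%N /\ (b - a) / k%:R < d.
  by near: k; apply: mesh_fine => //; exact: ltW.
have [i ik [it ti]] := mesh_locate k0 at_ tb.
rewrite (stepfE _ (ltW ab) ik it ti) distrC; apply: H => //.
  by rewrite meshS; lra.
by apply: mesh_le_last ik; exact: ltW.
Unshelve. all: by end_near. Qed.

(** Left ends approach [t] strictly from the left and therefore see the left limit, which is [f t]
    in the absence of a jump. *)
Lemma stepf_left_cvg T f a b t : cadlag T f -> 0 <= a -> b <= T -> a < t -> t <= b ->
  jump f t = 0 ->
  stepf a b k (fun i => f (mesh a b k i)) t @[k --> \oo] --> f t.
Proof.
move=> cf a0 bT at_ tb jt; have ab : a < b by exact: lt_le_trans tb.
apply/cvgrPdist_lt => e e0.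
have [|d d0 H] := cadlag_left_nojump cf _ e0 jt.
  by rewrite (le_lt_trans a0 at_) (le_trans tb bT).
near=> k; have [k0 kd] : (0 < k)%N /\ (b - a) / k%:R < d.
  by near: k; apply: mesh_fine => //; exact: ltW.
have [i ik [it ti]] := mesh_locate k0 at_ tb.
rewrite (stepfE _ (ltW ab) ik it ti) distrC; apply: H; last exact: ltW.
by move: ti; rewrite meshS; lra.
Unshelve. all: by end_near. Qed.

Lemma stepf_bounded a b k g M t : a <= b -> 0 <= M -> (forall i, (i < k)%N -> `|g i| <= M) ->
  `|stepf a b k g t| <= M.
Proof.
move=> ab M0 gM; have [/andP[at_ tb]|h] := boolP ((a < t) && (t <= b)).
  have [k0|k0] := posnP k; first by rewrite k0 /stepf big_ord0 normr0.
  have [i ik [it ti]] := mesh_locate k0 at_ tb.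
  by rewrite (stepfE _ ab ik it ti) gM.
rewrite /stepf big1 ?normr0// => i _; rewrite indicE memNset ?mulr0//.
by move/(itv_oc_mesh_sub ab (ltn_ord i)) => /=; rewrite in_itv/=; exact/negP.
Qed.

Lemma itv_oc_bounded_integrable a b M :
  mu.-integrable (`]a, b]%classic) (fun=> (M%:E)%E).
Proof.
apply/integrableP; split; first exact: measurable_cst.
under eq_integral do rewrite /=.
rewrite (integral_cst _ _ `|M%:E|)//= lebesgue_measure_itv/=.
by case: ifP => _; rewrite ?mule0// -EFinB -EFinM ltry.
Qed.

(** Dominated convergence for the right-end step functions, whose pointwise limit also gives the
    measurability of [f]. The convergent sums transfer measurability in omega and moment bounds to
    time integrals. *)
Lemma cadlag_integral_cvg T f a b : cadlag T f -> 0 <= a -> a <= b -> b <= T ->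
  mu.-integrable `]a, b] (EFin \o f) /\
  ((b - a) / k%:R * \sum_(i < k) f (mesh a b k i.+1)) @[k --> \oo] -->
    \int[mu]_(t in `]a, b]) f t.
Proof.
move=> cf a0 ab bT; have T0 : 0 <= T by exact: le_trans (le_trans ab bT).
have [M M0 HM] := cadlag_bounded T0 cf.
have mD : measurable (`]a, b]%classic : set (measurableTypeR R)) by [].
pose f_ k (t : measurableTypeR R) := (stepf a b k (fun i => f (mesh a b k i.+1)) t)%:E.
have mf k : measurable_fun `]a, b] (f_ k) by apply/measurable_EFinP; exact: measurable_stepf.
have fcvg t : `]a, b]%classic t -> f_ k t @[k --> \oo] --> (f t)%:E.
  rewrite /= in_itv/= => /andP[at_ tb]; apply: cvg_EFin; first by apply: nearW.
  exact: (stepf_right_cvg cf).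
have fM k t : `]a, b]%classic t -> (`|f_ k t| <= M%:E)%E.
  move=> _; rewrite lee_fin; apply: stepf_bounded => //; first exact: ltW.
  by move=> i ik; apply: HM; rewrite (le_trans a0)/= ?mesh_ge// (le_trans _ bT)// mesh_le_last.
have ig := itv_oc_bounded_integrable a b M.
have mfl : measurable_fun `]a, b] (EFin \o f : measurableTypeR R -> \bar R).
  exact: (emeasurable_fun_cvg f_ _ mf fcvg).
have := @dominated_convergence _ _ _ mu _ mD f_ (EFin \o f) (cst M%:E) mf mfl _ ig _.
move=> /(_ _ _)[||intf _ c].
- by apply: aeW => t tab; exact: fcvg.
- by apply: aeW => t k; exact: fM.
split => //; move: c.
rewrite (_ : (fun k => _) = (fun k => ((b - a) / k%:R * \sum_(i < k) f (mesh a b k i.+1))%:E)); last first.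
  by apply/funext => k; rewrite integral_stepf.
have /fineK <- : (\int[mu]_(t in `]a, b]) (f t)%:E)%E \is a fin_num by exact: integrable_fin_num.
by move/fine_cvg.
Qed.

(** Left-end steps converge off the jump times, which are finitely many and thus Lebesgue-null;
    boundedness of the path gives the dominating constant. *)
Lemma cadlag_left_step_L2 T f : 0 < T -> cadlag T f -> (jump_number f `]0%R, T] < +oo)%E ->
  (\int[mu]_(t in `[0%R, T]) ((stepf 0 T k (fun i => f (mesh 0 T k i)) t - f t) ^+ 2)%:E)%E
   @[k --> \oo] --> 0%E.
Proof.
move=> T0 cf /finite_jumps fj.
have [M M0 HM] := cadlag_bounded (ltW T0) cf.
have mD : measurable (`]0, T]%classic : set (measurableTypeR R)) by [].
have [/integrableP[/measurable_EFinP mf _] _] := cadlag_integral_cvg cf (lexx 0) (ltW T0) (lexx T).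
pose g_ k (t : measurableTypeR R) := ((stepf 0 T k (fun i => f (mesh 0 T k i)) t - f t) ^+ 2)%:E.
have mg k : measurable_fun `]0, T] (g_ k).
  apply/measurable_EFinP; apply: measurable_funX; apply: measurable_funB => //.
  exact: measurable_stepf.
have -> : (fun k => (\int[mu]_(t in `[0%R, T]) ((stepf 0 T k (fun i => f (mesh 0 T k i)) t - f t) ^+ 2)%:E)%E)
  = (fun k => \int[mu]_(t in `]0%R, T]) g_ k t)%E.
  by apply/funext => k; apply/esym/integral_itv_obnd_cbnd; exact: (mg k).
have := @dominated_convergence _ _ _ mu _ mD g_ (cst 0%E) (cst ((M + M) ^+ 2)%:E)
   mg (measurable_cst _) _ (itv_oc_bounded_integrable _ _ _) _.
move=> /(_ _ _)[||_ _]; last by rewrite integral0.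
- exists (`]0, T]%classic `&` [set s | jump f s != 0]); split.
  + apply: countable_measurable; last exact: finite_set_countable.
    by move=> t; exact: (@measurable_set1 R t).
  + by apply: countable_lebesgue_measure0; exact: finite_set_countable.
  + move=> t /= /not_implyP[tT H]; split => //; apply/eqP => jt; apply: H.
    move: tT; rewrite in_itv/= => /andP[t0 tT].
    rewrite /g_ -[0%E]/(0%:E); apply: cvg_EFin; first exact: nearW.
    have h := stepf_left_cvg cf (lexx 0) (lexx T) t0 tT jt.
    have h2 : stepf 0 T k (fun i => f (mesh 0 T k i)) t - f t @[k --> \oo] --> (0 : R).
      rewrite -[X in _ --> X](subrr (f t)); apply: (@cvgB _ _ _ _ _ _ (cst (f t)) _ _ h).
      exact: cvg_cst.
    pose u k := stepf 0 T k (fun i => f (mesh 0 T k i)) t - f t.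
    have h3 : u k * u k @[k --> \oo] --> (0 : R).
      by rewrite -[X in _ --> X](mulr0 0); apply: cvgM.
    apply: cvg_trans h3; apply: near_eq_cvg.
    by apply: nearW => k /=; rewrite expr2.
- apply: aeW => t k /=; rewrite in_itv/= => /andP[t0 tT].
  rewrite lee_fin ger0_norm ?sqr_ge0// -real_normK ?num_real// lerXn2r ?nnegrE ?addr_ge0 ?(ltW M0)//.
  rewrite (le_trans (ler_normB _ _))// lerD//; last by rewrite HM// (ltW t0) tT.
  apply: stepf_bounded; rewrite ?ltW// => i ik; apply: HM.
  by apply: mesh_itv; [exact: ltW|exact: ltnW].
Qed.

End Riemann.

(** * Moments and independence *)

Section Moments.
Local Open Scope ereal_scope.
Context {R : realType} {d : measure_display} {Omega : measurableType d}.
Variable P : probability Omega R.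
Implicit Types (X Y Z : Omega -> R) (m k : nat) (C : R).

(* The integral of a non-measurable nonnegative function is a lower integral,
   hence still monotone. *)
Lemma le_lower_integral (f g : Omega -> \bar R) : (forall x, 0 <= f x) ->
  (forall x, f x <= g x) -> \int[P]_x f x <= \int[P]_x g x.
Proof.
move=> f0 fg; have g0 x : 0 <= g x by exact: le_trans (fg x).
rewrite !ge0_integralTE//; apply: ereal_sup_le => _ [h /= hf <-].
by exists h => //= x; apply: le_trans (fg x).
Qed.

(** The integral itself, with no root taken, so that additivity of integrals applies directly. *)
Definition moment m Y : \bar R := \int[P]_x (`|Y x| ^+ m)%:E.

Lemma moment_ge0 m Y : 0 <= moment m Y.
Proof. by apply: integral_ge0 => x _; rewrite lee_fin exprn_ge0. Qed.

Lemma moment_le m X Y : (forall x, `|X x| <= `|Y x|)%R -> moment m X <= moment m Y.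
Proof.
move=> XY; apply: le_lower_integral => x; rewrite lee_fin ?exprn_ge0//.
by rewrite lerXn2r ?nnegrE.
Qed.

Lemma measurable_absX m Y : measurable_fun setT Y ->
  measurable_fun setT (fun x => (`|Y x| ^+ m)%:E).
Proof.
move=> mY; apply/measurable_EFinP; apply: measurable_funX.
exact: measurableT_comp.
Qed.

(** The null set is discarded from the integral of the measurable [X]; what remains is a comparison
    of lower integrals. *)
Lemma moment_ae_le m X Y (N : set Omega) : measurable_fun setT X -> measurable N -> P N = 0 ->
  (forall x, ~ N x -> `|X x| <= `|Y x|)%R -> moment m X <= moment m Y.
Proof.
move=> mX mN N0 XY.
rewrite /moment (ge0_negligible_integral mN measurableT)//; last exact: measurable_absX.
rewrite integral_mkcond; apply: le_lower_integral => x; rewrite patchE.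
  by case: ifP => // _; rewrite lee_fin exprn_ge0.
case: ifPn => [/set_mem[_ /= Nx]|_]; rewrite lee_fin ?exprn_ge0//.
by rewrite lerXn2r ?nnegrE// XY.
Qed.

Lemma moment_Lnorm m Y C : (0 < m)%N -> 'N[P]_(m%:R%:E)[EFin \o Y] <= C%:E ->
  moment m Y <= (`|C| ^+ m)%:E.
Proof.
move=> m0 NC; have m0' : (0 < m%:R :> R)%R by rewrite ltr0n.
have {}NC : 'N[P]_(m%:R%:E)[EFin \o Y] <= `|C|%:E.
  by apply: le_trans NC _; rewrite lee_fin ler_norm.
have : ('N[P]_(m%:R%:E)[EFin \o Y] `^ m%:R)%E <= (`|C|%:E `^ m%:R)%E.
  by rewrite gt0_ler_poweR// ?in_itv/= ?leey ?andbT ?Lnorm_ge0 ?lee_fin// ltW.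
rewrite poweR_EFin powR_mulrn// unlock; apply: le_trans.
rewrite -poweRrM mulVf ?gt_eqF// poweRe1; last first.
  by apply: integral_ge0 => x _; exact: poweR_ge0.
rewrite le_eqVlt; apply/orP; left; apply/eqP; apply: eq_integral => x _.
by rewrite /= -powR_mulrn.
Qed.

Lemma markov_moment m Y C t : measurable_fun setT Y -> (0 < t)%R -> moment m Y <= C%:E ->
  P [set x | t < `|Y x|]%R <= (C / t ^+ m)%:E.
Proof.
move=> mY t0 YC.
have mS : measurable [set x | t < `|Y x|]%R.
  have mY' : measurable_fun setT (fun x => `|Y x|%R) by exact: measurableT_comp.
  have := mY' measurableT _ (measurable_itv `]t, +oo[).
  by rewrite setTI; congr measurable; apply/seteqP; split=> x /=; rewrite in_itv/= andbT.
have tm : (0 < t ^+ m)%R by rewrite exprn_gt0.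
rewrite EFinM lee_pdivlMr//; apply: le_trans YC.
rewrite muleC -[P _]mul1e -integral_cst// -?ge0_integralZl_EFin//; last exact: ltW.
rewrite integral_mkcond; apply: le_lower_integral => x; rewrite patchE; case: ifPn => //= H.
- by rewrite mule_ge0// lee_fin ltW.
- by rewrite mule1 lee_fin lerXn2r ?nnegrE ?(ltW t0)//; apply/ltW; move/set_mem: H.
- by rewrite lee_fin exprn_ge0.
Qed.

(** Fatou's lemma, the lower limit being a limit by continuity of the power of the norm. *)
Lemma moment_cvg m (Y_ : nat -> Omega -> R) Y C : (forall k, measurable_fun setT (Y_ k)) ->
  (forall x, Y_ k x @[k --> \oo] --> Y x) ->
  (forall k, moment m (Y_ k) <= C%:E) -> moment m Y <= C%:E.
Proof.
move=> mY YY YC.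
have cv x : (`|Y_ k x| ^+ m)%:E @[k --> \oo] --> (`|Y x| ^+ m)%:E.
  apply: cvg_EFin; first exact: nearW.
  have c : {for Y x, continuous (fun u : R => `|u| ^+ m)%R}.
    apply: (continuous_comp (f := fun u : R => `|u|%R) (g := fun u : R => u ^+ m)%R).
      exact: norm_continuous.
    exact: exprn_continuous.
  exact: (continuous_cvg _ c (YY x)).
rewrite /moment; have -> : (fun x => (`|Y x| ^+ m)%:E) =
   (fun x => limn_einf (fun k => (`|Y_ k x| ^+ m)%:E)).
  by apply/funext => x; rewrite (cvg_limn_einf_sup (cv x)).
apply: le_trans (fatou _ _ _ _) _ => //.
- by move=> k; exact: measurable_absX.
rewrite limn_einf_lim; apply: lime_le; first exact: is_cvg_einfs.
apply: nearW => k; apply: le_trans (YC k).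
by apply: ereal_inf_lbound; exists k => /=.
Qed.

Lemma expect_cst (c : R) : \int[P]_x c%:E = c%:E.
Proof.
rewrite (_ : (fun _ => _) = cst c%:E)//.
by rewrite integral_cst//= probability_setT mule1.
Qed.

Lemma ge0_expectD (f g : Omega -> R) : measurable_fun setT f -> measurable_fun setT g ->
  (forall x, 0 <= f x)%R -> (forall x, 0 <= g x)%R ->
  \int[P]_x (f x + g x)%:E = \int[P]_x (f x)%:E + \int[P]_x (g x)%:E.
Proof.
move=> mf mg f0 g0; under eq_integral do rewrite EFinD.
rewrite ge0_integralD//; try by move=> x _; rewrite lee_fin.
- exact/measurable_EFinP.
- exact/measurable_EFinP.
Qed.

Lemma ge0_expectZ (c : R) (f : Omega -> R) : measurable_fun setT f -> (0 <= c)%R ->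
  (forall x, 0 <= f x)%R ->
  \int[P]_x (c * f x)%:E = c%:E * \int[P]_x (f x)%:E.
Proof.
move=> mf c0 f0; under eq_integral do rewrite EFinM.
by rewrite ge0_integralZl_EFin//; [move=> x _; rewrite lee_fin|exact/measurable_EFinP].
Qed.

Lemma ge0_expect_sum (I : Type) (r : seq I) (f : I -> Omega -> R) :
  (forall i, measurable_fun setT (f i)) -> (forall i x, 0 <= f i x)%R ->
  \int[P]_x (\sum_(i <- r) f i x)%:E = \sum_(i <- r) \int[P]_x (f i x)%:E.
Proof.
move=> mf f0; under eq_integral do rewrite -sumEFin.
rewrite ge0_integral_sum//; last by move=> i x _; rewrite lee_fin.
by move=> i; exact/measurable_EFinP.
Qed.

Lemma exprD_le (a b : R) m : (`|a + b| ^+ m <= 2 ^+ m * (`|a| ^+ m + `|b| ^+ m))%R.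
Proof.
wlog ab : a b / (`|a| <= `|b|)%R.
  by move=> H; case: (leP `|a|%R `|b|%R) => [/H//|/ltW/H]; rewrite addrC [X in (_ * X)%R]addrC.
apply: (@le_trans _ _ ((2 * `|b|) ^+ m)%R).
  by rewrite lerXn2r ?nnegrE ?mulr_ge0// (le_trans (ler_normD _ _))// mulr_natl mulr2n lerD2r.
by rewrite exprMn ler_wpM2l ?exprn_ge0// lerDr exprn_ge0.
Qed.

Lemma moment_add m X Y C C' : measurable_fun setT X -> measurable_fun setT Y ->
  moment m X <= C%:E -> moment m Y <= C'%:E ->
  moment m (fun x => X x + Y x)%R <= (2 ^+ m * (C + C'))%:E.
Proof.
move=> mX mY XC YC.
have mX' := iffLR (measurable_EFinP _ _) (measurable_absX m mX).
have mY' := iffLR (measurable_EFinP _ _) (measurable_absX m mY).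
apply: le_trans (_ : \int[P]_x (2 ^+ m * (`|X x| ^+ m + `|Y x| ^+ m))%:E <= _).
  by apply: le_lower_integral => x; rewrite lee_fin ?exprn_ge0// exprD_le.
rewrite ge0_expectZ ?exprn_ge0//; last first.
  exact: measurable_funD.
by rewrite EFinM lee_pmul2l// ?lte_fin ?exprn_gt0// ge0_expectD// ?EFinD ?leeD// => x; rewrite exprn_ge0.
Qed.

(* AM-GM, with the scales a and b of the two factors made explicit. *)
Lemma moment_mul m X Y (a b C C' : R) : measurable_fun setT X -> measurable_fun setT Y ->
  (0 < a)%R -> (0 < b)%R ->
  moment m.*2 X <= (C * a ^+ m.*2)%:E -> moment m.*2 Y <= (C' * b ^+ m.*2)%:E ->
  moment m (fun x => X x * Y x)%R <= ((C + C') * (a * b) ^+ m)%:E.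
Proof.
move=> mX mY a0 b0 XC YC.
have mX' := iffLR (measurable_EFinP _ _) (measurable_absX m.*2 mX).
have mY' := iffLR (measurable_EFinP _ _) (measurable_absX m.*2 mY).
have h1 : (0 <= b ^+ m / a ^+ m)%R by rewrite divr_ge0 ?exprn_ge0// ltW.
have h2 : (0 <= a ^+ m / b ^+ m)%R by rewrite divr_ge0 ?exprn_ge0// ltW.
apply: le_trans (_ : \int[P]_x ((b ^+ m / a ^+ m) * `|X x| ^+ m.*2 + (a ^+ m / b ^+ m) * `|Y x| ^+ m.*2)%:E <= _).
  apply: le_lower_integral => x; rewrite lee_fin ?exprn_ge0//.
  rewrite normrM exprMn -!muln2 !exprM.
  move: (`|X x| ^+ m)%R (`|Y x| ^+ m)%R (exprn_ge0 m (normr_ge0 (X x))) (exprn_ge0 m (normr_ge0 (Y x))) => u v u0 v0.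
  have p0 : (0 < a ^+ m)%R by rewrite exprn_gt0.
  have q0 : (0 < b ^+ m)%R by rewrite exprn_gt0.
  move: (a ^+ m)%R (b ^+ m)%R p0 q0 => p q p0 q0.
  rewrite -subr_ge0.
  have -> : (q / p * u ^+ 2 + p / q * v ^+ 2 - u * v = ((q * u - p * v) ^+ 2 + (q * u) * (p * v)) / (p * q))%R.
    by field; rewrite !gt_eqF.
  by rewrite divr_ge0 ?addr_ge0 ?sqr_ge0 ?mulr_ge0// ltW.
rewrite ge0_expectD//; last 4 first.
- exact: measurable_funM.
- exact: measurable_funM.
- by move=> x; rewrite mulr_ge0 ?exprn_ge0.
- by move=> x; rewrite mulr_ge0 ?exprn_ge0.
rewrite !ge0_expectZ//; try by move=> x; rewrite exprn_ge0.
apply: (le_trans (leeD (lee_wpmul2l _ XC) (lee_wpmul2l _ YC))); rewrite ?lee_fin//.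
rewrite -!muln2 !exprM exprMn le_eqVlt; apply/orP; left; apply/eqP.
by field; rewrite ?expf_neq0 ?gt_eqF.
Qed.

(** Writing (1 + x)^2 = 1 + y with y = 2x + x^2 >= -1 brings every real [x] into the range of
    Bernoulli's inequality, applied to [y]; the square x^2 is then dropped. *)
Lemma bernoulli_even (x : R) k : (1 + k.*2%:R * x <= (1 + x) ^+ k.*2)%R.
Proof.
rewrite -mul2n exprM.
have h : (-1 <= x + x + x ^+ 2)%R.
  by rewrite -subr_ge0 (_ : _ - _ = (1 + x) ^+ 2)%R ?sqr_ge0//; ring.
have -> : ((1 + x) ^+ 2 = 1 + (x + x + x ^+ 2))%R by ring.
set y := (x + x + x ^+ 2)%R in h *.
apply: (@le_trans _ _ (1 + k%:R * y)%R).
  rewrite lerD2l mulnC natrM -mulrA ler_wpM2l//.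
  by rewrite /y (_ : 2%:R * x = x + x)%R ?lerDl ?sqr_ge0//; ring.
elim: k => [|k IH]; first by rewrite expr0 mul0r addr0.
rewrite exprS; apply: (@le_trans _ _ ((1 + y) * (1 + k%:R * y))%R).
  rewrite -natr1 -subr_ge0 (_ : _ - _ = k%:R * y ^+ 2)%R; last by ring.
  by rewrite mulr_ge0 ?sqr_ge0.
by rewrite ler_wpM2l// addrC -lerBlDr sub0r.
Qed.

(** Jensen's inequality: an even power lies above its tangent at the mean [a], which is
    [bernoulli_even] at [(y i - a) / a], and the linear terms of the tangents sum to zero. *)
Lemma power_mean k n (y : nat -> R) : (0 < n)%N ->
  (`|n%:R^-1 * \sum_(i < n) y i| ^+ k.*2 <= n%:R^-1 * \sum_(i < n) `|y i| ^+ k.*2)%R.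
Proof.
move=> n0; set a := (_ * \sum_(i < n) y i)%R.
have nn : (n%:R != 0 :> R)%R by rewrite pnatr_eq0 -lt0n.
have eabs (u : R) : (`|u| ^+ k.*2 = u ^+ k.*2)%R.
  by rewrite -mul2n !exprM real_normK ?num_real.
rewrite eabs; under eq_bigr do rewrite eabs.
have [a0|a0] := eqVneq a 0%R.
  rewrite a0 expr0n; case: eqP => [->|_] /=.
    under eq_bigr do rewrite expr0.
    by rewrite sumr_const card_ord mulVf.
  rewrite mulr_ge0 ?invr_ge0// sumr_ge0// => i _; rewrite -mul2n exprM exprn_ge0// sqr_ge0//.
have tangent i : (a ^+ k.*2 + k.*2%:R * a ^+ k.*2.-1 * (y i - a) <= y i ^+ k.*2)%R.
  case: k {eabs} => [|k]; first by rewrite !expr0 mul0r mul0r addr0.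
  have := bernoulli_even ((y i - a) / a) k.+1.
  have p0 : (0 <= a ^+ k.+1.*2)%R by rewrite -mul2n exprM exprn_ge0// sqr_ge0.
  move/(ler_wpM2l p0); rewrite -exprMn.
  rewrite (_ : a * (1 + (y i - a) / a) = y i)%R; last by field.
  apply: le_trans; rewrite le_eqVlt; apply/orP; left; apply/eqP.
  by rewrite doubleS /= exprS; field.
rewrite ler_pdivlMl ?ltr0n//.
apply: le_trans (ler_sum _ (fun (i : 'I_n) _ => tangent i)).
rewrite big_split/= sumr_const card_ord -mulr_sumr sumrB sumr_const card_ord.
rewrite (_ : \sum_(i < n) y i = n%:R * a)%R; last by rewrite /a mulrA divff ?mul1r.
rewrite (_ : a *+ n = n%:R * a)%R; last by rewrite mulr_natl.
by rewrite subrr mulr0 addr0 mulr_natl.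
Qed.

Lemma moment_mean k n (Y_ : nat -> Omega -> R) C : (0 < n)%N ->
  (forall i, measurable_fun setT (Y_ i)) ->
  (forall i, (i < n)%N -> moment k.*2 (Y_ i) <= C%:E) ->
  moment k.*2 (fun x => n%:R^-1 * \sum_(i < n) Y_ i x)%R <= C%:E.
Proof.
move=> n0 mY YC.
have mY' i := iffLR (measurable_EFinP _ _) (measurable_absX k.*2 (mY i)).
apply: le_trans (_ : \int[P]_x (n%:R^-1 * \sum_(i < n) `|Y_ i x| ^+ k.*2)%:E <= _).
  apply: le_lower_integral => x; rewrite lee_fin ?exprn_ge0//.
  exact: (power_mean k (fun i => Y_ i x)).
rewrite ge0_expectZ ?invr_ge0//; last 2 first.
- by apply: measurable_sum => i.
- by move=> x; apply: sumr_ge0 => i _; rewrite exprn_ge0.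
rewrite ge0_expect_sum//.
apply: le_trans (_ : n%:R^-1%:E * (\sum_(i < n) C%:E) <= _).
  by apply: lee_wpmul2l; [rewrite lee_fin invr_ge0|apply: lee_sum => i _; exact: YC].
rewrite sumEFin -EFinM lee_fin sumr_const card_ord -[(C *+ n)%R]mulr_natl mulrA mulVf ?mul1r//.
by rewrite pnatr_eq0 -lt0n.
Qed.

End Moments.

(** * Limits in probability and independence *)

Section Independence.
Local Open Scope ereal_scope.
Context {R : realType} {d : measure_display} {Omega : measurableType d}.
Variable P : probability Omega R.
Implicit Types (U V X Y Z : Omega -> R) (m k : nat) (C : R) (G : set (set Omega)).

(** Where the error is less than [e], |Y| is at most |Y_k| + e; elsewhere [Y], truncated at [L],
    contributes at most L^m times a vanishing probability. Letting [k] and then [L] tend to infinity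
    gives the bound, and the factor 2^m comes from [exprD_le]. *)
Lemma moment_cvg_proba m (Y_ : nat -> Omega -> R) Y C : (0 < m)%N ->
  (forall k, measurable_fun setT (Y_ k)) -> measurable_fun setT Y ->
  cvg_proba0 P (fun k x => `|Y_ k x - Y x|%:E) ->
  (forall k, moment P m (Y_ k) <= C%:E) -> moment P m Y <= (2 ^+ m * C)%:E.
Proof.
move=> m0 mY_ mY cY YC.
apply/lee_addgt0Pr => e0 e00.
(* As e <= 1, e^m <= e holds for m > 0, so the second entry suffices for [eme]. *)
pose e := Num.min 1%R (e0 / 2 ^+ m)%R.
have e0p : (0 < e)%R by rewrite lt_min ltr01 divr_gt0// exprn_gt0.
have eme : (2 ^+ m * e ^+ m <= e0)%R.
  rewrite -ler_pdivlMl ?exprn_gt0// mulrC; apply: (@le_trans _ _ e); last first.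
    by rewrite /e ge_min lexx orbT.
  have e1 : (e <= 1)%R by rewrite /e ge_min lexx.
    by rewrite -{2}(expr1 e) ler_wiXn2l// ltW.
apply: (@le_trans _ _ (2 ^+ m * (C + e ^+ m))%:E); last first.
  by rewrite -EFinD lee_fin mulrDr lerD2l.
pose YL (L : nat) x : R := (Y x * \1_[set y | `|Y y| <= L%:R]%R x)%R.
have mS (L : nat) : measurable [set y | `|Y y| <= L%:R]%R.
  have mY' : measurable_fun setT (fun x => `|Y x|%R) by exact: measurableT_comp.
  have := mY' measurableT _ (measurable_itv `]-oo, L%:R]).
  by rewrite setTI; congr measurable; apply/seteqP; split=> x /=; rewrite in_itv/=.
apply: (@moment_cvg _ _ _ _ _ YL).
- move=> L; apply: measurable_funM => //; exact: measurable_indic.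
- move=> x; apply: cvg_near_cst; exists (Num.truncn `|Y x|).+1 => // L /= LL.
  rewrite /YL indicE mem_set ?mulr1//=.
  have /andP[_ /ltW/le_trans] := @truncn_itv _ `|Y x|%R (normr_ge0 _); apply.
  by rewrite ler_nat.
move=> L.
have mB k : measurable [set x | e%:E <= `|Y_ k x - Y x|%:E].
  have mY' : measurable_fun setT (fun x => `|Y_ k x - Y x|%R).
    by apply: measurableT_comp => //; exact: measurable_funB.
  have := mY' measurableT _ (measurable_itv `[e, +oo[).
  by rewrite setTI; congr measurable; apply/seteqP; split=> x /=; rewrite in_itv/= andbT lee_fin.
have H k : moment P m (YL L) <= (2 ^+ m * (C + e ^+ m))%:E + (L%:R ^+ m)%:E * P [set x | e%:E <= `|Y_ k x - Y x|%:E].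
  set B := [set x | _]; have mYk := iffLR (measurable_EFinP _ _) (measurable_absX m (mY_ k)).
  apply: le_trans (_ : \int[P]_x (2 ^+ m * (`|Y_ k x| ^+ m + e ^+ m) + L%:R ^+ m * \1_B x)%:E <= _).
    apply: le_lower_integral => x; rewrite lee_fin ?exprn_ge0//.
    have [Bx|Bx] := pselect (B x).
      rewrite [\1_B _]indicE mem_set// mulr1 /YL indicE.
      have [YLx|YLx] := pselect (`|Y x| <= L%:R)%R.
        rewrite mem_set// mulr1 ler_wpDl ?mulr_ge0 ?addr_ge0 ?exprn_ge0 ?(ltW e0p)//.
        by rewrite lerXn2r ?nnegrE.
      rewrite memNset// mulr0 normr0 expr0n gtn_eqF//=.
      by rewrite addr_ge0 ?mulr_ge0 ?addr_ge0 ?exprn_ge0 ?(ltW e0p).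
    rewrite [\1_B _]indicE memNset// mulr0 addr0.
    apply: (@le_trans _ _ (`|Y x| ^+ m)%R).
      rewrite lerXn2r ?nnegrE// /YL normrM ler_piMr// indicE; case: (_ \in _); by rewrite ?normr1 ?normr0.
    have -> : Y x = (Y_ k x + (Y x - Y_ k x))%R by rewrite addrC subrK.
    apply: le_trans (exprD_le _ _ _) _; rewrite ler_wpM2l ?exprn_ge0// lerD2l.
    by rewrite lerXn2r ?nnegrE ?(ltW e0p)// ltW// ltNge distrC; exact/negP.
  have mI : measurable_fun setT (fun x => L%:R ^+ m * \1_B x : R)%R.
    by apply: measurable_funM; [exact: measurable_cst|apply: measurable_indic; exact: mB].
  rewrite ge0_expectD//; last 2 first.
  - apply: measurable_funM => //; exact: measurable_funD.
  - by move=> x; rewrite mulr_ge0 ?addr_ge0 ?exprn_ge0 ?(ltW e0p).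
  rewrite leeD//.
    rewrite ge0_expectZ ?exprn_ge0//; last 2 first.
    - exact: measurable_funD.
    - by move=> x; rewrite addr_ge0 ?exprn_ge0 ?(ltW e0p).
    rewrite EFinM lee_pmul2l// ?lte_fin ?exprn_gt0// ge0_expectD//; last first.
      by move=> x; rewrite exprn_ge0 ?(ltW e0p).
    rewrite EFinD leeD//; first exact: YC.
    by rewrite expect_cst.
  rewrite ge0_expectZ ?exprn_ge0//; last by apply: measurable_indic; exact: mB.
  by rewrite (@integral_indic _ _ _ P _ measurableT _ (mB k)) setIT.
have := cY e e0p => cv.
have cv2 : (2 ^+ m * (C + e ^+ m))%:E + (L%:R ^+ m)%:E * P [set x | e%:E <= `|Y_ k x - Y x|%:E] @[k --> \oo]
   --> (2 ^+ m * (C + e ^+ m))%:E + (L%:R ^+ m)%:E * 0.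
  by apply: cvgeD => //; [exact: cvg_cst|exact: cvgeZl].
rewrite mule0 adde0 in cv2.
rewrite -(cvg_lim _ cv2)//; apply: lime_ge; first by apply/cvg_ex; eexists; exact: cv2.
by apply: nearW => k; exact: H.
Qed.

Definition indep_of G V := forall (A : set Omega) (B : set R), G A -> measurable B ->
  P (A `&` V @^-1` B) = P A * P (V @^-1` B).

(** The law of the pair agrees with the product of the laws on rectangles, hence everywhere, and
    Tonelli's theorem factors the integral. *)
Lemma indep_expectM G U V : G `<=` measurable -> measurable_wrt G U ->
  measurable_fun setT V -> indep_of G V ->
  \int[P]_x (`|U x| * `|V x|)%:E = \int[P]_x `|U x|%:E * \int[P]_x `|V x|%:E.
Proof.
move=> Gm GU mV ind.
have mU : measurable_fun setT U.
  by move=> _ B mB; rewrite setTI; exact/Gm/GU.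
pose UU : {RV P >-> R} := HB.pack U (isMeasurableFun.Build _ _ _ _ _ mU).
pose VV : {RV P >-> R} := HB.pack V (isMeasurableFun.Build _ _ _ _ _ mV).
have mW : measurable_fun setT (fun x => (U x, V x)) by exact: measurable_fun_pair.
pose W : {RV P >-> (R * R)%type} := HB.pack (fun x => (U x, V x)) (isMeasurableFun.Build _ _ _ _ _ mW).
have key A B : measurable A -> measurable B ->
   distribution P W (A `*` B) = distribution P UU A * distribution P VV B.
  move=> mA mB; rewrite /distribution /pushforward /=.
  by have := ind _ _ (GU _ mA) mB; apply: etrans; congr (P _).
have key2 := @product_measure_unique _ _ _ _ _ (distribution P UU) (distribution P VV) (distribution P W) key.
pose f (z : R * R) : \bar R := (`|z.1| * `|z.2|)%:E.
have mf : measurable_fun setT f.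
  apply/measurable_EFinP; apply: measurable_funM; apply: measurableT_comp => //.
transitivity (\int[distribution P W]_z f z).
  rewrite /distribution ge0_integral_pushforward//; last by move=> z _; rewrite lee_fin mulr_ge0.
transitivity (\int[distribution P UU \x distribution P VV]_z f z).
  by apply: eq_measure_integral => A mA _; exact/esym/key2.
rewrite fubini_tonelli1//; last by move=> z; rewrite lee_fin mulr_ge0.
rewrite /fubini_F /f /=.
have mn : measurable_fun [set: R] (fun x : R => `|x|%:E) by apply/measurable_EFinP; exact: normr_measurable.
transitivity (\int[distribution P UU]_x (`|x|%:E * \int[distribution P VV]_y `|y|%:E)).
  apply: eq_integral => x _; under eq_integral do rewrite EFinM.
  by rewrite ge0_integralZl.
rewrite ge0_integralZr//; last by apply: integral_ge0.
by congr (_ * _); rewrite /distribution ge0_integral_pushforward.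
Qed.

Lemma measurable_wrtW G U : G `<=` measurable -> measurable_wrt G U -> measurable_fun setT U.
Proof. by move=> Gm GU _ B mB; rewrite setTI; exact/Gm/GU. Qed.

Lemma measurable_wrt_comp G U (f : R -> R) : measurable_fun setT f -> measurable_wrt G U ->
  measurable_wrt G (f \o U).
Proof.
move=> mf GU B mB; rewrite comp_preimage; apply: GU.
by rewrite -[_ @^-1` _]setTI; exact: mf.
Qed.

Lemma indep_of_comp G V (f : R -> R) : measurable_fun setT f -> indep_of G V -> indep_of G (f \o V).
Proof.
move=> mf iV A B GA mB; rewrite comp_preimage; apply: iV => //.
by rewrite -[_ @^-1` _]setTI; exact: mf.
Qed.

(* Positive and negative parts of the two factors are themselves independent. *)
Lemma indep_expect0 G U V : G `<=` measurable -> measurable_wrt G U ->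
  measurable_fun setT V -> indep_of G V ->
  P.-integrable setT (EFin \o U) -> P.-integrable setT (EFin \o V) ->
  \int[P]_x (V x)%:E = 0 ->
  P.-integrable setT (fun x => (U x * V x)%:E) /\ \int[P]_x (U x * V x)%:E = 0.
Proof.
move=> Gm GU mV ind iU iV V0.
have mU := measurable_wrtW Gm GU.
pose p (x : R) := Num.max x 0%R; pose q (x : R) := Num.max (- x)%R 0%R.
have mp : measurable_fun setT p by exact: measurable_maxr.
have mq : measurable_fun setT q by apply: measurable_maxr => //; exact: measurableT_comp.
have p0 x : (0 <= p x)%R by rewrite /p le_max lexx orbT.
have q0 x : (0 <= q x)%R by rewrite /q le_max lexx orbT.
have pq (x : R) : x = (p x - q x)%R.
  rewrite /p /q; case: (leP x 0%R) => h; first by rewrite max_l ?oppr_ge0// sub0r opprK.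
  by rewrite max_r ?subr0// oppr_le0 ltW.
have pqabs (x : R) : (`|p x| <= `|x|)%R /\ (`|q x| <= `|x|)%R.
  rewrite /p /q; case: (lerP x 0%R) => h; rewrite ?normr0; split=> //.
  - by rewrite max_l ?normrN// oppr_ge0.
  - by rewrite max_r ?normr0// oppr_le0 ltW.
have ic (W : Omega -> R) (f : R -> R) : measurable_fun setT f -> (forall x, `|f x| <= `|x|)%R ->
    P.-integrable setT (EFin \o W) -> P.-integrable setT (EFin \o (f \o W)).
  move=> mf fle iW; have mW := iffLR (measurable_EFinP _ _) (measurable_int _ iW).
  apply: le_integrable iW => //; first by apply/measurable_EFinP; exact: measurableT_comp.
  by move=> x _ /=; rewrite lee_fin.
have ip := ic V p mp (fun x => proj1 (pqabs x)) iV.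
have iq := ic V q mq (fun x => proj2 (pqabs x)) iV.
have jp := ic U p mp (fun x => proj1 (pqabs x)) iU.
have jq := ic U q mq (fun x => proj2 (pqabs x)) iU.
have EV : \int[P]_x (p (V x))%:E = \int[P]_x (q (V x))%:E.
  have := V0; under eq_integral do rewrite (pq (V _)) EFinB.
  rewrite integralB// => /eqP; rewrite sube_eq ?add0e ?fin_num_adde_defl; first by move=> /eqP.
  - exact: (integrable_fin_num measurableT ip).
  - by [].
  - exact: (integrable_fin_num measurableT iq).
pose EE (f g : R -> R) := \int[P]_x (f (U x) * g (V x))%:E.
have prod (f g : R -> R) : measurable_fun setT f -> measurable_fun setT g ->
   (forall x, 0 <= f x)%R -> (forall x, 0 <= g x)%R ->
   EE f g = \int[P]_x (f (U x))%:E * \int[P]_x (g (V x))%:E.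
  move=> mf mg f0 g0.
  have := indep_expectM Gm (measurable_wrt_comp mf GU) (measurableT_comp mg mV) (indep_of_comp mg ind).
  rewrite /EE /=; under eq_integral do rewrite !ger0_norm//.
  under [X in _ = X * _ -> _]eq_integral do rewrite !ger0_norm//.
  by under [X in _ = _ * X -> _]eq_integral do rewrite !ger0_norm//.
have ipr (f g : R -> R) : measurable_fun setT f -> measurable_fun setT g ->
   (forall x, 0 <= f x)%R -> (forall x, 0 <= g x)%R ->
   P.-integrable setT (EFin \o (f \o U)) -> P.-integrable setT (EFin \o (g \o V)) ->
   P.-integrable setT (fun x => (f (U x) * g (V x))%:E).
  move=> mf mg f0 g0 if_ ig; apply/integrableP; split.
    apply/measurable_EFinP; apply: measurable_funM; exact: measurableT_comp.
  under eq_integral do rewrite /= ger0_norm ?mulr_ge0//.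
  have := prod f g mf mg f0 g0; rewrite /EE => ->.
  have h1 := integrable_fin_num measurableT if_; have h2 := integrable_fin_num measurableT ig.
  by move: (fin_numM h1 h2); rewrite fin_numElt => /andP[_].
have i1 := ipr p p mp mp p0 p0 jp ip.
have i2 := ipr p q mp mq p0 q0 jp iq.
have i3 := ipr q p mq mp q0 p0 jq ip.
have i4 := ipr q q mq mq q0 q0 jq iq.
have dec : (fun x => (U x * V x)%:E) = (fun x => ((p (U x) * p (V x))%:E - (p (U x) * q (V x))%:E) -
    ((q (U x) * p (V x))%:E - (q (U x) * q (V x))%:E)).
  apply/funext => x; rewrite -!EFinB; congr EFin.
  by rewrite {1}(pq (U x)) {1}(pq (V x)); ring.
have i12 := integrableB measurableT i1 i2; have i34 := integrableB measurableT i3 i4.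
rewrite dec; split; first exact: integrableB.
rewrite integralB// integralB// integralB//.
have -> : \int[P]_x (p (U x) * p (V x))%:E = \int[P]_x (p (U x) * q (V x))%:E.
  by have := prod p p mp mp p0 p0; have := prod p q mp mq p0 q0; rewrite /EE EV => -> ->.
have -> : \int[P]_x (q (U x) * p (V x))%:E = \int[P]_x (q (U x) * q (V x))%:E.
  by have := prod q p mq mp q0 p0; have := prod q q mq mq q0 q0; rewrite /EE EV => -> ->.
by rewrite !subee ?sube0//; [exact: (integrable_fin_num measurableT i4)|exact: (integrable_fin_num measurableT i2)].
Qed.

End Independence.

(** * Even moments of martingale transforms *)

Section Martingale.
Local Open Scope ereal_scope.
Context {R : realType} {d : measure_display} {Omega : measurableType d}.
Variable P : probability Omega R.
Implicit Types (U V X Y Z : Omega -> R) (m k : nat) (C : R) (G : set (set Omega)).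

Lemma even_normX (u : R) k : (`|u| ^+ k.*2 = u ^+ k.*2)%R.
Proof. by rewrite -mul2n !exprM real_normK ?num_real. Qed.

(* Taylor expansion to first order; only the term linear in y keeps its sign. *)
Lemma taylor_even k : exists2 K : R, (0 < K)%R & forall s y : R,
  ((s + y) ^+ k.*2.+2 <= s ^+ k.*2.+2 + k.*2.+2%:R * (s ^+ k.*2.+1 * y) +
     K * (s ^+ k.*2 * y ^+ 2 + y ^+ k.*2.+2))%R.
Proof.
have small n (x : R) : (`|x| <= 1 -> (1 + x) ^+ n <= 1 + n%:R * x + 4 ^+ n * x ^+ 2)%R.
  rewrite ler_norml => /andP[x1 x2]; elim: n => [|n IH].
    by rewrite !expr0 mul0r mul1r addr0 lerDl sqr_ge0.
  have n4 : (n%:R <= 4 ^+ n :> R)%R by rewrite -natrX ler_nat ltnW// ltn_expl.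
  have px : (0 <= 1 + x)%R by lra.
  have n0 : (0 <= n%:R :> R)%R by [].
  rewrite exprS; apply: le_trans (ler_wpM2l px IH) _.
  rewrite (exprS 4) -[n.+1%:R%R]natr1; move: n4 n0; move: (4 ^+ n)%R (n%:R : R)%R => K m n4 m0.
  rewrite -subr_ge0 (_ : _ - _ = x ^+ 2 * (K * (2 - x) + (K - m)))%R; last by ring.
  rewrite mulr_ge0 ?sqr_ge0//; have K0 := le_trans m0 n4.
  have : (0 <= K * (2 - x))%R by rewrite mulr_ge0//; lra.
  by lra.
(* The part 4^m bounds the second-order remainder when |y| <= |s|, after division by s^m. The part
   [m] compensates the linear term, at least - m y^m, when |y| > |s|. *)
set m := k.*2.+2; exists (4 ^+ m + m%:R)%R; first by rewrite ltr_wpDr ?exprn_gt0.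
move=> s y.
have e0 (u : R) j : (0 <= u ^+ j.*2)%R by rewrite -even_normX exprn_ge0.
have E1 : (s ^+ m = s ^+ k.*2 * s ^+ 2)%R by rewrite -exprD addn2.
have E2 : (s ^+ k.*2.+1 = s ^+ k.*2 * s)%R by rewrite exprSr.
have ym0 : (0 <= y ^+ m)%R by rewrite (e0 y k.+1).
have [ys|sy] := leP `|y|%R `|s|%R.
  have [s0|s0] := eqVneq s 0%R.
    have y0 : y = 0%R by move: ys; rewrite s0 normr0 normr_le0 => /eqP.
    by rewrite s0 y0 addr0 !mulr0 addr0 !expr0n/= mulr0 addr0 mulr0 addr0.
  have xs : (`|y / s| <= 1)%R by rewrite normrM normfV ler_pdivrMr ?normr_gt0// mul1r.
  have := ler_wpM2l (e0 s k.+1) (small m (y / s)%R xs).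
  rewrite -/m -exprMn (_ : s * (1 + y / s) = s + y)%R; last by field.
  move/le_trans; apply.
  rewrite (_ : s ^+ m * _ = s ^+ m + m%:R * (s ^+ k.*2.+1 * y) + 4 ^+ m * (s ^+ k.*2 * y ^+ 2))%R.
    have h4 : (0 <= s ^+ k.*2 * y ^+ 2)%R by rewrite mulr_ge0 ?e0 ?sqr_ge0.
    have m0 : (0 <= m%:R :> R)%R by [].
    have m4 : (0 <= 4 ^+ m :> R)%R by rewrite exprn_ge0.
    have h5 := mulr_ge0 m0 h4; have h6 := mulr_ge0 (addr_ge0 m4 m0) ym0.
    rewrite (mulrDr (4 ^+ m + m%:R)%R) (mulrDl _ _ (s ^+ k.*2 * y ^+ 2)%R).
    by lra.
  by rewrite E1 E2; field.
have h1 : ((s + y) ^+ m <= 4 ^+ m * y ^+ m)%R.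
  rewrite -(even_normX (s + y) k.+1) -(even_normX y k.+1) -/m -exprMn lerXn2r ?nnegrE ?mulr_ge0//.
  by apply: le_trans (ler_normD _ _) _; have := normr_ge0 y; lra.
have h2 : (- y ^+ m <= s ^+ k.*2.+1 * y)%R.
  rewrite lerNl -mulNr; apply: le_trans (ler_norm _) _.
  rewrite normrM normrN normrX -(even_normX y k.+1) -/m [leRHS]exprSr ler_wpM2r//.
  by rewrite lerXn2r ?nnegrE// ltW.
have h3 : (0 <= s ^+ m)%R by rewrite (e0 s k.+1).
have h4 : (0 <= s ^+ k.*2 * y ^+ 2)%R by rewrite mulr_ge0 ?e0 ?sqr_ge0.
have m0 : (0 <= m%:R :> R)%R by [].
have m4 : (0 <= 4 ^+ m :> R)%R by rewrite exprn_ge0.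
apply: le_trans h1 _.
have := ler_wpM2l m0 h2; rewrite mulrN => h5.
have h6 := mulr_ge0 (addr_ge0 m4 m0) h4.
rewrite (mulrDr (4 ^+ m + m%:R)%R) (mulrDl _ _ (y ^+ m)%R).
by lra.
Qed.

(** Either e^2 <= l s^2 and the first term suffices, or s^2 < e^2 / l and the second does. *)
Lemma young_even k (s e l : R) : (0 < l)%R ->
  (s ^+ k.*2 * e ^+ 2 <= l * s ^+ k.*2.+2 + (l ^+ k)^-1 * e ^+ k.*2.+2)%R.
Proof.
move=> l0.
have e0 (u : R) j : (0 <= u ^+ j.*2)%R by rewrite -even_normX exprn_ge0.
have lk : (0 < l ^+ k)%R by rewrite exprn_gt0.
have [h|h] := leP (e ^+ 2)%R (l * s ^+ 2)%R.
  apply: ler_wpDr; first by rewrite mulr_ge0 ?invr_ge0 ?(e0 e k.+1)// ltW.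
  rewrite (_ : s ^+ k.*2.+2 = s ^+ k.*2 * s ^+ 2)%R; last by rewrite -exprD addn2.
  by rewrite [leRHS]mulrCA ler_wpM2l.
apply: ler_wpDl; first by rewrite mulr_ge0 ?(e0 s k.+1)// ltW.
rewrite (_ : e ^+ k.*2.+2 = e ^+ k.*2 * e ^+ 2)%R; last by rewrite -exprD addn2.
rewrite [leRHS]mulrA ler_wpM2r ?sqr_ge0// ler_pdivlMl// -mul2n !exprM -exprMn.
by apply: lerXn2r; rewrite ?nnegrE ?sqr_ge0 ?(ltW h)// mulr_ge0 ?sqr_ge0 ?(ltW l0).
Qed.

Lemma integrable_moment m Y C : measurable_fun setT Y -> moment P m Y <= C%:E ->
  P.-integrable setT (fun x => (`|Y x| ^+ m)%:E).
Proof.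
move=> mY YC; apply/integrableP; split; first exact: measurable_absX.
under eq_integral do rewrite /= ger0_norm ?exprn_ge0//.
exact: le_lt_trans (ltry C).
Qed.

Lemma moment_lower m m' Y C : measurable_fun setT Y -> (m <= m')%N ->
  moment P m' Y <= C%:E -> moment P m Y <= (1 + C)%:E.
Proof.
move=> mY mm YC; have mY' := iffLR (measurable_EFinP _ _) (measurable_absX m' mY).
apply: (@le_trans _ _ (\int[P]_x (1 + `|Y x| ^+ m')%:E)).
  apply: le_lower_integral => x; rewrite lee_fin ?exprn_ge0//.
  have [h|h] := leP `|Y x|%R 1%R.
    by rewrite ler_wpDr ?exprn_ge0// exprn_ile1.
  by rewrite ler_wpDl// ler_weXn2l// ltW.
rewrite ge0_expectD//.
by rewrite expect_cst EFinD leeD.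
Qed.

(** Turns [measurable_wrt] into measurability on a type carrying [G] as its sigma-algebra, where the
    closure lemmas for measurable functions apply. *)
Lemma measurable_wrtP G U : sigma_algebra setT G ->
  measurable_wrt G U <-> measurable_fun setT (U : g_sigma_algebraType G -> R).
Proof.
move=> sG; split=> [GU _ B mB|mU B mB].
  by rewrite setTI; rewrite /measurable/= sigma_algebra_id//; exact: GU.
have := mU measurableT B mB; rewrite setTI.
by rewrite /measurable/= sigma_algebra_id.
Qed.

Section Transform.
Variables (N : nat) (G : nat -> set (set Omega)) (e xi : nat -> Omega -> R).
Hypothesis sG : forall i, (i <= N)%N -> sigma_algebra setT (G i).
Hypothesis Gm : forall i, (i <= N)%N -> G i `<=` measurable.
Hypothesis Ginc : forall i, (i < N)%N -> G i `<=` G i.+1.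
Hypothesis Ge : forall i, (i < N)%N -> measurable_wrt (G i) (e i).
Hypothesis Gxi : forall i, (i < N)%N -> measurable_wrt (G i.+1) (xi i).
Hypothesis ixi : forall i, (i < N)%N -> indep_of P (G i) (xi i).
Hypothesis Exi : forall i, (i < N)%N -> \int[P]_x (xi i x)%:E = 0.

Let S n x := (\sum_(i < n) e i x * xi i x)%R.

Let GS n : (n <= N)%N -> measurable_wrt (G n) (S n).
Proof.
elim: n => [|n IH] nN.
  apply/measurable_wrtP; first exact: sG.
  rewrite (_ : S 0 = cst 0%R); first exact: measurable_cst.
  by apply/funext => x; rewrite /S big_ord0.
have sub U : measurable_wrt (G n) U -> measurable_wrt (G n.+1) U.
  by move=> GU B mB; apply: Ginc => //; exact: GU.
have := sub _ (IH (ltnW nN)); have := sub _ (Ge nN); have := Gxi nN.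
have s := sG nN; move=> /(measurable_wrtP _ s) h1 /(measurable_wrtP _ s) h2 /(measurable_wrtP _ s) h3.
apply/measurable_wrtP => //.
rewrite (_ : S n.+1 = (fun x => S n x + e n x * xi n x)%R).
  by apply: measurable_funD => //; exact: measurable_funM.
by apply/funext => x; rewrite /S big_ord_recr.
Qed.

(** The scaling is that of Wiener increments over time [delta]: the moment of order 2k + 2 is of
    order delta^(k + 1), and N delta is the total time, which stays fixed under refinement. For sums
    of fluctuations [delta] is 1. *)
Variables (k : nat) (m delta B K : R).
Hypothesis N0 : (0 < N)%N.
Hypothesis delta0 : (0 < delta)%R.
Hypothesis m0 : (0 <= m)%R.
Hypothesis K0 : (0 < K)%R.
Hypothesis taylor : forall s y : R,
  ((s + y) ^+ k.*2.+2 <= s ^+ k.*2.+2 + k.*2.+2%:R * (s ^+ k.*2.+1 * y) +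
     K * (s ^+ k.*2 * y ^+ 2 + y ^+ k.*2.+2))%R.
Hypothesis Me : forall i, (i < N)%N -> moment P k.*2.+2 (e i) <= B%:E.
Hypothesis Mxi2 : forall i, (i < N)%N -> moment P 2 (xi i) <= (m * delta)%:E.
Hypothesis Mxik : forall i, (i < N)%N -> moment P k.*2.+2 (xi i) <= (m * delta ^+ k.+1)%:E.

Let B0 : (0 <= B)%R.
Proof. by rewrite -lee_fin; apply: le_trans (Me N0); exact: moment_ge0. Qed.

(* Independence kills the linear term of the Taylor bound and splits the others; Young's
   inequality then separates S^(2k) e^2. *)
Let step n A : (n < N)%N -> moment P k.*2.+2 (S n) <= A%:E ->
  moment P k.*2.+2 (S n.+1) <=
    (A * (1 + K * m / N%:R) + 2 * K * m * (N%:R * delta) ^+ k.+1 * B / N%:R)%:E.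
Proof.
move=> nN SA; have Gn := Gm (ltnW nN).
have A0 : (0 <= A)%R by rewrite -lee_fin; apply: le_trans SA; exact: moment_ge0.
have even0 (u : R) j : (0 <= u ^+ j.*2)%R by rewrite -even_normX exprn_ge0.
have mS := measurable_wrtW Gn (GS (ltnW nN)).
have me := measurable_wrtW Gn (Ge nN).
have mxi := measurable_wrtW (Gm nN) (Gxi nN).
have [s1 s2 sc] : [/\ sigma_algebra setT (G n), measurable_wrt (G n) (S n) & measurable_wrt (G n) (e n)].
  by split; [exact: sG (ltnW nN)|exact: GS (ltnW nN)|exact: Ge].
have [/(measurable_wrtP _ s1) g1 /(measurable_wrtP _ s1) g2] := (s2, sc).
have iS := integrable_moment mS SA; have ie := integrable_moment me (Me nN).
pose U x := (S n x ^+ k.*2.+1 * e n x)%R.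
have GU : measurable_wrt (G n) U.
  by apply/measurable_wrtP => //; apply: measurable_funM => //; exact: measurable_funX.
have iU : P.-integrable setT (EFin \o U).
  have := integrableD measurableT iS ie; apply: le_integrable => //.
    by apply/measurable_EFinP; exact: measurable_wrtW GU.
  move=> x _ /=; rewrite lee_fin [leRHS]ger0_norm ?addr_ge0 ?exprn_ge0//.
  rewrite /U normrM normrX; have [h|h] := leP `|S n x|%R `|e n x|%R.
    by rewrite ler_wpDl ?exprn_ge0// [leRHS]exprSr ler_wpM2r// lerXn2r ?nnegrE.
  by rewrite ler_wpDr ?exprn_ge0// [leRHS]exprSr ler_wpM2l ?exprn_ge0// ltW.
have ixi' : P.-integrable setT (EFin \o xi n).
  have := integrable_moment mxi (moment_lower (m := 1) mxi (ltnW (ltnSn 1)) (Mxi2 nN)).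
  apply: le_integrable => //; first exact/measurable_EFinP.
  by move=> x _ /=; rewrite lee_fin expr1 normr_id.
have [iUxi EUxi] := indep_expect0 Gn GU mxi (ixi nN) iU ixi' (Exi nN).
pose W x := (S n x ^+ k.*2 * e n x ^+ 2)%R.
have GW : measurable_wrt (G n) W.
  by apply/measurable_wrtP => //; apply: measurable_funM => //; exact: measurable_funX.
have mW := measurable_wrtW Gn GW.
(* With this scale in Young's inequality the previous moment is multiplied by 1 + K m / N only, so
   that N steps multiply it by at most exp(K m). *)
pose l := ((N%:R * delta)^-1)%R.
have Nd : (0 < N%:R * delta)%R by rewrite mulr_gt0 ?ltr0n.
have l0 : (0 < l)%R by rewrite invr_gt0.
have EW : \int[P]_x `|W x|%:E <= (l * A + (l ^+ k)^-1 * B)%:E.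
  apply: le_trans (_ : \int[P]_x (l * `|S n x| ^+ k.*2.+2 + (l ^+ k)^-1 * `|e n x| ^+ k.*2.+2)%:E <= _).
    apply: le_lower_integral => x; rewrite lee_fin// (even_normX _ k.+1) (even_normX _ k.+1) ger0_norm; first exact: young_even.
    by rewrite /W mulr_ge0 ?sqr_ge0.
  have mS' := iffLR (measurable_EFinP _ _) (measurable_absX k.*2.+2 mS).
  have me' := iffLR (measurable_EFinP _ _) (measurable_absX k.*2.+2 me).
  rewrite ge0_expectD; last 4 first.
  - exact: measurable_funM.
  - exact: measurable_funM.
  - by move=> x; rewrite mulr_ge0 ?exprn_ge0// ltW.
  - by move=> x; rewrite mulr_ge0 ?exprn_ge0// invr_ge0 exprn_ge0// ltW.
  have l0' := ltW l0; have l1 : (0 <= (l ^+ k)^-1)%R by rewrite invr_ge0 exprn_ge0.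
  rewrite !ge0_expectZ//.
  rewrite EFinD !EFinM leeD// lee_pmul2l// ?lte_fin ?invr_gt0 ?exprn_gt0//; exact: Me.
pose Z1 x := (`|W x| * `|xi n x ^+ 2|)%R.
pose Z2 x := (`|e n x ^+ k.*2.+2| * `|xi n x ^+ k.*2.+2|)%R.
have mabs (f : Omega -> R) : measurable_fun setT f -> measurable_fun setT (fun x => `|f x|%R).
  by move=> mf; exact: measurableT_comp.
have mZ1 : measurable_fun setT Z1.
  by apply: measurable_funM; apply: mabs => //; exact: measurable_funX.
have mZ2 : measurable_fun setT Z2.
  by apply: measurable_funM; apply: mabs => //; exact: measurable_funX.
have Z10 x : (0 <= Z1 x)%R by rewrite /Z1 mulr_ge0.
have Z20 x : (0 <= Z2 x)%R by rewrite /Z2 mulr_ge0.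
have mX j : measurable_fun [set: R] (fun u : R => u ^+ j)%R by exact: measurable_funX.
have EZ1 : \int[P]_x (Z1 x)%:E <= ((l * A + (l ^+ k)^-1 * B) * (m * delta))%:E.
  rewrite /Z1 (indep_expectM Gn GW (measurableT_comp (mX 2%N) mxi) (indep_of_comp (mX 2%N) (ixi nN))).
  rewrite EFinM; apply: lee_pmul => //; try by apply: integral_ge0 => x _; rewrite lee_fin.
  apply: le_trans (Mxi2 nN); apply: le_lower_integral => x; rewrite lee_fin//=.
  by rewrite normrX.
have EZ2 : \int[P]_x (Z2 x)%:E <= (B * (m * delta ^+ k.+1))%:E.
  have Gek : measurable_wrt (G n) ((fun u : R => u ^+ k.*2.+2)%R \o e n).
    exact: measurable_wrt_comp.
  have := indep_expectM Gn Gek (measurableT_comp (mX k.*2.+2) mxi) (indep_of_comp (mX k.*2.+2) (ixi nN)).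
  rewrite /= => ->.
  rewrite EFinM; apply: lee_pmul => //; try by apply: integral_ge0 => x _; rewrite lee_fin.
  - by apply: le_trans (Me nN); apply: le_lower_integral => x; rewrite lee_fin//= normrX.
  - by apply: le_trans (Mxik nN); apply: le_lower_integral => x; rewrite lee_fin//= normrX.
pose F x := (`|S n x| ^+ k.*2.+2 + K * (Z1 x + Z2 x))%R.
have mS' := iffLR (measurable_EFinP _ _) (measurable_absX k.*2.+2 mS).
have mZ : measurable_fun setT (fun x => Z1 x + Z2 x)%R by exact: measurable_funD.
have mKZ : measurable_fun setT (fun x => K * (Z1 x + Z2 x))%R by exact: measurable_funM.
have mF : measurable_fun setT F by exact: measurable_funD.
have F0 x : (0 <= F x)%R.
  by rewrite /F addr_ge0 ?exprn_ge0// mulr_ge0 ?addr_ge0// ltW.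
have EF : \int[P]_x (F x)%:E <= (A + K * ((l * A + (l ^+ k)^-1 * B) * (m * delta) + B * (m * delta ^+ k.+1)))%:E.
  rewrite /F ge0_expectD//; last by move=> x; rewrite mulr_ge0 ?addr_ge0// ltW.
  rewrite ge0_expectZ//; last 2 first.
  - exact: ltW.
  - by move=> x; rewrite addr_ge0.
  rewrite ge0_expectD// EFinD leeD// EFinM lee_pmul2l// EFinD leeD//.
have iF : P.-integrable setT (EFin \o F).
  apply/integrableP; split; first exact/measurable_EFinP.
  under eq_integral do rewrite /= ger0_norm//.
  exact: le_lt_trans EF (ltry _).
have iU' := integrableZl measurableT k.*2.+2%:R iUxi.
(* The announced bound exceeds the one obtained by the displayed last term, nonnegative since N >=
   1. *)
have -> : (A * (1 + K * m / N%:R) + 2 * K * m * (N%:R * delta) ^+ k.+1 * B / N%:R =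
   (A + K * ((l * A + (l ^+ k)^-1 * B) * (m * delta) + B * (m * delta ^+ k.+1))) +
   K * m * B * delta ^+ k.+1 * (N%:R ^+ k - 1))%R.
  rewrite /l -!exprVn invrK exprMn !exprS exprMn; field.
  by rewrite pnatr_eq0 -lt0n N0 gt_eqF.
apply: (@le_trans _ _ (A + K * ((l * A + (l ^+ k)^-1 * B) * (m * delta) + B * (m * delta ^+ k.+1)))%:E); last first.
  rewrite lee_fin lerDl !mulr_ge0// ?exprn_ge0 ?(ltW K0) ?(ltW delta0)//.
  by rewrite subr_ge0 -natrX ler1n expn_gt0 N0.
apply: le_trans EF.
apply: (@le_trans _ _ (\int[P]_x ((F x)%:E + k.*2.+2%:R%:E * (U x * xi n x)%:E))); last first.
  rewrite integralD// integralZl// EUxi mule0 adde0//.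
apply: le_lower_integral => x; first by rewrite lee_fin exprn_ge0.
rewrite -EFinM -EFinD lee_fin (even_normX _ k.+1) {1}/S big_ord_recr /= -/(S n x).
apply: le_trans (taylor _ _) _; rewrite /F (even_normX _ k.+1).
have -> : (S n x ^+ k.*2.+1 * (e n x * xi n x) = U x * xi n x)%R by rewrite mulrA.
rewrite -!addrA lerD2l [leRHS]addrC lerD2l ler_wpM2l ?(ltW K0)// /Z1 /Z2 lerD//.
all: apply: le_trans (ler_norm _) _; rewrite exprMn.
  by rewrite mulrA normrM.
by rewrite normrM.
Qed.

(** Discrete Gronwall: each step multiplies by [r] and adds [c], so starting from 0 the n-th bound
    is n c r^n, and r^N <= exp(K m). The result depends on [N] only through N delta, which makes it
    uniform over refinements of a fixed interval. *)
Lemma transform_moment :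
  moment P k.*2.+2 (S N) <= (2 * K * m * expR (K * m) * (N%:R * delta) ^+ k.+1 * B)%:E.
Proof.
pose c := (2 * K * m * (N%:R * delta) ^+ k.+1 * B / N%:R)%R; pose r := (1 + K * m / N%:R)%R.
have c0 : (0 <= c)%R.
  by rewrite /c !mulr_ge0 ?invr_ge0 ?exprn_ge0 ?mulr_ge0 ?(ltW K0) ?(ltW delta0).
have r1 : (1 <= r)%R by rewrite lerDl !mulr_ge0 ?invr_ge0 ?(ltW K0).
have H n : (n <= N)%N -> moment P k.*2.+2 (S n) <= (n%:R * c * r ^+ n)%:E.
  elim: n => [_|n IH nN].
    rewrite !mul0r /moment; under eq_integral do rewrite /S big_ord0 normr0 expr0n/=.
    by rewrite expect_cst.
  apply: le_trans (step nN (IH (ltnW nN))) _; rewrite lee_fin -/c -/r.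
  rewrite -(mulrA _ (r ^+ n)%R r) -exprSr -natr1 mulrDl mul1r mulrDl lerD2l.
  by rewrite ler_peMr// exprn_ege1.
apply: le_trans (H N (leqnn N)) _; rewrite lee_fin.
have rN : (r ^+ N <= expR (K * m))%R.
  have -> : (K * m = N%:R * (K * m / N%:R))%R by rewrite [RHS]mulrC divfK// pnatr_eq0 -lt0n.
  rewrite expRM_natl lerXn2r ?nnegrE ?expR_ge0 ?expR_ge1Dx//.
  exact: le_trans r1.
apply: (@le_trans _ _ (N%:R * c * expR (K * m))%R); first by rewrite ler_wpM2l// mulr_ge0.
rewrite le_eqVlt; apply/orP; left; apply/eqP; rewrite /c; field.
by rewrite pnatr_eq0 -lt0n.
Qed.

End Transform.


End Martingale.

(** * The normal distribution *)

Section Gaussian.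
Local Open Scope ereal_scope.
Context {R : realType}.
Notation mu := (@lebesgue_measure R).
Notation nu := (@normal_prob R 0%R 1%R).

Let scale (c : R) : measurableTypeR R -> measurableTypeR R := fun x : R => (c * x)%R.

Let measurable_scale (c : R) : measurable_fun setT (scale c).
Proof. by apply: measurable_funM => //; exact: measurable_cst. Qed.

(** By uniqueness of Lebesgue measure, checked on half-open intervals. *)
Lemma lebesgue_measure_scale (c : R) (A : set (measurableTypeR R)) : (0 < c)%R -> measurable A ->
  mu A = c%:E * mu (scale c @^-1` A).
Proof.
move=> c0 mA.
pose m' : {measure set (measurableTypeR R) -> \bar R} :=
  mscale (NngNum (ltW c0)) (pushforward mu (scale c)).
have := @lebesgue_measure_unique R (m' (measurable_scale c)) _ A mA; apply.
move=> _ [[a b]] _ <-; rewrite /m' /= /mscale /pushforward /=.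
rewrite [pushforward _ _ _](_ : _ = mu `](a / c)%R, (b / c)%R]%classic); last first.
  congr (lebesgue_measure _).
  apply/seteqP; split=> x /=; rewrite !in_itv/= /scale.
    by rewrite ltr_pdivrMr// ler_pdivlMr// ![(x * c)%R]mulrC.
  by rewrite ltr_pdivrMr// ler_pdivlMr// ![(x * c)%R]mulrC.
rewrite !lebesgue_measure_itv/= !lte_fin ltr_pM2r ?invr_gt0//.
case: ifP => _; last by rewrite mule0.
by rewrite -!EFinB -EFinM -mulrBl mulrC divfK// gt_eqF.
Qed.

Lemma ge0_integral_scale (c : R) (f : R -> \bar R) : (0 < c)%R ->
  measurable_fun setT (f : measurableTypeR R -> \bar R) -> (forall x, 0 <= f x) ->
  \int[mu]_x f x = c%:E * \int[mu]_x f (c * x)%R.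
Proof.
move=> c0 mf f0.
pose m' : {measure set (measurableTypeR R) -> \bar R} :=
  mscale (NngNum (ltW c0)) (pushforward mu (scale c)).
transitivity (\int[m' (measurable_scale c)]_x f x).
  by apply: eq_measure_integral => A mA _; exact: lebesgue_measure_scale.
rewrite ge0_integral_mscale//; congr (_ * _).
by rewrite ge0_integral_pushforward.
Qed.

(** The second parameter of [normal_prob] is the standard deviation; the law follows by a linear
    substitution in the density. *)
Lemma normal_prob_scale (s : R) (B : set R) : (0 < s)%R -> measurable B ->
  normal_prob 0%R s B = nu ((fun x => s * x)%R @^-1` B).
Proof.
move=> s0 mB; rewrite /normal_prob integral_mkcond [RHS]integral_mkcond.
have mp (t : R) : measurable_fun setT (fun x : measurableTypeR R => (normal_pdf 0 t x)%:E).
  by apply/measurable_EFinP; exact: measurable_normal_pdf.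
rewrite (ge0_integral_scale s0); last 2 first.
- by apply: (measurable_restrictT _ mB).1; apply: measurable_funTS; exact: mp.
- by move=> x; rewrite patchE; case: ifP => // _; rewrite lee_fin normal_pdf_ge0.
rewrite -ge0_integralZl_EFin ?(ltW s0)//; last 2 first.
- by move=> x _; rewrite patchE; case: ifP => // _; rewrite lee_fin normal_pdf_ge0.
- have := (measurable_restrictT (fun x : measurableTypeR R => (normal_pdf 0%R s x)%:E) mB).1 (measurable_funTS (mp s)).
  by move=> /measurableT_comp /(_ (measurable_scale s)).
apply: eq_integral => x _; rewrite !patchE.
have -> : ((s * x)%R \in B) = (x \in (fun x => s * x)%R @^-1` B) by apply/idP/idP => /set_mem ?; exact/mem_set.
case: ifP => _; last by rewrite mule0.
rewrite -EFinM; congr EFin; rewrite !normal_pdfE ?gt_eqF// /normal_fun /normal_peak !subr0.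
rewrite expr1n mul1r mulrA; congr (_ * expR _)%R; last first.
  by rewrite exprMn; field; rewrite gt_eqF.
rewrite -mulrnAr sqrtrM ?sqr_ge0// sqrtr_sqr gtr0_norm// invfM mulrA divff ?mul1r//.
by rewrite gt_eqF.
Qed.

Lemma normal_prob_opp (B : set R) : measurable B -> nu ((fun x => - x)%R @^-1` B) = nu B.
Proof.
move=> mB; rewrite /normal_prob integral_mkcond [RHS]integral_mkcond.
have mp : measurable_fun setT (fun x : measurableTypeR R => (normal_pdf 0 1%R x)%:E).
  by apply/measurable_EFinP; exact: measurable_normal_pdf.
have mpB : measurable_fun setT ((fun x : measurableTypeR R => (normal_pdf 0 1%R x)%:E) \_ B).
  by apply: (measurable_restrictT _ mB).1; apply: measurable_funTS; exact: mp.
transitivity (\int[pushforward mu (-%R : _ -> measurableTypeR R)]_x ((fun x : measurableTypeR R => (normal_pdf 0 1%R x)%:E) \_ B) x); last first.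
  by apply: eq_measure_integral => A mA _; exact: lebesgue_measureN.
rewrite ge0_integral_pushforward//; last first.
  by move=> x _; rewrite patchE; case: ifP => // _; rewrite lee_fin normal_pdf_ge0.
apply: eq_integral => x _ /=; rewrite !patchE.
have -> : ((- x)%R \in B) = (x \in (fun x => - x)%R @^-1` B) by apply/idP/idP => /set_mem ?; exact/mem_set.
case: ifP => // _; rewrite !normal_pdfE ?oner_neq0// /normal_fun !subr0.
by rewrite sqrrN.
Qed.

Import HBNNSimple.

(** Indicators are the definition of [normal_prob]; simple functions and monotone convergence extend
    the formula. *)
Lemma integral_normal_prob (f : R -> R) : measurable_fun setT f -> (forall x, 0 <= f x)%R ->
  \int[nu]_x (f x)%:E = \int[mu]_x ((f x)%:E * (normal_pdf 0 1 x)%:E).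
Proof.
move=> mf0 f0.
pose g (x : measurableTypeR R) := (normal_pdf 0 1 x)%:E.
have g0 x : 0 <= g x by rewrite lee_fin normal_pdf_ge0.
have mg : measurable_fun setT g by apply/measurable_EFinP; exact: measurable_normal_pdf.
have mf : measurable_fun setT (fun x : measurableTypeR R => (f x)%:E) by exact/measurable_EFinP.
pose h := nnsfun_approx measurableT mf.
have f0' (x : measurableTypeR R) : setT x -> 0 <= (f x)%:E by rewrite lee_fin.
have -> : \int[nu]_x (f x)%:E = lim (\int[nu]_x (EFin \o h n) x @[n --> \oo]).
  have fE x : (f x)%:E = lim ((EFin \o h n) x @[n --> \oo]).
    by apply/esym/cvg_lim => //; exact: cvg_nnsfun_approx.
  under eq_integral => x _ do rewrite fE.
  apply: monotone_convergence => //.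
  - by move=> n; apply/measurable_EFinP.
  - by move=> n x Ex //=; rewrite lee_fin.
  - by move=> x Ex a b ab; rewrite lee_fin; exact/lefP/nd_nnsfun_approx.
have -> : \int[mu]_x ((f x)%:E * g x) = lim (\int[mu]_x ((EFin \o h n) x * g x) @[n --> \oo]).
  have fg x : (f x)%:E * g x = lim (((EFin \o h n) \* g) x @[n --> \oo]).
    by apply/esym/cvg_lim => //; apply: cvgeZr => //; exact: cvg_nnsfun_approx.
  under eq_integral => x _ do rewrite fg.
  apply: monotone_convergence => [//| | |].
  - by move=> n; apply/emeasurable_funM => //; exact/measurable_EFinP.
  - by move=> n x Ex; apply: mule_ge0; [rewrite lee_fin|exact: g0].
  - by move=> x Ex a b ab/=; apply: lee_wpmul2r; [exact: g0|rewrite lee_fin; exact/lefP/nd_nnsfun_approx].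
suff suf n : \int[mu]_x ((EFin \o h n) x * g x) = \int[nu]_x (EFin \o h n) x.
  by congr (limn _); apply/funext => n; rewrite suf.
transitivity (\int[nu]_x (\sum_(y \in range (h n)) (y * \1_(h n @^-1` [set y]) x)%:E)); last first.
  by apply: eq_integral => t tE; rewrite /= fimfunE -fsumEFin.
have indich m r : measurable_fun setT (fun x => (r * \1_(h m @^-1` [set r]) x)%:E).
  by apply: (measurable_comp measurableT) => //; exact: measurable_funM.
rewrite ge0_integral_fsum//; last by move=> m y Ey; exact: nnfun_muleindic_ge0.
transitivity (\int[mu]_x (\sum_(y \in range (h n)) (y * \1_(h n @^-1` [set y]) x)%:E * g x)).
  under [RHS]eq_integral => x xE.
    rewrite -ge0_mule_fsuml => [|y]; last exact: nnfun_muleindic_ge0.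
    rewrite fsumEFin // -(fimfunE _ x); over.
  by [].
rewrite ge0_integral_fsum//; last 2 first.
  - by move=> y; apply: emeasurable_funM.
  - by move=> m y Ey; rewrite mule_ge0// nnfun_muleindic_ge0.
apply: eq_fsbigr => r rhn.
under [RHS]eq_integral do rewrite EFinM.
rewrite integralZl_indic_nnsfun => //.
under eq_integral do rewrite EFinM -muleA.
have r0 : (0 <= r)%R by move/set_mem: rhn => [x _ <-].
rewrite ge0_integralZl//.
- under eq_integral do rewrite muleC.
  rewrite (eq_integral (g \_ (h n @^-1` [set r]))); last first.
    by move=> x xE; rewrite epatch_indic.
  by rewrite -integral_mkcond integral_indic// setIT.
- by apply: emeasurable_funM => //; exact/measurable_EFinP.
- by move=> x _; rewrite mule_ge0// lee_fin.
Qed.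

(** The m-th power of y / m <= exp(y / m). *)
Lemma exprn_le_expR (y : R) m : (0 <= y)%R -> (y ^+ m <= m%:R ^+ m * expR y)%R.
Proof.
case: m => [|m] y0; first by rewrite !expr0 mul1r -expR0 ler_expR.
have mp : (0 < m.+1%:R :> R)%R by rewrite ltr0n.
rewrite -ler_pdivrMl ?exprn_gt0// -exprVn -exprMn.
have -> : expR y = (expR (m.+1%:R^-1 * y) ^+ m.+1)%R.
  by rewrite -expRM_natl mulrA divff ?mul1r// gt_eqF.
rewrite lerXn2r ?nnegrE ?expR_ge0 ?mulr_ge0 ?invr_ge0//.
by apply: le_trans (expR_ge1Dx _); rewrite lerDr.
Qed.

(** Up to a constant, the standard density is the density of variance 2 times exp(- x^2 / 4), and
    this factor absorbs |x|^m <= 1 + (x^2)^m. The constant [C] comes from [exprn_le_expR] at x^2 /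
    4. *)
Lemma normal_abs_moment m : exists M : R, \int[nu]_x (`|x| ^+ m)%:E <= M%:E.
Proof.
pose s2 := Num.sqrt (2 : R).
have s20 : s2 != 0%R by rewrite gt_eqF// sqrtr_gt0.
pose C := (1 + 4 ^+ m * m%:R ^+ m : R)%R.
have C0 : (0 <= C)%R by rewrite addr_ge0 ?mulr_ge0 ?exprn_ge0.
pose M := (C * normal_peak 1 / normal_peak s2)%R; exists M.
have M0 : (0 <= M)%R by rewrite /M !mulr_ge0 ?invr_ge0 ?normal_peak_ge0.
have mX : measurable_fun setT (fun x : R => `|x| ^+ m)%R.
  by apply: measurable_funX; exact: normr_measurable.
rewrite integral_normal_prob//.
rewrite -[leRHS]mule1 -(integral_normal_pdf 0%R s2) -ge0_integralZl_EFin//; last 2 first.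
- by move=> x _; rewrite lee_fin normal_pdf_ge0.
- by apply/measurable_EFinP; exact: measurable_normal_pdf.
apply: ge0_le_integral => //.
- by move=> x _; rewrite mule_ge0// lee_fin ?exprn_ge0 ?normal_pdf_ge0.
- apply/measurable_EFinP; apply: measurable_funM; last exact: measurable_normal_pdf.
  by apply: measurable_funX; exact: normr_measurable.
- apply/measurable_EFinP; apply: measurable_funM => //; exact: measurable_normal_pdf.
move=> x _; rewrite -!EFinM lee_fin !normal_pdfE ?oner_neq0//.
have -> : (M * (normal_peak s2 * normal_fun 0 s2 x) = C * normal_peak 1 * normal_fun 0 s2 x)%R.
  by rewrite /M; field; rewrite gt_eqF// normal_peak_gt0.
rewrite mulrCA [(C * _)%R]mulrC -mulrA ler_wpM2l ?normal_peak_ge0//.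
rewrite /normal_fun !subr0 /s2 sqr_sqrtr// expr1n.
have -> : (- x ^+ 2 / (2 *+ 2) = x ^+ 2 / 4 + - x ^+ 2 / (1 *+ 2))%R by field.
rewrite expRD mulrA ler_wpM2r ?expR_ge0//.
apply: (@le_trans _ _ (1 + (x ^+ 2) ^+ m)%R).
  have [h|h] := leP `|x|%R 1%R; first by apply: ler_wpDr; [rewrite exprn_ge0 ?sqr_ge0|rewrite exprn_ile1].
  rewrite ler_wpDl// -real_normK ?num_real// -exprM ler_weXn2l ?(ltW h)//.
  by rewrite mul2n -addnn leq_addr.
have h2 : (1 <= expR (x ^+ 2 / 4))%R by rewrite -expR0 ler_expR divr_ge0 ?sqr_ge0.
rewrite /C mulrDl mul1r lerD//.
have -> : (x ^+ 2 = 4 * (x ^+ 2 / 4))%R by field.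
rewrite exprMn -mulrA ler_wpM2l ?exprn_ge0//.
have -> : (4 * (x ^+ 2 / 4) / 4 = x ^+ 2 / 4)%R by field.
by apply: exprn_le_expR; rewrite divr_ge0 ?sqr_ge0.
Qed.

(** Plays the part of [p] in the quantile and path estimates; its value at the square root of
    c(alpha) is 1 - alpha. *)
Definition normal_cdf_abs (x : R) : R := fine (nu [set z : R | `|z| <= x]%R).

Let absleE (x : R) : [set z : R | `|z| <= x]%R = `[(- x)%R, x]%classic.
Proof. by apply/seteqP; split=> z /=; rewrite in_itv/= ler_norml. Qed.

Lemma measurable_absle (x : R) : measurable [set z : R | `|z| <= x]%R.
Proof. by rewrite absleE. Qed.

Lemma normal_cdf_absE (x : R) : nu [set z : R | `|z| <= x]%R = (normal_cdf_abs x)%:E.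
Proof. by rewrite fineK// fin_num_measure//; exact: measurable_absle. Qed.

Let mpdf (D : set (measurableTypeR R)) : measurable_fun D (fun x : measurableTypeR R => (normal_pdf 0 (1%R : R) x)%:E).
Proof. by apply/measurable_EFinP/measurable_funTS; exact: measurable_normal_pdf. Qed.

Let nu_itv_le (i : interval R) (M : R) : (0 <= M)%R -> (forall x, x \in i -> normal_pdf 0 1 x <= M)%R ->
  nu [set` i] <= M%:E * mu [set` i].
Proof.
move=> M0 H; rewrite /normal_prob -integral_cst//; apply: ge0_le_integral => //.
by move=> x _; rewrite lee_fin normal_pdf_ge0.
Qed.

Let nu_itv_ge (i : interval R) (M : R) : (0 <= M)%R -> (forall x, x \in i -> M <= normal_pdf 0 1 x)%R ->
  M%:E * mu [set` i] <= nu [set` i].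
Proof.
move=> M0 H; by rewrite /normal_prob -integral_cst//; apply: ge0_le_integral.
Qed.

(** The set x < |z| <= y consists of two intervals of length y - x, on which the density is at most
    its peak. *)
Lemma normal_cdf_abs_lip : exists2 C : R, (0 < C)%R &
  forall x y : R, (0 <= x -> x <= y -> normal_cdf_abs y - normal_cdf_abs x <= C * (y - x))%R.
Proof.
exists (2 * normal_peak 1)%R; first by rewrite mulr_gt0// normal_peak_gt0// oner_neq0.
move=> x y x0 xy; rewrite lerBlDl -lee_fin EFinD -!normal_cdf_absE.
have E : [set z : R | `|z| <= y]%R `<=` [set z : R | `|z| <= x]%R `|` (`]x, y]%classic `|` `[(- y)%R, (- x)%R[%classic).
  move=> z /=; rewrite !in_itv/= !ler_norml => /andP[z1 z2].
  have [h|h] := leP z x; last by right; left; rewrite z2.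
  have [h'|h'] := leP (- x)%R z; [by left|by right; right; rewrite z1].
have mE : measurable ([set z : R | `|z| <= x]%R `|` (`]x, y]%classic `|` `[(- y)%R, (- x)%R[%classic)).
  by apply: measurableU; [exact: measurable_absle|exact: measurableU].
pose nm : {measure set (measurableTypeR R) -> \bar R} := normal_prob 0%R 1%R.
apply: (@le_trans _ _ (nm ([set z : R | `|z| <= x]%R `|` (`]x, y]%classic `|` `[(- y)%R, (- x)%R[%classic)))).
  by apply: (@le_measure _ _ _ nm); rewrite ?inE//; exact: measurable_absle.
apply: le_trans (@measureU2 _ _ _ nm _ _ _ _) _; [exact: measurable_absle|exact: measurableU|].
rewrite leeD2l//; apply: le_trans (@measureU2 _ _ _ nm _ _ _ _) _ => //.
have p0 := normal_peak_ge0 (1%R : R).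
have ub (z : R) : (normal_pdf 0 1 z <= normal_peak 1)%R by exact: normal_pdf_ub (oner_neq0 _).
apply: le_trans (leeD (@nu_itv_le `]x, y] _ p0 (fun z _ => ub z)) (@nu_itv_le `[(- y)%R, (- x)%R[ _ p0 (fun z _ => ub z))) _.
rewrite !lebesgue_measure_itv/= !lte_fin ltrN2.
case: ifPn => h; last by rewrite mule0 adde0 lee_fin !mulr_ge0// subr_ge0.
rewrite -!EFinB -!EFinM -EFinD lee_fin le_eqVlt; apply/orP; left; apply/eqP; ring.
Qed.

(** On ]x, y] inside [0, b] the density is at least its value at [b]. This linear growth is what
    converts an error on counts into an error of the same order on the quantile. *)
Lemma normal_cdf_abs_lower (b : R) : exists2 c : R, (0 < c)%R &
  forall x y : R, (0 <= x -> x <= y -> y <= b -> c * (y - x) <= normal_cdf_abs y - normal_cdf_abs x)%R.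
Proof.
exists (normal_pdf 0 1 b).
  by rewrite normal_pdfE ?oner_neq0// mulr_gt0 ?expR_gt0// normal_peak_gt0// oner_neq0.
move=> x y x0 xy yb; rewrite lerBrDl -lee_fin EFinD -!normal_cdf_absE.
have -> : (normal_pdf 0 1 b * (y - x))%:E = (normal_pdf 0 1 b)%:E * mu `]x, y]%classic.
  rewrite lebesgue_measure_itv/= lte_fin; case: ifPn => h; first by rewrite -EFinB -EFinM.
  by rewrite mule0 (_ : (y - x = 0)%R) ?mulr0//; apply/eqP; rewrite subr_eq0 eq_le xy leNgt h.
apply: le_trans (_ : nu [set z : R | `|z| <= x]%R + nu `]x, y]%classic <= _).
  rewrite leeD2l//; apply: nu_itv_ge; first exact: normal_pdf_ge0.
  move=> z; rewrite in_itv/= => /andP[xz zy].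
  rewrite !normal_pdfE ?oner_neq0// ler_wpM2l ?normal_peak_ge0// /normal_fun !subr0 ler_expR.
  rewrite ler_pM2r ?invr_gt0// ?expr1n// lerN2 lerXn2r ?nnegrE//.
  - by rewrite (le_trans x0)// ltW.
  - by rewrite (le_trans x0)// (le_trans xy).
  - exact: le_trans yb.
pose nm : {measure set (measurableTypeR R) -> \bar R} := normal_prob 0%R 1%R.
rewrite -(@measureU _ _ _ nm)//; last 2 first.
- exact: measurable_absle.
- apply/seteqP; split=> // z [/=]; rewrite in_itv/= => zx /andP[xz _].
  by move: (le_lt_trans (le_trans (ler_norm _) zx) xz); rewrite ltxx.
apply: (@le_measure _ _ _ nm); rewrite ?inE//; [|exact: measurable_absle|].
  by apply: measurableU => //; exact: measurable_absle.
move=> z /= []; first by move=> /le_trans; apply.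
by rewrite in_itv/= => /andP[xz zy]; rewrite ger0_norm// (le_trans x0)// ltW.
Qed.

Lemma normal_cdf_abs0 : normal_cdf_abs 0 = 0%R.
Proof.
rewrite /normal_cdf_abs absleE oppr0 set_itv1.
by rewrite /normal_prob integral_set1.
Qed.

(** For c < 0 the event is empty and for c = 0 it is null, whereas 1 - alpha is positive. *)
Lemma c_alpha_gt0 (alpha c : R) : (0 < alpha < 1)%R -> is_c_alpha alpha c ->
  (0 < Num.sqrt c)%R /\ normal_cdf_abs (Num.sqrt c) = (1 - alpha)%R.
Proof.
move=> /andP[a0 a1] ca.
have [c0|c0] := leP 0%R c; last first.
  exfalso; have : nu [set z : R | z ^+ 2 <= c]%R = 0.
    rewrite (_ : [set z : R | z ^+ 2 <= c]%R = set0) ?measure0//.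
    apply/seteqP; split=> // z /= zc.
    by move: (le_lt_trans zc c0); rewrite ltNge sqr_ge0.
  by rewrite ca => /eqP; rewrite eqe subr_eq0 gt_eqF.
have E : [set z : R | z ^+ 2 <= c]%R = [set z : R | `|z| <= Num.sqrt c]%R.
  have H (z : R) : (z ^+ 2 <= c)%R = (`|z| <= Num.sqrt c)%R.
    by rewrite -(real_normK (num_real z)) -{1}(sqr_sqrtr c0) ler_pXn2r ?nnegrE ?sqrtr_ge0.
  by apply/seteqP; split=> z /=; rewrite H.
have h : normal_cdf_abs (Num.sqrt c) = (1 - alpha)%R by rewrite /normal_cdf_abs -E ca.
split=> //; rewrite lt_neqAle sqrtr_ge0 andbT; apply/eqP => s0.
by move: h; rewrite -s0 normal_cdf_abs0 => /eqP; rewrite eq_sym subr_eq0 gt_eqF.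
Qed.

Let mq (a : R) : measurable_fun setT (fun z : R => (z ^+ 2 * \1_[set y : R | `|y| <= a] z)%R).
Proof.
apply: measurable_funM; first exact: measurable_funX.
by apply: measurable_indic; exact: measurable_absle.
Qed.

Let qge0 (a z : R) : (0 <= z ^+ 2 * \1_[set y : R | `|y| <= a]%R z)%R.
Proof. by rewrite mulr_ge0 ?sqr_ge0. Qed.

Lemma q_of_cE (c : R) : \int[nu]_z (z ^+ 2 * \1_[set y : R | `|y| <= Num.sqrt c]%R z)%:E = (q_of_c c)%:E.
Proof.
rewrite /q_of_c /Rintegral fineK// ge0_fin_numE; last by apply: integral_ge0 => z _; rewrite lee_fin.
have [M HM] := normal_abs_moment 2; apply: le_lt_trans (le_trans _ HM) (ltry _).
apply: ge0_le_integral => //.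
- by move=> z _; rewrite lee_fin.
- by apply/measurable_EFinP; exact: mq.
- by apply/measurable_EFinP/measurable_funX; exact: normr_measurable.
- move=> z _; rewrite lee_fin real_normK ?num_real// ler_piMr ?sqr_ge0//.
Qed.

(** On a / 2 < |z| <= a the integrand is at least (a / 2)^2, and this set has positive mass by
    [normal_cdf_abs_lower]. *)
Lemma q_of_c_gt0 (c : R) : (0 < Num.sqrt c)%R -> (0 < q_of_c c)%R.
Proof.
move=> a0; set a := Num.sqrt c in a0 *.
have [k k0 Hk] := normal_cdf_abs_lower a.
have a2 : (0 <= a / 2)%R by rewrite divr_ge0 ?ltW.
have h := Hk (a / 2)%R a a2 ltac:(lra) (lexx _).
rewrite -lte_fin -q_of_cE; apply: (@lt_le_trans _ _ ((a / 2) ^+ 2 * (k * (a - a / 2)))%:E).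
  by rewrite lte_fin mulr_gt0 ?exprn_gt0 ?mulr_gt0 ?divr_gt0//; lra.
rewrite EFinM; apply: (@le_trans _ _ (((a / 2) ^+ 2)%:E * nu ([set y | `|y| <= a]%R `\` [set y | `|y| <= a / 2]%R))).
  rewrite lee_wpmul2l ?lee_fin ?sqr_ge0// measureD; [|exact: measurable_absle|exact: measurable_absle|]; last first.
    by rewrite /= -/nu normal_cdf_absE ltry.
  rewrite setIidr; last by move=> y /= /le_trans; apply; lra.
  by rewrite /= !normal_cdf_absE -EFinB lee_fin.
have mD : measurable ([set y : R | `|y| <= a]%R `\` [set y | `|y| <= a / 2]%R).
  by apply: measurableD; exact: measurable_absle.
rewrite -[X in _ * X]mul1e -integral_cst// -ge0_integralZl_EFin ?sqr_ge0//.
rewrite integral_mkcond; apply: ge0_le_integral => //.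
- by move=> z _; rewrite patchE; case: ifP => // _; rewrite mule1 lee_fin sqr_ge0.
- by apply: (measurable_restrictT _ mD).1.
- by apply/measurable_EFinP; exact: mq.
move=> z _; rewrite patchE; case: ifPn => [/set_mem[/= za /negP]|_]; last by rewrite lee_fin.
rewrite -ltNge => az; rewrite mule1 lee_fin indicE mem_set// mulr1 -(real_normK (num_real z)).
by rewrite lerXn2r ?nnegrE// ltW.
Qed.

End Gaussian.

Section GaussianVariable.
Local Open Scope ereal_scope.
Context {R : realType} {d : measure_display} {Omega : measurableType d}.
Variable P : probability Omega R.
Notation nu := (@normal_prob R 0%R 1%R).

Definition standard_normal (Z : Omega -> R) := measurable_fun setT Z /\
  forall B : set R, measurable B -> P (Z @^-1` B) = nu B.

Lemma standard_normal_scale (s : R) (g : Omega -> R) : (0 < s)%R -> measurable_fun setT g ->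
  (forall B : set R, measurable B -> P (g @^-1` B) = normal_prob 0%R s B) ->
  standard_normal (fun x => s^-1 * g x)%R.
Proof.
move=> s0 mg lg; split; first exact: measurable_funM.
move=> B mB.
have mh : measurable_fun setT (fun x : R => s^-1 * x)%R by exact: measurable_funM.
have mB' : measurable ((fun x : R => s^-1 * x)%R @^-1` B) by rewrite -[X in measurable X]setTI; exact: mh.
have -> : (fun x => s^-1 * g x)%R @^-1` B = g @^-1` ((fun x => s^-1 * x)%R @^-1` B) by [].
rewrite lg// normal_prob_scale//; congr (normal_prob 0 1 _).
by apply/seteqP; split=> x /=; rewrite mulrA mulVf ?gt_eqF// mul1r.
Qed.

Lemma standard_normal_expect Z (f : R -> R) : standard_normal Z -> measurable_fun setT f ->
  (forall x, 0 <= f x)%R -> \int[P]_x (f (Z x))%:E = \int[nu]_z (f z)%:E.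
Proof.
move=> [mZ lZ] mf f0.
have mZ' : measurable_fun setT (Z : Omega -> measurableTypeR R) by exact: mZ.
pose ZZ : {RV P >-> measurableTypeR R} := HB.pack (Z : Omega -> measurableTypeR R) (isMeasurableFun.Build _ _ _ _ _ mZ').
transitivity (\int[distribution P ZZ]_z (f z)%:E).
  by rewrite /distribution ge0_integral_pushforward//; [exact/measurable_EFinP|move=> z _; rewrite lee_fin].
by apply: eq_measure_integral => A mA _; exact: lZ.
Qed.

Lemma standard_normal_cdf Z (x : R) : standard_normal Z ->
  P [set y | `|Z y| <= x]%R = (normal_cdf_abs x)%:E.
Proof. by move=> [_ lZ]; rewrite -normal_cdf_absE -lZ//; exact: measurable_absle. Qed.

Lemma standard_normal_moment m : exists2 M : R, (0 <= M)%R &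
  forall Z, standard_normal Z -> moment P m Z <= M%:E.
Proof.
have [M HM] := @normal_abs_moment R m; exists `|M|%R => // Z hZ.
rewrite /moment (standard_normal_expect (f := fun z => `|z| ^+ m)%R)//.
- by apply: le_trans HM _; rewrite lee_fin ler_norm.
- by apply: measurable_funX; exact: normr_measurable.
Qed.

(** By symmetry [Z] and its opposite have the same law, so the integral equals its own opposite;
    finiteness then makes it 0. *)
Lemma standard_normal_mean Z : standard_normal Z -> \int[P]_x (Z x)%:E = 0.
Proof.
move=> hZ; have [mZ lZ] := hZ.
have hN : standard_normal (fun x => - Z x)%R.
  split; first exact: measurableT_comp.
  move=> B mB; rewrite -normal_prob_opp// -lZ//.
  by have := @oppr_measurable R setT measurableT B mB; rewrite setTI.
have [M _ HM] := standard_normal_moment 1.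
have iZ : P.-integrable setT (EFin \o Z).
  have := integrable_moment mZ (HM _ hZ); apply: le_integrable => //; first exact/measurable_EFinP.
  by move=> x _ /=; rewrite lee_fin expr1 normr_id.
have E : \int[P]_x (Z x)%:E = \int[P]_x (- Z x)%:E.
  rewrite [LHS]integralE [RHS]integralE.
  have mp : measurable_fun setT (fun x : R => Num.max x 0)%R by exact: measurable_maxr.
  have p0 (x : R) : (0 <= Num.max x 0)%R by rewrite le_max lexx orbT.
  have h1 := standard_normal_expect hZ mp p0; have h2 := standard_normal_expect hN mp p0.
  have f1 (Y : Omega -> R) : \int[P]_x ((fun x => (Y x)%:E)^\+ x) = \int[P]_x (Num.max (Y x) 0)%:E.
    by apply: eq_integral => x _; rewrite funeposE EFin_max.
  have f2 (Y : Omega -> R) : \int[P]_x ((fun x => (Y x)%:E)^\- x) = \int[P]_x (Num.max (- Y x) 0)%:E.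
    by apply: eq_integral => x _; rewrite funenegE -EFinN EFin_max.
  rewrite !f1 !f2 h1 h2; congr (_ - _).
  by under [RHS]eq_integral do rewrite opprK; rewrite h1.
move: E; under [RHS]eq_integral do rewrite EFinN.
under [X in _ = X -> _]eq_integral do rewrite -mulN1e.
rewrite integralZl// mulN1e.
have : \int[P]_x (Z x)%:E \is a fin_num by exact: (integrable_fin_num measurableT iZ).
case: (\int[P]_x (Z x)%:E) => // r _ [] /eqP.
by rewrite -addr_eq0 -mulr2n mulrn_eq0/= => /eqP ->.
Qed.

End GaussianVariable.

(** * Increments of Ito integrals *)

Section Filtrations.
Context {R : realType} {d : measure_display} {Omega : measurableType d}.
Implicit Types (P : probability Omega R) (T : R) (F : R -> set (set Omega)) (G : set (set Omega)).

Lemma measurable_wrtB G (U V : Omega -> R) : sigma_algebra setT G ->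
  measurable_wrt G U -> measurable_wrt G V -> measurable_wrt G (fun x => U x - V x).
Proof.
move=> sG /(measurable_wrtP _ sG) mU /(measurable_wrtP _ sG) mV.
by apply/(measurable_wrtP _ sG); exact: measurable_funB.
Qed.

Lemma measurable_wrtM G (U V : Omega -> R) : sigma_algebra setT G ->
  measurable_wrt G U -> measurable_wrt G V -> measurable_wrt G (fun x => U x * V x).
Proof.
move=> sG /(measurable_wrtP _ sG) mU /(measurable_wrtP _ sG) mV.
by apply/(measurable_wrtP _ sG); exact: measurable_funM.
Qed.

Lemma measurable_wrt_indic G (A : set Omega) : sigma_algebra setT G ->
  G A -> measurable_wrt G (\1_A : Omega -> R).
Proof.
move=> sG GA; apply/(measurable_wrtP _ sG).
apply: (@measurable_indic _ (g_sigma_algebraType G) R setT A).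
by apply: sub_sigma_algebra.
Qed.

Variables (T : R) (F : R -> set (set Omega)).
Hypothesis hF : filtration T F.

Lemma filtration_sigma t : 0 <= t <= T -> sigma_algebra setT (F t).
Proof. by case/(hF.1 t). Qed.

Lemma filtration_sub t : 0 <= t <= T -> F t `<=` measurable.
Proof. by case/(hF.1 t). Qed.

Lemma measurable_wrt_le s t (Y : Omega -> R) : 0 <= s -> s <= t -> t <= T ->
  measurable_wrt (F s) Y -> measurable_wrt (F t) Y.
Proof. by move=> s0 st tT mY B mB; apply: (hF.2 s t) => //; exact: mY. Qed.

Lemma adapted_measurable (U : R -> Omega -> R) t : cadlag_adapted T F U ->
  0 <= t <= T -> measurable_fun setT (U t).
Proof.
by move=> [aU _] tT; apply: measurable_wrtW (aU t tT); exact: filtration_sub.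
Qed.

(** [nojump_osc] and [osc_nojump] express the event through countably many mesh values at times not
    exceeding [b]. This adaptedness is what lets the indicator enter a martingale transform. *)
Lemma nojump_wrt (U : R -> Omega -> R) a b : cadlag_adapted T F U ->
  0 <= a -> a <= b -> b <= T -> F b [set x | nojump (U ^~ x) a b].
Proof.
move=> [aU cU] a0; rewrite le_eqVlt => /predU1P[<-{b}|ab] bT.
  rewrite (_ : [set x | _] = setT); last first.
    by apply/seteqP; split=> // x _ r ar ra; have := lt_le_trans ar ra; rewrite ltxx.
  have [F0 FC _] := filtration_sigma (t := a) (ltac:(by rewrite a0)).
  by rewrite -(setD0 setT); exact: FC.
have bT' : 0 <= b <= T by rewrite (le_trans a0 (ltW ab)).
have sF := filtration_sigma bT'.
rewrite -(sigma_algebra_id sF).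
pose D := g_sigma_algebraType (F b).
have mU s : a <= s <= b -> measurable_fun (T := D) setT (U s).
  move=> /andP[as_ sb]; apply/(measurable_wrtP _ sF).
  apply: (@measurable_wrt_le s) => //; first exact: le_trans as_.
  by apply: aU; rewrite (le_trans a0 as_) (le_trans sb).
pose A m k i : set D :=
  [set x | `|U (mesh a b k i.+1) x - U (mesh a b k i) x| <= m.+1%:R^-1].
have mA m k i : (i < k)%N -> measurable (A m k i).
  move=> ik; rewrite /A -[X in measurable X]setTI.
  apply: measurable_fun_le => //; apply: measurableT_comp; first exact: normr_measurable.
  apply: measurable_funB; apply: mU.
    by rewrite mesh_ge ?(ltW ab)// mesh_le_last// ltW.
  by rewrite mesh_ge ?(ltW ab)// mesh_le_last ?ltW// ltnW.
rewrite (_ : [set x | _] = \bigcap_m \bigcup_K \bigcap_(k in [set k | (K <= k)%N])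
   \bigcap_(i in [set i | (i < k)%N]) A m k i).
  change (@measurable _ D (\bigcap_m \bigcup_K \bigcap_(k in [set k | (K <= k)%N])
    \bigcap_(i in [set i | (i < k)%N]) A m k i)).
  apply: bigcapT_measurable => m; apply: bigcupT_measurable => K.
  apply: bigcap_measurableType => k _; apply: bigcap_measurableType => i /=; exact: mA.
apply/seteqP; split=> x /=.
  move=> nj m _.
  have [K _ hK] := nojump_osc (cU x) a0 ab bT nj (e := m.+1%:R^-1) (ltac:(by [])).
  by exists K => // k /= Kk i ik; apply: hK.
move=> H; apply: (osc_nojump (cU x)) => // m.
by have [K _ hK] := H m I; exists K => // k /= Kk i ik; apply: hK.
Qed.

End Filtrations.

Section AeConvergence.
Local Open Scope ereal_scope.
Context {R : realType} {d : measure_display} {Omega : measurableType d}.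
Variable P : probability Omega R.

(** Dominated convergence for the indicators of the events [E k]. *)
Lemma ae_cvg_proba0 (Y : nat -> Omega -> \bar R) (N : set Omega) :
  (forall k, measurable_fun setT (Y k)) -> measurable N -> P N = 0 ->
  (forall x, ~ N x -> Y k x @[k --> \oo] --> 0) -> cvg_proba0 P Y.
Proof.
move=> mY mN N0 cY e e0.
pose E k : set Omega := [set x | e%:E <= Y k x].
have mE k : measurable (E k).
  rewrite /E -[X in measurable X]setTI.
  by apply: emeasurable_fun_le => //; exact: measurable_cst.
pose f k x : \bar R := (\1_(E k) x)%:E.
have mf k : measurable_fun setT (f k).
  by apply/measurable_EFinP; apply: measurable_indic.
have cf : {ae P, forall x, setT x -> f k x @[k --> \oo] --> (cst 0 : Omega -> \bar R) x}.
  exists N; split=> // x /= /not_implyP[_]; apply: contra_notP => /cY /= cYx.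
  apply: cvg_near_cst.
  have : nbhs (0 : \bar R) [set y | y < e%:E] by apply: open_ereal_lt_ereal; rewrite /= lte_fin.
  move=> /cYx[K _ hK]; exists K => // k /hK /= Yk.
  rewrite /f indicE memNset//=; apply/negP; rewrite -ltNge.
  exact: Yk.
have f1 : {ae P, forall x n, setT x -> `|f n x| <= (cst 1 : Omega -> \bar R) x}.
  apply/aeW => x n _; rewrite /f /= lee_fin ger0_norm ?indicE; by case: (_ \in _).
have [_ _] := dominated_convergence measurableT mf (measurable_cst _) cf
  (finite_measure_integrable_cst P 1 measurableT) f1.
have -> : \int[P]_x (cst 0 : Omega -> \bar R) x = 0 by apply: integral0_eq.
apply: cvg_trans; apply: near_eq_cvg; near=> k.
rewrite /= /f integral_indic// setIT; congr (P _); apply/seteqP; by split.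
Unshelve. all: by end_near.
Qed.

End AeConvergence.

Section CadlagAlgebra.
Context {R : realType}.
Implicit Types (T : R) (f g : R -> R).

Lemma cadlag_cst T (c : R) : cadlag T (fun=> c).
Proof. by split=> t _; [exact: cvg_cst | exact: is_cvg_cst]. Qed.

Lemma cadlagB T f g : cadlag T f -> cadlag T g -> cadlag T (fun t => f t - g t).
Proof.
move=> [fr fl] [gr gl]; split=> t tT; first by apply: cvgB; [exact: fr|exact: gr].
by apply: is_cvgB; [exact: fl|exact: gl].
Qed.

Lemma cadlagM T f g : cadlag T f -> cadlag T g -> cadlag T (fun t => f t * g t).
Proof.
move=> [fr fl] [gr gl]; split=> t tT; first by apply: cvgM; [exact: fr|exact: gr].
by apply: is_cvgM; [exact: fl|exact: gl].
Qed.

Lemma cadlag_sqr T f : cadlag T f -> cadlag T (fun t => f t ^+ 2).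
Proof.
move=> cf; rewrite (_ : (fun t => _) = (fun t => f t * f t)); first exact: cadlagM.
by apply/funext => t; rewrite expr2.
Qed.

End CadlagAlgebra.

(** * Moments of time integrals *)

Section TimeIntegral.
Context {R : realType} {d : measure_display} {Omega : measurableType d}.
Variable P : probability Omega R.
Notation mu := (@lebesgue_measure R).

Lemma momentZ m (c C : R) (Y : Omega -> R) : measurable_fun setT Y ->
  (moment P m Y <= C%:E)%E -> (moment P m (fun x => c * Y x)%R <= (`|c| ^+ m * C)%:E)%E.
Proof.
move=> mY YC; rewrite /moment.
under eq_integral do rewrite normrM exprMn.
rewrite ge0_expectZ//.
  by rewrite EFinM lee_wpmul2l// lee_fin.
by apply: measurable_funX; exact: measurableT_comp.
Qed.

Variables (T a b : R) (U : R -> Omega -> R).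
Hypotheses (a0 : 0 <= a) (ab : a <= b) (bT : b <= T).
Hypothesis cU : forall x, cadlag T (U ^~ x).
Hypothesis mU : forall t, a <= t <= b -> measurable_fun setT (U t).

Let riemann k x := (b - a) / k%:R * \sum_(i < k) U (mesh a b k i.+1) x.

Let measurable_mesh k i : (i < k)%N -> measurable_fun setT (U (mesh a b k i.+1)).
Proof. by move=> ik; apply: mU; rewrite mesh_ge// mesh_le_last. Qed.

Let measurable_riemann k : measurable_fun setT (riemann k).
Proof.
apply: measurable_funM; first exact: measurable_cst.
by apply: measurable_sum => i; exact: measurable_mesh.
Qed.

Lemma measurable_time_integral :
  measurable_fun setT (fun x => \int[mu]_(t in `]a, b]) U t x : R).
Proof.
apply: (measurable_fun_cvg measurable_riemann) => x _.
by have [] := cadlag_integral_cvg (cU x) a0 ab bT.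
Qed.

(** A Riemann sum is b - a times a mean, to which Jensen's inequality applies; Fatou's lemma passes
    to the integral. The sums are indexed by [n.+1] so that there is at least one cell. *)
Lemma time_integral_moment k C :
  (forall t, a <= t <= b -> (moment P k.*2 (U t) <= C%:E)%E) ->
  (moment P k.*2 (fun x => \int[mu]_(t in `]a, b]) U t x)%R <= ((b - a) ^+ k.*2 * C)%:E)%E.
Proof.
move=> UC.
(* [moment_mean] asks for measurability at every index, so the values beyond the mesh are set to
   0. *)
pose Y n i x := if (i < n)%N then U (mesh a b n i.+1) x else 0.
have mY n i : measurable_fun setT (Y n i).
  by rewrite /Y; case: ltnP => ik; [exact: measurable_mesh|exact: measurable_cst].
apply: (@moment_cvg _ _ _ P k.*2 (fun n x => riemann n.+1 x)).
- by [].
- move=> x; have [_] := cadlag_integral_cvg (cU x) a0 ab bT.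
  by move=> h; rewrite (cvg_shiftS (riemann^~ x)).
- move=> n; rewrite (_ : riemann n.+1 =
    (fun x => (b - a) * (n.+1%:R^-1 * \sum_(i < n.+1) Y n.+1 i x))); last first.
    apply/funext => x; rewrite /riemann -mulrA; congr (_ * (_ * _)).
    by apply: eq_bigr => i _; rewrite /Y ltn_ord.
  rewrite -[X in X ^+ _]ger0_norm ?subr_ge0//; apply: momentZ.
    apply: measurable_funM; first exact: measurable_cst.
    exact: measurable_sum.
  apply: moment_mean => // i ik; rewrite /Y.
  rewrite (_ : (fun _ => _) = U (mesh a b n.+1 i.+1)); last by apply/funext=> x; rewrite ik.
  by apply: UC; rewrite mesh_ge// mesh_le_last.
Qed.

End TimeIntegral.

Section Wiener.
Context {R : realType} {d : measure_display} {Omega : measurableType d}.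
Variables (P : probability Omega R) (T : R) (F : R -> set (set Omega)).
Hypothesis hF : filtration T F.

Lemma wiener_increment (w : R -> Omega -> R) s t : wiener_process P T F w ->
  0 <= s -> s < t -> t <= T ->
  [/\ measurable_wrt (F t) (fun x => w t x - w s x),
      indep_of P (F s) (fun x => w t x - w s x) &
      standard_normal P (fun x => (Num.sqrt (t - s))^-1 * (w t x - w s x))].
Proof.
move=> [aw _ _ lw iw] s0 st tT.
have mw : measurable_wrt (F t) (fun x => w t x - w s x).
  have tT' : 0 <= t <= T by rewrite (le_trans s0 (ltW st)).
  apply: measurable_wrtB; [exact: (filtration_sigma hF)|exact: aw|].
  apply: (measurable_wrt_le hF s0 (ltW st) tT); apply: aw.
  by rewrite s0 (le_trans (ltW st)).
split=> //.
  by move=> A B FA mB; apply: (iw s t).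
apply: standard_normal_scale; first by rewrite sqrtr_gt0 subr_gt0.
  apply: measurable_wrtW mw; apply: (filtration_sub hF).
  by rewrite (le_trans s0 (ltW st)).
by move=> B mB; apply: (lw s t).
Qed.

Lemma wiener_moment m : exists2 C : R, 0 <= C & forall (w : R -> Omega -> R) s t,
  wiener_process P T F w -> 0 <= s -> s < t -> t <= T ->
  (moment P m (fun x => w t x - w s x)%R <= (C * Num.sqrt (t - s) ^+ m)%:E)%E.
Proof.
have [C C0 hC] := @standard_normal_moment R _ Omega P m; exists C => // w s t hw s0 st tT.
have [_ _ nw] := wiener_increment hw s0 st tT.
have := momentZ (Num.sqrt (t - s)) nw.1 (hC _ nw).
rewrite mulrC ger0_norm ?sqrtr_ge0//; apply: le_trans.
rewrite le_eqVlt; apply/orP; left; apply/eqP; congr (moment _ _ _); apply/funext => x.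
by rewrite mulrA divff ?mul1r// gt_eqF// sqrtr_gt0 subr_gt0.
Qed.

Lemma wiener_mean (w : R -> Omega -> R) s t : wiener_process P T F w ->
  0 <= s -> s < t -> t <= T -> (\int[P]_x (w t x - w s x)%:E = 0)%E.
Proof.
move=> hw s0 st tT; have [_ _ nw] := wiener_increment hw s0 st tT.
have s1 : Num.sqrt (t - s) != 0 by rewrite gt_eqF// sqrtr_gt0 subr_gt0.
have [M M0 hM] := @standard_normal_moment R _ Omega P 1.
have iz : P.-integrable setT (EFin \o (fun x => (Num.sqrt (t - s))^-1 * (w t x - w s x))).
  have := integrable_moment nw.1 (hM _ nw).
  have mz := nw.1.
  apply: le_integrable => //; first exact/measurable_EFinP.
  by move=> x _ /=; rewrite expr1 normr_id.
transitivity ((Num.sqrt (t - s))%:E *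
  \int[P]_x (((Num.sqrt (t - s))^-1 * (w t x - w s x))%R)%:E)%E; last first.
  by rewrite (standard_normal_mean nw) mule0.
rewrite -integralZl//; apply: eq_integral => x _ /=.
by rewrite -EFinM mulrA divff// mul1r.
Qed.

End Wiener.

(** * Ito integrals over one observation interval *)

Section Ito.
Context {R : realType} {d : measure_display} {Omega : measurableType d}.
Variables (P : probability Omega R) (T : R) (F : R -> set (set Omega)).
Hypotheses (hT : 0 < T) (hF : filtration T F).
Notation mu := (@lebesgue_measure R).

Lemma cvg_proba0_le2 (A B C : nat -> Omega -> R) :
  (forall k, measurable_fun setT (A k)) -> (forall k, measurable_fun setT (B k)) ->
  (forall k, measurable_fun setT (C k)) ->
  (forall k x, `|C k x| <= `|A k x| + `|B k x|) ->
  cvg_proba0 P (fun k x => `|A k x|%:E) -> cvg_proba0 P (fun k x => `|B k x|%:E) ->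
  cvg_proba0 P (fun k x => `|C k x|%:E).
Proof.
move=> mA mB mC CAB cA cB e e0.
have e2 : 0 < e / 2 by rewrite divr_gt0.
have mE (D : Omega -> R) r : measurable_fun setT D ->
    measurable [set x | (r%:E <= `|D x|%:E)%E].
  move=> mD; rewrite -[X in measurable X]setTI.
  by apply: emeasurable_fun_le => //; apply/measurable_EFinP; exact: measurableT_comp.
have cAB := cvgeD (isT : ((0 : \bar R) +? (0 : \bar R))%E) (cA _ e2) (cB _ e2).
rewrite adde0 in cAB.
apply: (@squeeze_cvge _ _ _ _ (fun=> 0%E)); [|exact: cvg_cst|exact: cAB].
apply: nearW => k; rewrite measure_ge0/=.
apply: le_trans (measureU2 _ _ _) => //; [|exact: mE|exact: mE].
apply: le_measure; rewrite ?inE; [exact: mE|by apply: measurableU; exact: mE|].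
move=> x /=; rewrite !lee_fin => eC.
have := le_trans eC (CAB k x).
case: (leP (e / 2) `|A k x|) => h1; first by left.
case: (leP (e / 2) `|B k x|) => h2; first by right.
lra.
Qed.

Definition left_steps (sg : R -> Omega -> R) k : step_data :=
  StepData k (mesh 0 T k) (fun i => sg (mesh 0 T k i)).

Section Integrand.
Variable sg : R -> Omega -> R.
Hypothesis hsg : cadlag_adapted T F sg.

Lemma simple_left_steps k : (0 < k)%N -> simple_predictable T F (left_steps sg k).
Proof.
move=> k0; split=> /=; first by rewrite mesh0.
  by rewrite mesh_last.
move=> i ik; split; first by apply: mesh_le => //; exact: ltW.
by apply: hsg.1; apply: mesh_itv; [exact: ltW|exact: ltnW].
Qed.

Let err k x (t : R) := (step_process (left_steps sg k) t x - sg t x) ^+ 2.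

Let measurable_err k x : measurable_fun (`]0, T]%classic : set (measurableTypeR R)) (EFin \o err k x).
Proof.
apply/measurable_EFinP; apply: measurable_funX; apply: measurable_funB.
  exact: (@measurable_stepf _ 0 T k (fun i => sg (mesh 0 T k i) x)).
have [/integrableP[/measurable_EFinP + _] _] :=
  cadlag_integral_cvg (hsg.2 x) (lexx 0) (ltW hT) (lexx T).
by [].
Qed.

(** Cell by cell the error is the time integral of the square of a cadlag process, measurable in
    omega as a limit of Riemann sums; an induction on the cells adds the pieces. *)
Lemma measurable_left_steps_error k : (0 < k)%N ->
  measurable_fun setT (fun x => \int[mu]_(t in `[0%R, T])
    ((step_process (left_steps sg k) t x - sg t x) ^+ 2)%:E)%E.
Proof.
move=> k0.
suff H j : (j <= k)%N ->
    measurable_fun setT (fun x => \int[mu]_(t in `]0%R, mesh 0 T k j]) (err k x t)%:E)%E.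
  have := H k (leqnn k); rewrite mesh_last//; apply: eq_measurable_fun => x _.
  exact: integral_itv_obnd_cbnd (measurable_err k x).
elim: j => [_|j IH jk].
  by under eq_fun do rewrite mesh0 set_itvoc0 integral_set0; exact: measurable_cst.
have T0 := ltW hT.
have lj1 : mesh 0 T k j <= mesh 0 T k j.+1 by exact: mesh_le.
have ljT : mesh 0 T k j.+1 <= T by exact: mesh_le_last.
have lj : 0 <= mesh 0 T k j by exact: mesh_ge.
have mj : 0 <= mesh 0 T k j <= T by rewrite lj (le_trans lj1).
have split_itv : `]0, mesh 0 T k j.+1]%classic =
    (`]0, mesh 0 T k j]%classic : set (measurableTypeR R)) `|` `]mesh 0 T k j, mesh 0 T k j.+1]%classic.
  by rewrite -itv_bndbnd_setU// bnd_simp.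
have cD x : cadlag T (fun t => (sg (mesh 0 T k j) x - sg t x) ^+ 2).
  by apply: cadlag_sqr; apply: cadlagB; [exact: cadlag_cst|exact: hsg.2].
have E x : (\int[mu]_(t in `]0%R, mesh 0 T k j.+1]) (err k x t)%:E =
    \int[mu]_(t in `]0%R, mesh 0 T k j]) (err k x t)%:E +
    (\int[mu]_(t in `]mesh 0 T k j, mesh 0 T k j.+1]) ((sg (mesh 0 T k j) x - sg t x) ^+ 2))%R%:E)%E.
  rewrite split_itv ge0_integral_setU//=; last 3 first.
  - rewrite -split_itv; apply: measurable_funS (measurable_err k x) => //.
    by apply: subset_itvl; rewrite bnd_simp.
  - by move=> t _; rewrite lee_fin sqr_ge0.
  - apply/disj_setPRL => t /=; rewrite !in_itv/= => /andP[h1 _] /andP[_].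
    by rewrite leNgt h1.
  congr (_ + _)%E.
  have [ic _] := cadlag_integral_cvg (cD x) lj lj1 ljT.
  rewrite /Rintegral fineK; last exact: integrable_fin_num ic.
  apply: eq_integral => t; rewrite inE/= in_itv/= => /andP[jt tj].
  rewrite /err (_ : step_process _ _ _ = sg (mesh 0 T k j) x)//.
  exact: (stepfE (fun i => sg (mesh 0 T k i) x) T0 jk jt tj).
under eq_fun do rewrite E.
apply: emeasurable_funD; first exact: IH (ltnW jk).
apply/measurable_EFinP.
apply: (measurable_time_integral (T := T) (U := fun t x => (sg (mesh 0 T k j) x - sg t x) ^+ 2)) => //.
move=> t /andP[t1 t2]; apply: measurable_funX; apply: measurable_funB.
  exact: (adapted_measurable hF hsg).
by apply: (adapted_measurable hF hsg); rewrite (le_trans lj t1) (le_trans t2).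
Qed.

Hypothesis hfin : {ae P, forall x, (jump_number (sg ^~ x) `]0%R, T] < +oo)%E}.

(** Only grids with a multiple of [n] cells occur, so that observation times are mesh points and the
    step integral splits exactly over the observation intervals. *)
Lemma left_steps_cvg n : (0 < n)%N ->
  cvg_proba0 P (fun m x => \int[mu]_(t in `[0%R, T])
    ((step_process (left_steps sg (n * m.+1)) t x - sg t x) ^+ 2)%:E)%E.
Proof.
move=> n0; have [N [mN N0 subN]] := hfin.
apply: (ae_cvg_proba0 _ mN N0) => [m|x /(contra_not (subN x))/contrapT fx].
  by apply: measurable_left_steps_error; rewrite muln_gt0 n0.
have := cadlag_left_step_L2 hT (hsg.2 x) fx.
have /cvg_comp : (fun m => n * m.+1)%N @ \oo --> \oo.
  move=> A [K _ hK]; exists K => // m /= Km; apply: hK => /=.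
  by rewrite (leq_trans Km)// (leq_trans (leqnSn m))// leq_pmull.
by apply.
Qed.

End Integrand.

Section Increment.
Variables (w sg Mt : R -> Omega -> R).
Hypotheses (hw : wiener_process P T F w) (hsg : cadlag_adapted T F sg).
Hypothesis hM : ito_integral P T F w sg Mt.
Hypothesis hfin : {ae P, forall x, (jump_number (sg ^~ x) `]0%R, T] < +oo)%E}.

Lemma step_integral_mesh k p x : (p <= k)%N ->
  step_integral w (left_steps sg k) (mesh 0 T k p) x =
  \sum_(0 <= i < p) sg (mesh 0 T k i) x * (w (mesh 0 T k i.+1) x - w (mesh 0 T k i) x).
Proof.
move=> pk; have T0 := ltW hT.
rewrite /step_integral/= -(big_mkord xpredT (fun i => sg (mesh 0 T k i) x *
  (w (Num.min (mesh 0 T k i.+1) (mesh 0 T k p)) x - w (Num.min (mesh 0 T k i) (mesh 0 T k p)) x))).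
rewrite (big_cat_nat _ pk)//= [X in _ + X](_ : _ = 0) ?addr0; last first.
  rewrite big_nat big1// => i /andP[p_i _]; rewrite !min_r ?subrr ?mulr0//; apply: mesh_le => //.
  exact: leqW.
rewrite !big_nat; apply: eq_bigr => i /andP[_ ip].
by rewrite !min_l//; apply: mesh_le => //; exact: ltnW.
Qed.

Lemma mesh_refine n m j l : (0 < n)%N -> (0 < m)%N ->
  mesh 0 T (n * m) (j * m + l) = mesh (mesh 0 T n j) (mesh 0 T n j.+1) m l.
Proof.
move=> n0 m0; rewrite /mesh natrD !natrM -natr1.
by field; rewrite !pnatr_eq0 -!lt0n n0 m0.
Qed.

(** The left-point sum over the refinement of [a, b] is the difference of the step integrals at [b]
    and at [a]; the term with [sg a] telescopes. The error is at most the sum of the errors at the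
    two times. *)
Lemma ito_increment_cvg n j : (j < n)%N ->
  let a := mesh 0 T n j in let b := mesh 0 T n j.+1 in
  cvg_proba0 P (fun m x => `|\sum_(l < m.+1) (sg (mesh a b m.+1 l) x - sg a x) *
     (w (mesh a b m.+1 l.+1) x - w (mesh a b m.+1 l) x)
     - (Mt b x - Mt a x - sg a x * (w b x - w a x))|%:E).
Proof.
move=> jn a b; have n0 : (0 < n)%N by exact: leq_ltn_trans jn.
have T0 := ltW hT.
have aT : 0 <= a <= T by apply: mesh_itv => //; exact: ltnW.
have bT : 0 <= b <= T by apply: mesh_itv.
have ab : a <= b by exact: mesh_le.
have mw t : 0 <= t <= T -> measurable_fun setT (w t).
  move=> tT; apply: measurable_wrtW (filtration_sub hF tT) _.
  by have [+ _ _ _ _] := hw; apply.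
have msg t : 0 <= t <= T -> measurable_fun setT (sg t).
  by move=> tT; exact: (adapted_measurable hF hsg).
have mM t : 0 <= t <= T -> measurable_fun setT (Mt t) by have [+ _ _] := hM; apply.
have SI m i : (0 < m)%N -> (i <= n)%N -> forall x,
    step_integral w (left_steps sg (n * m)) (mesh 0 T n i) x =
    \sum_(0 <= l < i * m) sg (mesh 0 T (n * m) l) x *
      (w (mesh 0 T (n * m) l.+1) x - w (mesh 0 T (n * m) l) x).
  move=> m0 i_n x; rewrite -step_integral_mesh ?leq_mul2r ?i_n ?orbT//.
  have := mesh_refine i 0 n0 m0; rewrite addn0 => ->.
  by rewrite mesh0.
have mSI m t : (0 < m)%N -> 0 <= t <= T ->
    measurable_fun setT (step_integral w (left_steps sg (n * m)) t).
  move=> m0 /andP[t0 tT]; apply: measurable_sum => i /=.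
  have it : forall p, (p <= n * m)%N -> 0 <= mesh 0 T (n * m) p <= T.
    by move=> p pm; exact: mesh_itv.
  have mit p : (p <= n * m)%N -> 0 <= Num.min (mesh 0 T (n * m) p) t <= T.
    by move=> /it/andP[h1 h2]; rewrite le_min h1 t0 ge_min h2.
  apply: measurable_funM; first by apply: msg; apply: it; exact: ltnW.
  by apply: measurable_funB; apply: mw; apply: mit => //; exact: ltnW.
have cS t : 0 <= t <= T -> cvg_proba0 P (fun m x =>
    `|step_integral w (left_steps sg (n * m.+1)) t x - Mt t x|%:E).
  have [_ _ H] := hM; apply: H; last exact: left_steps_cvg.
  by move=> m; apply: simple_left_steps; rewrite ?muln_gt0 ?n0.
have ms m l : (l <= m.+1)%N -> 0 <= mesh a b m.+1 l <= T.
  move=> lm; rewrite (le_trans _ (mesh_ge _ _ ab)) ?(andP aT).1//.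
  by rewrite (le_trans (mesh_le_last ab lm))// (andP bT).2.
apply: (@cvg_proba0_le2
  (fun m x => step_integral w (left_steps sg (n * m.+1)) b x - Mt b x)
  (fun m x => step_integral w (left_steps sg (n * m.+1)) a x - Mt a x)).
- by move=> m; apply: measurable_funB; [exact: mSI|exact: mM].
- by move=> m; apply: measurable_funB; [exact: mSI|exact: mM].
- move=> m; apply: measurable_funB.
    apply: measurable_sum => l; apply: measurable_funM.
      by apply: measurable_funB; apply: msg => //; apply: ms; exact: ltnW.
    by apply: measurable_funB; apply: mw; apply: ms => //; exact: ltnW.
  apply: measurable_funB; first by apply: measurable_funB; exact: mM.
  by apply: measurable_funM; [exact: msg|apply: measurable_funB; exact: mw].
- move=> m x.
  have -> : \sum_(l < m.+1) (sg (mesh a b m.+1 l) x - sg a x) *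
       (w (mesh a b m.+1 l.+1) x - w (mesh a b m.+1 l) x) =
     step_integral w (left_steps sg (n * m.+1)) b x
     - step_integral w (left_steps sg (n * m.+1)) a x - sg a x * (w b x - w a x).
    have tel : w b x - w a x = \sum_(l < m.+1) (w (mesh a b m.+1 l.+1) x - w (mesh a b m.+1 l) x).
      rewrite -(big_mkord xpredT (fun l => w (mesh a b m.+1 l.+1) x - w (mesh a b m.+1 l) x)).
      by rewrite telescope_sumr// mesh_last// mesh0.
    rewrite !SI// 1?ltnW// (@big_cat_nat _ _ _ (j * m.+1) 0 (j.+1 * m.+1))//=; last first.
      by rewrite leq_mul2r leqnSn orbT.
    rewrite [X in X - _ - _]addrC addrK -[X in \sum_(X <= _ < _) _]add0n big_addn mulSn addnK.
    rewrite big_mkord tel mulr_sumr -sumrB; apply: eq_bigr => l _.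
    have mr i : mesh a b m.+1 i = mesh 0 T (n * m.+1) (i + j * m.+1).
      by rewrite addnC mesh_refine.
    by rewrite !mr addSn mulrBl.
  set A := step_integral _ _ _ _; set B := step_integral _ _ _ _.
  rewrite (_ : _ - _ - _ - _ = (A - Mt b x) - (B - Mt a x)); last by ring.
  exact: ler_normB.
- exact: cS.
- exact: cS.
Qed.

End Increment.

(** [transform_moment] bounds the left-point sums uniformly in the refinement, and
    [moment_cvg_proba] passes to the limit at the price of the factor 2^(2k + 2). [C] is chosen
    before the processes, [n] and [j], as needed when sigma varies with [n]. *)
Lemma ito_increment_moment k : exists2 C : R, 0 <= C &
  forall (w sg Mt : R -> Omega -> R) n j B, wiener_process P T F w -> cadlag_adapted T F sg ->
  ito_integral P T F w sg Mt ->
  {ae P, forall x, (jump_number (sg ^~ x) `]0%R, T] < +oo)%E} ->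
  (j < n)%N -> let a := mesh 0 T n j in let b := mesh 0 T n j.+1 in
  (forall s, a <= s <= b -> (moment P k.*2.+2 (fun x =>
     \1_[set x | nojump (sg ^~ x) a s] x * (sg s x - sg a x))%R <= B%:E)%E) ->
  (moment P k.*2.+2 (fun x => \1_[set x | nojump (sg ^~ x) a b] x *
     (Mt b x - Mt a x - sg a x * (w b x - w a x)))%R <= (C * (b - a) ^+ k.+1 * B)%:E)%E.
Proof.
have [K K0 taylor] := @taylor_even R k.
have [C2 C20 hC2] := wiener_moment P hF 2.
have [Ck Ck0 hCk] := wiener_moment P hF k.*2.+2.
pose m0 := C2 + Ck.
have m00 : 0 <= m0 by exact: addr_ge0.
exists (2 ^+ k.*2.+2 * (2 * K * m0 * expR (K * m0))).
  have K0' := ltW K0; rewrite mulr_ge0 ?exprn_ge0// mulr_ge0 ?expR_ge0//.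
  by rewrite mulr_ge0// mulr_ge0.
move=> w sg Mt n j B hw hsg hM hfin jn a b eB.
have n0 : (0 < n)%N by exact: leq_ltn_trans jn.
have T0 := ltW hT.
have aT : 0 <= a <= T by apply: mesh_itv => //; exact: ltnW.
have bT : 0 <= b <= T by apply: mesh_itv.
have ab : a < b.
  by rewrite /b meshS ltrDl subr0 divr_gt0// ltr0n.
have sT s : a <= s <= b -> 0 <= s <= T.
  by move=> /andP[s1 s2]; rewrite (le_trans (andP aT).1 s1) (le_trans s2)// (andP bT).2.
have mw t : 0 <= t <= T -> measurable_fun setT (w t).
  move=> tT; apply: measurable_wrtW (filtration_sub hF tT) _.
  by have [+ _ _ _ _] := hw; apply.
have msg t : 0 <= t <= T -> measurable_fun setT (sg t).
  by move=> tT; exact: (adapted_measurable hF hsg).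
have mM t : 0 <= t <= T -> measurable_fun setT (Mt t) by have [+ _ _] := hM; apply.
pose s m l := mesh a b m.+1 l.
have sab m l : (l <= m.+1)%N -> a <= s m l <= b by move=> lm; exact: mesh_itv (ltW ab) lm.
(* The indicator stops at [s m l], the left end of the small cell, which makes [e] measurable with
   respect to the past of the increment [xi]. *)
pose e m l x := \1_[set x | nojump (sg ^~ x) a (s m l)] x * (sg (s m l) x - sg a x).
pose xi m l x := w (s m l.+1) x - w (s m l) x.
have delta0 m : 0 < (b - a) / m.+1%:R by rewrite divr_gt0// subr_gt0.
have slt m l : s m l < s m l.+1 by rewrite /s meshS ltrDl.
have sdiff m l : s m l.+1 - s m l = (b - a) / m.+1%:R by rewrite /s meshS addrAC subrr add0r.
pose D : set Omega := [set x | nojump (sg ^~ x) a b].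
have mD : measurable D.
  apply: (filtration_sub hF bT); apply: (nojump_wrt hF) => //; [by case/andP: aT|exact: ltW|by case/andP: bT].
have mZ : measurable_fun setT (fun x => Mt b x - Mt a x - sg a x * (w b x - w a x)).
  apply: measurable_funB; first by apply: measurable_funB; exact: mM.
  by apply: measurable_funM; [exact: msg|apply: measurable_funB; exact: mw].
have mY m : measurable_fun setT (fun x => \sum_(l < m.+1) (sg (s m l) x - sg a x) * xi m l x).
  apply: measurable_sum => l; apply: measurable_funM.
    by apply: measurable_funB; apply: msg => //; apply: sT; apply: sab; exact: ltnW.
  by apply: measurable_funB; apply: mw; apply: sT; apply: sab => //; exact: ltnW.
rewrite -2!(mulrA (2 ^+ k.*2.+2)).
apply: (@moment_cvg_proba _ _ _ P _ (fun m x => \1_D x * \sum_(l < m.+1) (sg (s m l) x - sg a x) * xi m l x)) => //.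
- by move=> m; apply: measurable_funM => //; exact: measurable_indic.
- by apply: measurable_funM => //; exact: measurable_indic.
- have c := ito_increment_cvg hw hsg hM hfin jn.
  apply: (@cvg_proba0_le2 (fun m x => \sum_(l < m.+1) (sg (s m l) x - sg a x) * xi m l x
     - (Mt b x - Mt a x - sg a x * (w b x - w a x))) (fun m x => 0)).
  + by move=> m; exact: measurable_funB.
  + by move=> m; exact: measurable_cst.
  + by move=> m; apply: measurable_funB; apply: measurable_funM => //; exact: measurable_indic.
  + by move=> m x; rewrite normr0 addr0 -mulrBr normrM ler_piMl// ger0_norm//.
  + exact: c.
  + move=> r r0; apply: cvg_near_cst; apply: nearW => m.
    by rewrite normr0 (_ : [set _ | _] = set0) ?measure0// -subset0 => x /=; rewrite lee_fin leNgt r0.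
- move=> m.
  (* On [D] all the indicators inside [e] equal 1, and off [D] the left side vanishes. *)
  apply: (@le_trans _ _ (moment P k.*2.+2 (fun x => \sum_(l < m.+1) e m l x * xi m l x))).
    apply: moment_le => x; rewrite indicE; case: (boolP (x \in D)) => [|_]; last by rewrite mul0r normr0.
    rewrite inE /D /= => nj; rewrite mul1r le_eqVlt; apply/orP; left; apply/eqP; congr (`|_|).
    apply: eq_bigr => l _; rewrite /e indicE mem_set ?mul1r//= => r ar rs.
    apply: nj => //; apply: le_trans rs _.
    by have /andP[] := sab m l (ltnW (ltn_ord l)).
  have := @transform_moment _ _ _ P m.+1 (fun l => F (s m l)) (e m) (xi m) _ _ _ _ _ _ _ k m0
    ((b - a) / m.+1%:R) B K.
  have -> : m.+1%:R * ((b - a) / m.+1%:R) = b - a by rewrite mulrC divfK// pnatr_eq0.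
  apply => //.
  + by move=> i im; apply: (filtration_sigma hF); apply: sT; exact: sab.
  + by move=> i im; apply: (filtration_sub hF); apply: sT; exact: sab.
  + move=> i im; have /sT/andP[h1 _] := sab m i (ltnW im); have /sT/andP[_ h2] := sab m i.+1 im.
    by apply: hF.2 => //; exact: ltW.
  + move=> i im; have si := sab m i (ltnW im); have /andP[si0 siT] := sT _ si.
    apply: measurable_wrtM; first by apply: (filtration_sigma hF); exact: sT.
      apply: measurable_wrt_indic; first by apply: (filtration_sigma hF); exact: sT.
      apply: (nojump_wrt hF) => //; [by case/andP: aT|by case/andP: si].
    apply: measurable_wrtB; first by apply: (filtration_sigma hF); exact: sT.
      by apply: hsg.1; exact: sT.
    apply: (measurable_wrt_le hF (s := a)) => //; [by case/andP: aT|by case/andP: si|].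
    exact: hsg.1.
  + move=> i im; have /sT/andP[h1 _] := sab m i (ltnW im); have /sT/andP[_ h2] := sab m i.+1 im.
    by have [] := wiener_increment hF hw h1 (slt m i) h2.
  + move=> i im; have /sT/andP[h1 _] := sab m i (ltnW im); have /sT/andP[_ h2] := sab m i.+1 im.
    by have [] := wiener_increment hF hw h1 (slt m i) h2.
  + move=> i im; have /sT/andP[h1 _] := sab m i (ltnW im); have /sT/andP[_ h2] := sab m i.+1 im.
    exact: (wiener_mean hF hw h1 (slt m i) h2).
  + by move=> i im; apply: eB; apply: sab; exact: ltnW.
  + move=> i im; have /sT/andP[h1 _] := sab m i (ltnW im); have /sT/andP[_ h2] := sab m i.+1 im.
    apply: le_trans (hC2 _ _ _ hw h1 (slt m i) h2) _.
    have d0 := ltW (delta0 m); rewrite sdiff sqr_sqrtr// lee_fin ler_wpM2r//.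
    by rewrite /m0 lerDl.
  + move=> i im; have /sT/andP[h1 _] := sab m i (ltnW im); have /sT/andP[_ h2] := sab m i.+1 im.
    apply: le_trans (hCk _ _ _ hw h1 (slt m i) h2) _.
    have d0 := ltW (delta0 m).
    rewrite sdiff -doubleS -mul2n exprM sqr_sqrtr// lee_fin ler_wpM2r ?exprn_ge0//.
    by rewrite /m0 lerDr.
Qed.

End Ito.

(** * Rates of convergence *)

Section PowerRates.
Context {R : realType}.
Implicit Types (a b : R) (n : nat).

Lemma npowD n a b : (0 < n)%N -> n%:R `^ (a + b) = n%:R `^ a * n%:R `^ b :> R.
Proof. by move=> n0; rewrite powRD// pnatr_eq0 -lt0n n0 implybT. Qed.

Lemma npow_gt0 n a : (0 < n)%N -> 0 < n%:R `^ a :> R.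
Proof. by move=> n0; rewrite powR_gt0// ltr0n. Qed.

Lemma npow_le n a b : (0 < n)%N -> a <= b -> n%:R `^ a <= n%:R `^ b :> R.
Proof. by move=> n0 ab; apply: ler_powR; rewrite ?ler1n. Qed.

Lemma npow1 n : n%:R `^ 1 = n%:R :> R.
Proof. by rewrite powRr1. Qed.

Lemma npow_exp n a (k : nat) : (n%:R `^ a) ^+ k = n%:R `^ (a * k%:R) :> R.
Proof. by rewrite powRrM powR_mulrn// powR_ge0. Qed.

Lemma npow_dom (e C : R) : 0 < e -> \forall n \near \oo, (0 < n)%N /\ C <= n%:R `^ e.
Proof.
move=> e0; pose C1 := Num.max 1 C.
have C10 : 0 < C1 by rewrite lt_max ltr01.
exists (Num.truncn (C1 `^ e^-1)).+1 => // n /= nC.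
have n0 : (0 < n)%N by exact: leq_trans nC.
split=> //.
apply: (@le_trans _ _ C1); first by rewrite le_max lexx orbT.
have : C1 `^ e^-1 <= n%:R.
  by apply: ltW; rewrite (lt_le_trans (truncnS_gt _))// ler_nat.
move=> /(ge0_ler_powR (ltW e0)); rewrite !nnegrE powR_ge0 ler0n => /(_ isT isT).
by rewrite -powRrM mulVf ?gt_eqF// powRr1// ltW.
Qed.

End PowerRates.

Section Rates.
Context {R : realType} {d : measure_display} {Omega : measurableType d}.
Variable P : probability Omega R.
Implicit Types (Y Z : nat -> nat -> Omega -> R) (E : nat -> set Omega).

(** All even moments are of order n^a, uniformly in j; Markov's inequality at high orders turns this
    into [wop] bounds. The bounds hold for large n only, as the hypothesis on [card_frakL] is
    asymptotic; quantities without index j enter with a dummy one. *)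
Definition mom_bound Y (a : R) : Prop :=
  (forall n j, (0 < j <= n)%N -> measurable_fun setT (Y n j)) /\
  forall k, exists C : R, \forall n \near \oo, forall j, (0 < j <= n)%N ->
    (moment P k.*2 (Y n j) <= (C * (n%:R `^ a) ^+ k.*2)%:E)%E.

(* wop: with overwhelming probability *)
Definition wop E : Prop := forall L : nat, \forall n \near \oo, exists N : set Omega,
  [/\ measurable N, (P N <= (n%:R ^- L)%:E)%E & forall x, ~ N x -> E n x].

Lemma mom_bound_le Y a b : a <= b -> mom_bound Y a -> mom_bound Y b.
Proof.
move=> ab [mY bY]; split=> // k; have [C hC] := bY k; exists `|C|.
near=> n => j jn; have n0 : (0 < n)%N by near: n; exact: nbhs_infty_gt.
apply: (@le_trans _ _ (C * (n%:R `^ a) ^+ k.*2)%:E); first by move: j jn; near: n.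
rewrite lee_fin; apply: (@le_trans _ _ (`|C| * (n%:R `^ a) ^+ k.*2)).
  by rewrite ler_wpM2r ?ler_norm// exprn_ge0// powR_ge0.
by rewrite ler_wpM2l// lerXn2r ?nnegrE ?powR_ge0// npow_le.
Unshelve. all: by end_near. Qed.

Lemma mom_bound_norm_le Y Z a :
  (forall n j, (0 < j <= n)%N -> measurable_fun setT (Y n j)) ->
  (forall n j, (0 < j <= n)%N -> forall x, `|Y n j x| <= `|Z n j x|) ->
  mom_bound Z a -> mom_bound Y a.
Proof.
move=> mY YZ [mZ bZ]; split=> // k; have [C hC] := bZ k; exists C.
apply: filterS hC => n hn j jn; apply: le_trans (hn j jn).
by apply: moment_le; exact: YZ.
Qed.

Lemma mom_boundD Y Z a : mom_bound Y a -> mom_bound Z a ->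
  mom_bound (fun n j x => Y n j x + Z n j x) a.
Proof.
move=> [mY bY] [mZ bZ]; split=> [n j jn|k]; first by apply: measurable_funD; [exact: mY|exact: mZ].
have [C hC] := bY k; have [D hD] := bZ k; exists (2 ^+ k.*2 * (C + D)).
near=> n => j jn; rewrite -mulrA mulrDl; apply: moment_add.
- exact: mY.
- exact: mZ.
- by move: j jn; near: n.
- by move: j jn; near: n.
Unshelve. all: by end_near. Qed.

Lemma mom_bound_cst (c a : R) : mom_bound (fun n _ _ => c * n%:R `^ a) a.
Proof.
split=> [n j _|k]; first exact: measurable_cst.
exists (`|c| ^+ k.*2); apply: nearW => n j _; rewrite /moment expect_cst normrM exprMn.
by rewrite [X in _ * X ^+ _]ger0_norm// powR_ge0.
Qed.

(* Z need not be measurable: its norm is then a lower integral, which is still monotone. *)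
Lemma mom_bound_of_norm Y a :
  (forall n j, (0 < j <= n)%N -> measurable_fun setT (Y n j)) ->
  (forall p : R, 1 < p -> exists C : R, \forall n \near \oo, forall j, (0 < j <= n)%N ->
    exists Z : Omega -> R, ('N[P]_(p%:E)[EFin \o Z] <= (C * n%:R `^ a)%:E)%E /\
      {ae P, forall x, `|Y n j x| <= `|Z x|}) -> mom_bound Y a.
Proof.
move=> mY H; split=> // -[|k].
  exists 1; apply: nearW => n j _; rewrite /moment double0.
  by under eq_integral do rewrite expr0; rewrite expect_cst expr0 mulr1.
have [|C hC] := H (k.+1.*2)%:R; first by rewrite ltr1n doubleS.
exists (`|C| ^+ k.+1.*2); apply: filterS hC => n hn j jn.
have [Z [hZ [N [mN N0 subN]]]] := hn j jn.
apply: (@le_trans _ _ (moment P k.+1.*2 Z)).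
  apply: moment_ae_le mN N0 _; first exact: mY.
  by move=> x Nx; apply: contra_notT Nx => h; apply: subN => /=; exact/negP.
apply: le_trans (moment_Lnorm _ hZ) _; first by rewrite doubleS.
by rewrite normrM exprMn [X in _ * X ^+ _]ger0_norm// powR_ge0.
Qed.

Lemma wopI E E' : wop E -> wop E' -> wop (fun n => E n `&` E' n).
Proof.
move=> hE hE' L; near=> n.
have [N [mN PN EN]] : exists N : set Omega,
  [/\ measurable N, (P N <= (n%:R ^- L.+1)%:E)%E & forall x, ~ N x -> E n x] by near: n; exact: hE.
have [N' [mN' PN' EN']] : exists N : set Omega,
  [/\ measurable N, (P N <= (n%:R ^- L.+1)%:E)%E & forall x, ~ N x -> E' n x] by near: n; exact: hE'.
(* Both sets are taken at level L + 1, and 2 n^(-L-1) <= n^(-L) once n >= 2. *)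
have n1 : (2 <= n)%N by near: n; exact: nbhs_infty_ge.
have n0 : 0 < n%:R :> R by rewrite ltr0n (leq_trans _ n1).
exists (N `|` N'); split; first exact: measurableU.
  apply: (le_trans (measureU2 _ mN mN')); apply: (le_trans (leeD PN PN')).
  rewrite -EFinD lee_fin exprS invfM -mulrDl; apply: ler_piMl; first by rewrite invr_ge0 exprn_ge0// ltW.
  apply: (@le_trans _ _ (2^-1 + 2^-1)); last lra.
  by rewrite lerD// lef_pV2 ?posrE// ler_nat.
by move=> x /not_orP[/EN ? /EN' ?]; split.
Unshelve. all: by end_near. Qed.

Lemma wop_sub E E' : (\forall n \near \oo, E n `<=` E' n) -> wop E -> wop E'.
Proof.
move=> EE' hE L; near=> n.
have [N [mN PN EN]] : exists N : set Omega,
  [/\ measurable N, (P N <= (n%:R ^- L)%:E)%E & forall x, ~ N x -> E n x] by near: n; exact: hE.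
exists N; split=> // x /EN; apply: (near EE' n) => //.
Unshelve. all: by end_near. Qed.

Lemma wop_ae E : (forall n, (0 < n)%N -> {ae P, forall x, E n x}) -> wop E.
Proof.
move=> H L; exists 1%N => // n /= n0; have [N [mN N0 subN]] := H n n0.
exists N; split=> //; first by rewrite N0 lee_fin invr_ge0 exprn_ge0.
by move=> x /(contra_not (subN x))/contrapT.
Qed.

(** Markov's inequality with a moment of high order, then a union bound over the indices. *)
Lemma mom_wop Y a e : 0 < e -> mom_bound Y a ->
  wop (fun n => [set x | forall j, (0 < j <= n)%N -> `|Y n j x| <= n%:R `^ (a + e)]).
Proof.
move=> e0 [mY bY] L.
(* Two extra powers of n are provided: one for the union over n indices, one for the moment constant
   [C], at most n eventually. *)
pose k := (Num.truncn ((L%:R + 2) / e)).+1.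
have ke : L%:R + 2 <= e * k.*2%:R.
  rewrite mulrC -ler_pdivrMr//; apply: ltW; apply: (lt_le_trans (truncnS_gt _)).
  by rewrite -/k ler_nat -addnn leq_addl.
have [C hC] := bY k.
near=> n.
have n0 : (0 < n)%N by near: n; exact: nbhs_infty_gt.
have nC : C <= n%:R.
  have : (0 < n)%N /\ C <= n%:R `^ 1 by near: n; exact: npow_dom.
  by rewrite npow1 => -[].
have hn : forall j, (0 < j <= n)%N -> (moment P k.*2 (Y n j) <= (C * (n%:R `^ a) ^+ k.*2)%:E)%E.
  by near: n.
pose B i : set Omega := [set x | (i < n)%N && (n%:R `^ (a + e) < `|Y n i.+1 x|)].
have BE i : (i < n)%N -> B i = [set x | n%:R `^ (a + e) < `|Y n i.+1 x|].
  by move=> i_n; rewrite /B i_n.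
have mB i : measurable (B i).
  rewrite /B; case: (ltnP i n) => i_n; last first.
    by rewrite (_ : [set x | _] = set0)// -subset0 => x /=.
  rewrite -[X in measurable X]setTI; apply: measurable_fun_ltr => //.
  by apply: measurableT_comp; [exact: normr_measurable|exact: mY].
exists (\big[setU/set0]_(i < n) B i); split.
- exact: bigsetU_measurable.
- apply: le_trans; first by apply: Boole_inequality => *; exact: mB.
  apply: (@le_trans _ _ (\sum_(i < n) (n%:R ^- L.+1)%:E)%E).
    apply: lee_sum => i _; rewrite BE//.
    have ji : (0 < i.+1 <= n)%N by rewrite ltn_ord.
    apply: (le_trans (markov_moment (mY _ _ ji) (npow_gt0 _ n0) (hn _ ji))).
    have pa : n%:R `^ a ^+ k.*2 != 0 :> R by rewrite expf_neq0// gt_eqF// npow_gt0.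
    rewrite lee_fin npowD// exprMn [_ ^+ _ * _]mulrC -mulf_div divff// mulr1 npow_exp.
    rewrite ler_pdivrMr ?npow_gt0// -powR_mulrn// -powRN -npowD//.
    apply: (le_trans nC); rewrite -[leLHS]npow1; apply: npow_le => //.
    by rewrite -natr1; lra.
  rewrite sumEFin lee_fin sumr_const card_ord -[_ *+ n]mulr_natr.
  have n1 : n%:R != 0 :> R by rewrite pnatr_eq0 -lt0n.
  suff -> : n%:R ^- L.+1 * n%:R = n%:R ^- L :> R by [].
  by rewrite exprS; field; rewrite n1 expf_neq0.
- move=> x NB j /andP[j0 jn]; rewrite leNgt; apply/negP => h; apply: NB.
  rewrite -bigcup_mkord; exists j.-1 => /=; rewrite ?prednK//.
  by rewrite /B /= prednK// jn.
Unshelve. all: by end_near. Qed.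

End Rates.

(** * The error terms of the model *)

Section CadlagIntegral.
Context {R : realType}.
Notation mu := (@lebesgue_measure R).
Variables (T : R) (f : R -> R).
Hypotheses (hT : 0 < T) (cf : cadlag T f).

Lemma cadlag_integral_itv t : 0 <= t <= T ->
  \int[mu]_(s in `[0, t]) f s = \int[mu]_(s in `]0, t]) f s.
Proof.
move=> /andP[t0 tT]; rewrite Rintegral_itv_obnd_cbnd//.
by have [] := cadlag_integral_cvg cf (lexx 0) t0 tT.
Qed.

Lemma cadlag_integral_increment a b : 0 <= a -> a <= b -> b <= T ->
  \int[mu]_(s in `[0, b]) f s - \int[mu]_(s in `[0, a]) f s = \int[mu]_(s in `]a, b]) f s.
Proof.
move=> a0 ab bT; have b0 := le_trans a0 ab.
rewrite !cadlag_integral_itv ?a0 ?b0 ?bT ?(le_trans ab)//.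
by rewrite Rintegral_itvB ?bnd_simp//; have [] := cadlag_integral_cvg cf (lexx 0) b0 bT.
Qed.

Lemma gridE n j : grid T n j = mesh 0 T n j.
Proof. by rewrite /grid /mesh add0r subr0 mulrA. Qed.

Lemma grid_le n i j : (i <= j)%N -> grid T n i <= grid T n j.
Proof. by move=> ij; rewrite !gridE; apply: mesh_le => //; exact: ltW. Qed.

Lemma grid_itv n j : (j <= n)%N -> 0 <= grid T n j <= T.
Proof. by move=> jn; rewrite gridE; apply: mesh_itv => //; exact: ltW. Qed.

Lemma grid_step n j : (0 < j)%N -> grid T n j - grid T n j.-1 = T / n%:R.
Proof. by case: j => // j _; rewrite !gridE meshS addrAC subrr add0r subr0. Qed.

Lemma grid0 n : grid T n 0 = 0.
Proof. by rewrite gridE mesh0. Qed.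

Lemma grid_last n : (0 < n)%N -> grid T n n = T.
Proof. by move=> n0; rewrite gridE mesh_last. Qed.

Lemma cadlag_integral_grid n : (0 < n)%N -> \int[mu]_(s in `[0, T]) f s =
  \sum_(1 <= j < n.+1) \int[mu]_(s in `]grid T n j.-1, grid T n j]) f s.
Proof.
move=> n0; rewrite -[X in `[0, X]](grid_last n0).
suff H i : (i <= n)%N -> \int[mu]_(s in `[0, grid T n i]) f s =
    \sum_(1 <= j < i.+1) \int[mu]_(s in `]grid T n j.-1, grid T n j]) f s by exact: H.
elim: i => [_|i IH i_n]; first by rewrite grid0 set_itv1 Rintegral_set1 big_geq.
rewrite big_nat_recr//= -IH 1?ltnW//.
have /andP[g0 _] := grid_itv (ltnW i_n); have /andP[_ gT] := grid_itv i_n.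
by rewrite -(cadlag_integral_increment g0 (grid_le n (leqnSn i)) gT) addrC subrK.
Qed.

End CadlagIntegral.

Section MomentBounds.
Context {R : realType} {d : measure_display} {Omega : measurableType d}.
Variable P : probability Omega R.
Implicit Types (Y : nat -> nat -> Omega -> R).

Lemma moment0 (Y : Omega -> R) : moment P 0 Y = 1%:E.
Proof. by rewrite /moment; under eq_integral do rewrite expr0; exact: expect_cst. Qed.

Lemma mom_boundS Y a : (forall n j, (0 < j <= n)%N -> measurable_fun setT (Y n j)) ->
  (forall k, exists C : R, \forall n \near \oo, forall j, (0 < j <= n)%N ->
    (moment P k.+1.*2 (Y n j) <= (C * (n%:R `^ a) ^+ k.+1.*2)%:E)%E) ->
  mom_bound P Y a.
Proof.
move=> mY bY; split=> // -[|k]; last exact: bY.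
by exists 1; apply: nearW => n j _; rewrite double0 moment0 expr0 mulr1.
Qed.

Lemma npowN1 n : n%:R `^ (-1) = n%:R^-1 :> R.
Proof. by rewrite powR_inv1. Qed.

End MomentBounds.

Section Model.
Context {R : realType} {d : measure_display} {Omega : measurableType d}.
Variable P : probability Omega R.
Notation mu := (@lebesgue_measure R).
Variables (T : R) (F : R -> set (set Omega)) (w : R -> Omega -> R).
Hypotheses (hT : 0 < T) (hF : filtration T F) (hw : wiener_process P T F w).
Variable sigma : nat -> R -> Omega -> R.
Hypothesis hsigma : forall n, (0 < n)%N -> cadlag_adapted T F (sigma n).
Hypothesis hsigmafin : forall n, (0 < n)%N -> {ae P, forall omega,
  (jump_number (sigma n ^~ omega) `]0%R, T] < +oo)%E}.
Hypothesis h1i : forall p : R, 1 < p -> exists C : R,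
  forall n t, (0 < n)%N -> 0 <= t <= T ->
    ('N[P]_(p%:E)[EFin \o sigma n t] <= C%:E)%E.

Notation tl n j := (grid T n j.-1).
Notation tr n j := (grid T n j).

Lemma tl_itv n j : (0 < j <= n)%N -> 0 <= tl n j <= T.
Proof. by move=> /andP[j0 jn]; apply: grid_itv => //; rewrite (leq_trans _ jn)// leq_pred. Qed.

Lemma tr_itv n j : (0 < j <= n)%N -> 0 <= tr n j <= T.
Proof. by move=> /andP[j0 jn]; exact: grid_itv. Qed.

Lemma tl_lt_tr n j : (0 < j <= n)%N -> tl n j < tr n j.
Proof.
move=> /andP[j0 jn]; rewrite -subr_gt0 grid_step// divr_gt0// ltr0n.
exact: leq_trans jn.
Qed.

Lemma measurable_sigma n t : (0 < n)%N -> 0 <= t <= T -> measurable_fun setT (sigma n t).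
Proof. by move=> n0 tT; exact: (adapted_measurable hF (hsigma n0)). Qed.

Lemma ord_gt0 n j : (0 < j <= n)%N -> (0 < n)%N.
Proof. by move=> /andP[j0]; exact: leq_trans. Qed.

Lemma mom_sigma : mom_bound P (fun n j => sigma n (tl n j)) 0.
Proof.
apply: mom_bound_of_norm => [n j jn|p p1].
  exact: (measurable_sigma (ord_gt0 jn) (tl_itv jn)).
have [C hC] := h1i p1; exists C; apply: nearW => n j jn; exists (sigma n (tl n j)).
by rewrite powRr0 mulr1; split; [exact: hC (ord_gt0 jn) (tl_itv jn)|exact: aeW].
Qed.

Lemma moment_sigma k : exists2 C : R, 0 <= C & forall n t, (0 < n)%N -> 0 <= t <= T ->
  (moment P k.*2 (sigma n t) <= C%:E)%E.
Proof.
case: k => [|k]; first by exists 1 => // n t _ _; rewrite moment0.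
have [|C hC] := @h1i (k.+1.*2)%:R; first by rewrite ltr1n doubleS.
exists (`|C| ^+ k.+1.*2) => [|n t n0 tT]; first exact: exprn_ge0.
by apply: moment_Lnorm; [rewrite doubleS|exact: hC].
Qed.

Lemma cadlag_sigma2 n x : (0 < n)%N -> cadlag T (fun t => sigma n t x ^+ 2).
Proof. by move=> n0; apply: cadlag_sqr; exact: (hsigma n0).2. Qed.

Lemma moment_sigma2 k : exists2 C : R, 0 <= C & forall n t, (0 < n)%N -> 0 <= t <= T ->
  (moment P k.*2 (fun x => sigma n t x ^+ 2)%R <= C%:E)%E.
Proof.
have [C C0 hC] := moment_sigma k.*2; exists (C + C) => [|n t n0 tT]; first exact: addr_ge0.
have -> : (fun x => sigma n t x ^+ 2) = (fun x => sigma n t x * sigma n t x).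
  by apply/funext => x; rewrite expr2.
have := @moment_mul _ _ _ P k.*2 (sigma n t) (sigma n t) 1 1 C C.
by rewrite !(expr1n, mulr1); apply => //; (exact: measurable_sigma || exact: hC).
Qed.

Definition qvar n j x := \int[mu]_(t in `]tl n j, tr n j]) (sigma n t x ^+ 2).

Definition Theta n x := \int[mu]_(t in `[0, T]) (sigma n t x ^+ 2).

(** The rate n^(-1) is the length T / n of the interval. *)
Lemma mom_time_integral (U : nat -> R -> Omega -> R) :
  (forall n x, (0 < n)%N -> cadlag T (U n ^~ x)) ->
  (forall n t, (0 < n)%N -> 0 <= t <= T -> measurable_fun setT (U n t)) ->
  (forall k, exists2 C : R, 0 <= C & forall n t, (0 < n)%N -> 0 <= t <= T ->
    (moment P k.*2 (U n t) <= C%:E)%E) ->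
  mom_bound P (fun n j x => \int[mu]_(t in `]tl n j, tr n j]) U n t x)%R (-1).
Proof.
move=> cU mU bU.
have sub n j t : (0 < j <= n)%N -> tl n j <= t <= tr n j -> 0 <= t <= T.
  move=> jn /andP[t1 t2]; have /andP[h1 _] := tl_itv jn; have /andP[_ h2] := tr_itv jn.
  by rewrite (le_trans h1)// (le_trans t2).
apply: mom_boundS => [n j jn|k].
  have [/andP[h1 _] /andP[_ h2]] := (tl_itv jn, tr_itv jn).
  have n0 := ord_gt0 jn.
  apply: (measurable_time_integral (T := T)) => //.
  - by apply: ltW; exact: tl_lt_tr.
  - by move=> x; exact: cU.
  - by move=> t tt; apply: mU => //; exact: sub tt.
have [C C0 hC] := bU k.+1; exists (T ^+ k.+1.*2 * C); apply: nearW => n j jn.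
have [/andP[h1 _] /andP[_ h2]] := (tl_itv jn, tr_itv jn).
have n0 := ord_gt0 jn.
have := @time_integral_moment _ _ _ P T (tl n j) (tr n j) (U n) h1
  (ltW (tl_lt_tr jn)) h2 _ _ k.+1 C.
rewrite grid_step; last by case/andP: jn.
rewrite npowN1 exprMn mulrAC; apply.
- by move=> x; exact: cU.
- by move=> t tt; apply: mU => //; exact: sub tt.
- by move=> t tt; apply: hC => //; exact: sub tt.
Qed.

Lemma mom_qvar : mom_bound P qvar (-1).
Proof.
apply: (mom_time_integral (U := fun n t x => sigma n t x ^+ 2)).
- by move=> n x; exact: cadlag_sigma2.
- by move=> n t n0 tT; apply: measurable_funX; exact: measurable_sigma.
- exact: moment_sigma2.
Qed.

(** Enters through the dominating variable on the exceptional event. *)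
Lemma mom_Theta : mom_bound P (fun n _ x => Theta n x) 0.
Proof.
have E n x : (0 < n)%N -> Theta n x = \int[mu]_(t in `]0, T]) (sigma n t x ^+ 2).
  move=> n0; rewrite /Theta (cadlag_integral_itv (cadlag_sigma2 x n0))// lexx andbT.
  exact: ltW.
have mU n t : (0 < n)%N -> 0 <= t <= T -> measurable_fun setT (fun x => sigma n t x ^+ 2).
  by move=> n0 tT; apply: measurable_funX; exact: measurable_sigma.
have T0 := ltW hT.
apply: mom_boundS => [n j /ord_gt0 n0|k].
  under eq_fun do rewrite E//.
  apply: (measurable_time_integral (T := T) (U := fun t x => sigma n t x ^+ 2)) => //.
  - by move=> x; exact: cadlag_sigma2.
  - by move=> t tt; exact: mU.
have [C C0 hC] := moment_sigma2 k.+1; exists (T ^+ k.+1.*2 * C); apply: nearW => n j /ord_gt0 n0.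
have := @time_integral_moment _ _ _ P T 0 T (fun t x => sigma n t x ^+ 2) (lexx 0)
  T0 (lexx T) _ _ k.+1 C.
rewrite subr0 powRr0 expr1n mulr1 (_ : (fun x => _) = (fun x => Theta n x)); last first.
  by apply/funext => x; rewrite E.
apply.
- by move=> x; exact: cadlag_sigma2.
- by move=> t tt; exact: mU.
- by move=> t tt; exact: hC.
Qed.

Variable sigmat : R -> Omega -> R.
Hypothesis hsigmat : forall n, (0 < n)%N -> {ae P, forall omega,
  forall t, 0 <= t <= T ->
    sigmat t omega = sigma n t omega - jump_sum (sigma n ^~ omega) t}.
Hypothesis h1i' : forall p : R, 1 < p -> exists C : R,
  forall s t, 0 <= s <= T -> 0 <= t <= T ->
    ('N[P]_(p%:E)[EFin \o (sigmat t \- sigmat s)%R]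
       <= (C * `|t - s| `^ 2^-1)%:E)%E.

(** Concerns sigma alone; it contains the set [Dset], where [J] is free of jumps as well. *)
Definition Dsig n j : set Omega := [set x | nojump (sigma n ^~ x) (tl n j) (tr n j)].

(** Without jumps on ]a, s] the sum of jumps is the same at both times, so the increment of sigma is
    that of [sigmat], which is Holder of exponent 1/2 in every norm. *)
Lemma moment_sigma_diff k : exists2 C : R, 0 <= C & forall n a s, (0 < n)%N -> 0 <= a -> a <= s -> s <= T ->
  (moment P k.*2 (fun x => \1_[set x | nojump (sigma n ^~ x) a s] x * (sigma n s x - sigma n a x))%R
   <= (C * (s - a) ^+ k)%:E)%E.
Proof.
case: k => [|k].
  by exists 1 => // n a s _ _ _ _; rewrite double0 moment0 expr0 mulr1.
have [|C hC] := @h1i' (k.+1.*2)%:R; first by rewrite ltr1n doubleS.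
exists (`|C| ^+ k.+1.*2) => [|n a s n0 a0 as_ sT]; first exact: exprn_ge0.
have aT : 0 <= a <= T by rewrite a0 (le_trans as_).
have sT' : 0 <= s <= T by rewrite (le_trans a0).
have [N [mN N0 subN]] := hsigmat n0.
apply: (@le_trans _ _ (moment P k.+1.*2 (sigmat s \- sigmat a))).
  apply: (@moment_ae_le _ _ _ P _ _ _ N) => //.
    apply: measurable_funM; last by apply: measurable_funB; exact: measurable_sigma.
    apply: measurable_indic; apply: (filtration_sub hF sT').
    exact: (nojump_wrt hF (hsigma n0)).
  move=> x /(contra_not (subN x))/contrapT h.
  rewrite /= !h// indicE; case: (boolP (x \in _)) => [|_]; last by rewrite mul0r normr0.
  rewrite inE/= => nj; rewrite mul1r (jump_sum_nojump as_ nj).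
  by rewrite opprB addrA subrK.
apply: (le_trans (moment_Lnorm _ (hC _ _ aT sT'))); first by rewrite doubleS.
have sa0 : 0 <= s - a by rewrite subr_ge0.
rewrite lee_fin normrM exprMn (ger0_norm (powR_ge0 _ _)) (ger0_norm sa0).
by rewrite ler_wpM2l ?exprn_ge0// powR12_sqrt// -mul2n exprM sqr_sqrtr.
Qed.


Lemma measurable_Dsig n j : (0 < j <= n)%N -> measurable (Dsig n j).
Proof.
move=> jn; have [/andP[h1 _] h2] := (tl_itv jn, tr_itv jn); have /andP[_ h3] := h2.
apply: (filtration_sub hF h2); apply: (nojump_wrt hF (hsigma (ord_gt0 jn))) => //.
by apply: ltW; exact: tl_lt_tr.
Qed.

Definition qerr n j x := \1_(Dsig n j) x * (qvar n j x - T / n%:R * sigma n (tl n j) x ^+ 2).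

(** The difference of squares factors into an increment of order h^(1/2) and a bounded sum;
    integration over length h gives h^(3/2). *)
Lemma mom_qerr : mom_bound P qerr (- (3 / 2)).
Proof.
apply: mom_boundS => [n j jn|k].
  apply: measurable_funM; first by apply: measurable_indic; exact: measurable_Dsig.
  apply: measurable_funB; first exact: mom_qvar.1.
  apply: measurable_funM; first exact: measurable_cst.
  by apply: measurable_funX; apply: measurable_sigma; [exact: ord_gt0 jn|exact: tl_itv].
have [C C0 hC] := moment_sigma k.+1.*2; have [D D0 hD] := moment_sigma_diff k.+1.*2.
pose m := k.+1; pose B := D + 2 ^+ m.*2.*2 * (C + C).
exists (T ^+ (m.*2 + m) * B); apply: nearW => n j jn.
have [aT bT] := (tl_itv jn, tr_itv jn).
have [/andP[h1 _] /andP[_ h2]] := (tl_itv jn, tr_itv jn).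
have n0 := ord_gt0 jn; have ab := tl_lt_tr jn.
have h0 : 0 < T / n%:R by rewrite divr_gt0// ltr0n.
have hstep : tr n j - tl n j = T / n%:R by rewrite grid_step//; case/andP: jn.
have sub t : tl n j <= t <= tr n j -> 0 <= t <= T.
  by move=> /andP[t1 t2]; rewrite (le_trans h1)// (le_trans t2).
(* A time integral only needs cadlag paths and measurability in omega, so the indicator of the whole
   interval is allowed here; the moment bound at time [t] passes to the indicator up to [t]. *)
pose U t x := \1_(Dsig n j) x * (sigma n t x ^+ 2 - sigma n (tl n j) x ^+ 2).
have mD : measurable_fun setT (\1_(Dsig n j) : Omega -> R).
  by apply: measurable_indic; exact: measurable_Dsig.
have ms t : 0 <= t <= T -> measurable_fun setT (sigma n t) by exact: measurable_sigma.
have mU t : tl n j <= t <= tr n j -> measurable_fun setT (U t).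
  move=> tt; apply: measurable_funM => //.
  by apply: measurable_funB; apply: measurable_funX; apply: ms => //; exact: sub.
have cU x : cadlag T (U ^~ x).
  apply: cadlagM; first exact: cadlag_cst.
  by apply: cadlagB; [exact: cadlag_sigma2|exact: cadlag_cst].
have -> : qerr n j = (fun x => \int[mu]_(t in `]tl n j, tr n j]) U t x).
  apply/funext => x; rewrite /U.
  have [i2 _] := cadlag_integral_cvg (cadlag_sigma2 x n0) h1 (ltW ab) h2.
  have [ic _] := cadlag_integral_cvg (cadlag_cst T (sigma n (tl n j) x ^+ 2)) h1 (ltW ab) h2.
  have [iB _] := cadlag_integral_cvg (cadlagB (cadlag_sigma2 x n0)
    (cadlag_cst T (sigma n (tl n j) x ^+ 2))) h1 (ltW ab) h2.
  rewrite RintegralZl// RintegralB// Rintegral_cst//= lebesgue_measure_itv/= lte_fin ab.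
  by rewrite -EFinB/= hstep [X in _ - X]mulrC.
have := @time_integral_moment _ _ _ P T (tl n j) (tr n j) U h1 (ltW ab) h2 cU mU m
  (B * (T / n%:R) ^+ m).
have -> : (tr n j - tl n j) ^+ m.*2 * (B * (T / n%:R) ^+ m) =
    T ^+ (m.*2 + m) * B * n%:R `^ (- (3 / 2)) ^+ m.*2.
  rewrite hstep mulrCA -exprD exprMn mulrA [T ^+ _ * B]mulrC -npowN1 !npow_exp.
  congr (_ * _ `^ _); rewrite natrD -addnn natrD; lra.
apply=> t tt; have tT := sub _ tt; have /andP[at_ tb] := tt.
pose e x := \1_[set x | nojump (sigma n ^~ x) (tl n j) t] x * (sigma n t x - sigma n (tl n j) x).
have me : measurable_fun setT e.
  apply: measurable_funM; last by apply: measurable_funB; exact: ms.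
  apply: measurable_indic; apply: (filtration_sub hF tT).
  by apply: (nojump_wrt hF (hsigma n0)) => //; case/andP: tT.
apply: (@le_trans _ _ (moment P m.*2 (fun x => e x * (sigma n t x + sigma n (tl n j) x)))).
  apply: moment_le => x; rewrite /U subr_sqr indicE.
  case: (boolP (x \in _)) => [|_]; last by rewrite mul0r normr0.
  rewrite inE /Dsig/= => nj; rewrite mul1r /e indicE mem_set ?mul1r//= => r r1 r2.
  by apply: nj => //; exact: le_trans tb.
have := @moment_mul _ _ _ P m.*2 e (fun x => sigma n t x + sigma n (tl n j) x)
  (Num.sqrt (T / n%:R)) 1 D (2 ^+ m.*2.*2 * (C + C)).
have -> : (Num.sqrt (T / n%:R) * 1) ^+ m.*2 = (T / n%:R) ^+ m.
  by rewrite mulr1 -mul2n exprM sqr_sqrtr// ltW.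
apply => //.
- by apply: measurable_funD; exact: ms.
- by rewrite sqrtr_gt0.
- apply: (le_trans (hD n (tl n j) t n0 h1 at_ _)); first by case/andP: tT.
  rewrite lee_fin ler_wpM2l// -[in leRHS]mul2n exprM sqr_sqrtr ?(ltW h0)//.
  by rewrite lerXn2r ?nnegrE ?subr_ge0// ?(ltW h0)// -hstep lerB.
- by rewrite expr1n mulr1; apply: moment_add; [exact: ms|exact: ms|exact: hC|exact: hC].
Qed.

Variable M : nat -> R -> Omega -> R.
Hypothesis hM : forall n, (0 < n)%N -> ito_integral P T F w (sigma n) (M n).

Definition ito_err n j x := \1_(Dsig n j) x *
  (M n (tr n j) x - M n (tl n j) x - sigma n (tl n j) x * (w (tr n j) x - w (tl n j) x)).

Lemma measurable_w t : 0 <= t <= T -> measurable_fun setT (w t).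
Proof.
move=> tT; apply: measurable_wrtW (filtration_sub hF tT) _.
by have [+ _ _ _ _] := hw; apply.
Qed.

(** One factor h^(1/2) comes from the Wiener increments, another from the variation of sigma over
    the interval. *)
Lemma mom_ito_err : mom_bound P ito_err (-1).
Proof.
apply: mom_boundS => [n j jn|k].
  have [mM _ _] := hM (ord_gt0 jn); have [aT bT] := (tl_itv jn, tr_itv jn).
  apply: measurable_funM; first by apply: measurable_indic; exact: measurable_Dsig.
  apply: measurable_funB; first by apply: measurable_funB; exact: mM.
  apply: measurable_funM; first by apply: measurable_sigma => //; exact: ord_gt0 jn.
  by apply: measurable_funB; exact: measurable_w.
have [C C0 hC] := ito_increment_moment P hT hF k.
have [D D0 hD] := moment_sigma_diff k.+1.
exists (T ^+ k.+1.*2 * (C * D)); apply: nearW => n j jn.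
have n0 := ord_gt0 jn; have ab := tl_lt_tr jn.
have hstep : tr n j - tl n j = T / n%:R by rewrite grid_step//; case/andP: jn.
case: j jn ab hstep => // j jn ab hstep; have /= jn' := jn.
have h0 : 0 < T / n%:R by rewrite divr_gt0// ltr0n.
have [/andP[h1 _] /andP[_ h2]] := (tl_itv jn, tr_itv jn).
have := hC w (sigma n) (M n) n j (D * (T / n%:R) ^+ k.+1) hw (hsigma n0) (hM n0) (hsigmafin n0) jn'.
rewrite -!gridE /= hstep.
have -> : C * (T / n%:R) ^+ k.+1 * (D * (T / n%:R) ^+ k.+1) =
    T ^+ k.+1.*2 * (C * D) * (n%:R `^ (-1)) ^+ k.+1.*2.
  by rewrite npowN1 mulrACA -exprD addnn exprMn; ring.
apply => s /andP[as_ sb].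
apply: (le_trans (hD n (grid T n j) s n0 h1 as_ (le_trans sb h2))).
rewrite lee_fin ler_wpM2l// lerXn2r ?nnegrE ?subr_ge0// ?(ltW h0)//.
by rewrite -hstep lerB.
Qed.

Definition zeta n j x := (Num.sqrt (T / n%:R))^-1 * (w (tr n j) x - w (tl n j) x).

Lemma zeta_normal n j : (0 < j <= n)%N -> standard_normal P (zeta n j).
Proof.
move=> jn; have [/andP[h1 _] /andP[_ h2]] := (tl_itv jn, tr_itv jn).
have [_ _] := wiener_increment hF hw h1 (tl_lt_tr jn) h2.
by rewrite grid_step//; case/andP: jn.
Qed.

Lemma mom_zeta : mom_bound P zeta 0.
Proof.
split=> [n j jn|k]; first by have [] := zeta_normal jn.
have [C C0 hC] := @standard_normal_moment R _ Omega P k.*2; exists C.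
by apply: nearW => n j jn; rewrite powRr0 expr1n mulr1; apply: hC; exact: zeta_normal.
Qed.

Variable b : R -> Omega -> R.
Hypothesis hb : cadlag_adapted T F b.
Hypothesis h1ii : forall p : R, 1 < p -> exists C : R,
  forall t, 0 <= t <= T -> ('N[P]_(p%:E)[EFin \o b t] <= C%:E)%E.

Definition drift n j x := \int[mu]_(t in `]tl n j, tr n j]) b t x.

Lemma mom_drift : mom_bound P drift (-1).
Proof.
apply: (mom_time_integral (U := fun=> b)).
- by move=> n x _; exact: hb.2.
- by move=> n t _ tT; exact: (adapted_measurable hF hb).
- case=> [|k]; first by exists 1 => // n t _ _; rewrite moment0.
  have [|C hC] := @h1ii (k.+1.*2)%:R; first by rewrite ltr1n doubleS.
  exists (`|C| ^+ k.+1.*2) => [|n t n0 tT]; first exact: exprn_ge0.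
  by apply: moment_Lnorm; [rewrite doubleS|exact: hC].
Qed.

End Model.

(** * Weighted sums of centred functions of the normalized Wiener increments *)

Section Fluctuations.
Context {R : realType} {d : measure_display} {Omega : measurableType d}.
Variable P : probability Omega R.
Variables (T : R) (F : R -> set (set Omega)) (w : R -> Omega -> R).
Hypotheses (hT : 0 < T) (hF : filtration T F) (hw : wiener_process P T F w).

Lemma standard_normal_moment_sqr k : exists2 D : R, 0 <= D & forall Z : Omega -> R,
  standard_normal P Z -> (moment P k.*2 (fun x => 1 + Z x ^+ 2)%R <= D%:E)%E.
Proof.
have [C C0 hC] := @standard_normal_moment R _ Omega P k.*2.*2.
exists (2 ^+ k.*2 * (1 + (C + C))) => [|Z nZ].
  by rewrite mulr_ge0 ?exprn_ge0// addr_ge0// addr_ge0.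
have mZ := nZ.1.
apply: moment_add; [exact: measurable_cst|exact: measurable_funX| |].
  by rewrite /moment expect_cst normr1 expr1n.
have -> : (fun x => Z x ^+ 2) = (fun x => Z x * Z x) by apply/funext => x; rewrite expr2.
have := @moment_mul _ _ _ P k.*2 Z Z 1 1 C C.
by rewrite !(expr1n, mulr1); apply => //; exact: hC.
Qed.

(** [f] depends on n because the thresholds of the counts do; [e] is known at the left end of the
    interval, which makes the weighted sum a martingale transform. *)
Variables (f : nat -> R -> R) (m : nat -> R) (e : nat -> nat -> Omega -> R).
Hypotheses (mf : forall n, measurable_fun setT (f n)) (f0 : forall n z, 0 <= f n z).
Hypotheses (f1 : forall n z, f n z <= 1 + z ^+ 2).
Hypothesis Ef : forall n (Z : Omega -> R), standard_normal P Z ->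
  (\int[P]_x (f n (Z x))%:E = (m n)%:E)%E.
Hypothesis we : forall n j, (0 < j <= n)%N -> measurable_wrt (F (grid T n j.-1)) (e n j).
Hypothesis me : forall k, exists C : R, forall n j, (0 < j <= n)%N ->
  (moment P k.*2 (e n j) <= C%:E)%E.

Let xi n j x := f n (zeta T w n j x) - m n.

Let mfz n j : (0 < j <= n)%N -> measurable_fun setT (fun x => f n (zeta T w n j x)).
Proof. by move=> jn; apply: measurableT_comp => //; have [] := zeta_normal hT hF hw jn. Qed.

Let moment_xi k : exists2 D : R, 0 <= D & forall n j, (0 < j <= n)%N ->
  (moment P k.*2 (xi n j) <= D%:E)%E.
Proof.
have [D D0 hD] := standard_normal_moment_sqr k.
have [D1 D10 hD1] := standard_normal_moment_sqr 1.
exists (2 ^+ k.*2 * (D + (2 + D1) ^+ k.*2)) => [|n j jn].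
  by rewrite mulr_ge0 ?exprn_ge0// addr_ge0 ?exprn_ge0// addr_ge0.
have nz := zeta_normal hT hF hw jn.
have mz := nz.1.
apply: (@moment_add _ _ _ P _ _ (fun=> - m n)); [exact: mfz|exact: measurable_cst| |].
  apply: le_trans (hD _ nz); apply: moment_le => x.
  by rewrite !ger0_norm// ?f0// (le_trans (f0 n (zeta T w n j x))).
rewrite /moment expect_cst normrN lee_fin lerXn2r ?nnegrE ?addr_ge0//.
have m0 : 0 <= m n by rewrite -lee_fin -(Ef n nz); apply: integral_ge0 => x _; rewrite lee_fin.
rewrite ger0_norm// -lee_fin -(Ef n nz).
have := moment_lower (m := 1) _ _ (hD1 _ nz); rewrite /= => H.
apply: (@le_trans _ _ (moment P 1 (fun x => 1 + zeta T w n j x ^+ 2)%R)).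
  apply: le_lower_integral => x; first by rewrite lee_fin.
  by rewrite lee_fin expr1 ger0_norm// (le_trans (f0 n (zeta T w n j x))).
apply: (le_trans (H _ _)) => //; first by apply: measurable_funD => //; exact: measurable_funX.
by rewrite lee_fin lerD2r ler1n.
Qed.

Let xi_mean n j : (0 < j <= n)%N -> (\int[P]_x (xi n j x)%:E = 0)%E.
Proof.
move=> jn; have nz := zeta_normal hT hF hw jn.
have if_ : P.-integrable setT (EFin \o (fun x => f n (zeta T w n j x))).
  apply/integrableP; split; first by apply/measurable_EFinP; exact: mfz.
  under eq_integral do rewrite /= ger0_norm//.
  by rewrite Ef// ltry.
have im : P.-integrable setT (EFin \o (fun=> m n)) by exact: finite_measure_integrable_cst.
by rewrite /xi integralB_EFin//= Ef// expect_cst subee.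
Qed.

(** [transform_moment] with N = n and [delta] equal to 1: n centred terms of unit size add up to
    order n^(1/2). *)
Lemma mom_fluct : mom_bound P
  (fun n _ x => \sum_(1 <= j < n.+1) e n j x * (f n (zeta T w n j x) - m n)) (2^-1).
Proof.
have E n : (fun x => \sum_(1 <= j < n.+1) e n j x * (f n (zeta T w n j x) - m n)) =
    (fun x => \sum_(i < n) e n i.+1 x * xi n i.+1 x).
  by apply/funext => x; rewrite big_add1 big_mkord.
have gi n i : (i < n)%N -> (0 < i.+1 <= n)%N by [].
have gT n i : (i <= n)%N -> 0 <= grid T n i <= T by move=> i_n; exact: grid_itv.
apply: mom_boundS => [n _ _|k].
  rewrite E; apply: measurable_sum => i; have ji := gi n i (ltn_ord i).
  apply: measurable_funM; last by apply: measurable_funB; [exact: mfz|exact: measurable_cst].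
  by apply: measurable_wrtW (we ji); apply: (filtration_sub hF); exact: (tl_itv hT).
have [K K0 taylor] := @taylor_even R k.
have [B hB] := me k.+1.
have [D1 D10 hD1] := moment_xi 1; have [D2 D20 hD2] := moment_xi k.+1.
pose m0 := D1 + D2; have m00 : 0 <= m0 by exact: addr_ge0.
exists (2 * K * m0 * expR (K * m0) * B); exists 1%N => // n /= n0 _ _; rewrite E.
have := @transform_moment _ _ _ P n (fun i => F (grid T n i)) (fun i => e n i.+1)
  (fun i => xi n i.+1) _ _ _ _ _ _ _ k m0 1 B K n0 ltr01 m00 K0 taylor _ _ _.
have -> : 2 * K * m0 * expR (K * m0) * B * n%:R `^ 2^-1 ^+ k.+1.*2 =
    2 * K * m0 * expR (K * m0) * (n%:R * 1) ^+ k.+1 * B :> R.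
  rewrite mulr1 powR12_sqrt// -mul2n [in LHS]exprM sqr_sqrtr//; ring.
apply.
- by move=> i i_n; apply: (filtration_sigma hF); exact: gT.
- by move=> i i_n; apply: (filtration_sub hF); exact: gT.
- move=> i i_n; have /andP[h1 _] := gT n i (ltnW i_n); have /andP[_ h2] := gT n i.+1 i_n.
  by apply: hF.2 => //; exact: grid_le.
- by move=> i i_n; exact: (we (gi _ _ i_n)).
- move=> i i_n; have [/andP[h1 _] /andP[_ h2]] := (tl_itv hT (gi _ _ i_n), tr_itv hT (gi _ _ i_n)).
  have [h _ _] := wiener_increment hF hw h1 (tl_lt_tr hT (gi _ _ i_n)) h2.
  apply: (measurable_wrt_comp (f := fun z => f n ((Num.sqrt (T / n%:R))^-1 * z) - m n) _ h).
  apply: measurable_funB; last exact: measurable_cst.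
  apply: (measurableT_comp (mf n)).
  by apply: measurable_funM => //; exact: measurable_cst.
- move=> i i_n; have [/andP[h1 _] /andP[_ h2]] := (tl_itv hT (gi _ _ i_n), tr_itv hT (gi _ _ i_n)).
  have [_ h _] := wiener_increment hF hw h1 (tl_lt_tr hT (gi _ _ i_n)) h2.
  apply: (indep_of_comp (f := fun z => f n ((Num.sqrt (T / n%:R))^-1 * z) - m n) _ h).
  apply: measurable_funB; last exact: measurable_cst.
  apply: (measurableT_comp (mf n)).
  by apply: measurable_funM => //; exact: measurable_cst.
- by move=> i i_n; exact: xi_mean.
- by move=> i i_n; exact: hB.
- move=> i i_n; apply: (le_trans (hD1 n i.+1 (gi _ _ i_n))).
  by rewrite lee_fin mulr1 lerDl.
- move=> i i_n; apply: (le_trans (hD2 n i.+1 (gi _ _ i_n))).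
  by rewrite lee_fin expr1n mulr1 lerDr.
Qed.

End Fluctuations.

Section Inverses.
Context {R : realType} {d : measure_display} {Omega : measurableType d}.
Variable P : probability Omega R.

Lemma mom_inv (Y : nat -> nat -> Omega -> R) :
  (forall n j, (0 < j <= n)%N -> measurable_fun setT (Y n j)) ->
  (forall p : R, 1 < p -> exists C : R, forall n j, (0 < j <= n)%N ->
    ('N[P]_(p%:E)[EFin \o (fun x => (Y n j x)^-1)%R] <= C%:E)%E) ->
  mom_bound P (fun n j x => `|Y n j x|^-1) 0.
Proof.
move=> mY bY; apply: mom_bound_of_norm => [n j jn|p p1].
  rewrite (_ : (fun x => _) = (fun x => `|Y n j x| `^ (-1))); last first.
    by apply/funext => x; rewrite powR_inv1.
  apply: (@measurableT_comp _ _ _ _ _ _ (@powR R ^~ (-1))); first exact: measurable_powR.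
  by apply: measurableT_comp; [exact: normr_measurable|exact: mY].
have [C hC] := bY p p1; exists C; apply: nearW => n j jn; exists (fun x => (Y n j x)^-1).
rewrite powRr0 mulr1; split; first exact: hC.
by apply: aeW => x; rewrite !normfV normr_id.
Qed.

End Inverses.

(** * Intervals and windows free of jumps *)

Section QuietIntervals.
Context {R : realType} {d : measure_display} {Omega : measurableType d}.
Variable P : probability Omega R.
Variables (T : R) (F : R -> set (set Omega)).
Hypotheses (hT : 0 < T) (hF : filtration T F).
Variables (sigma J : nat -> R -> Omega -> R).
Hypothesis hsigma : forall n, (0 < n)%N -> cadlag_adapted T F (sigma n).
Hypothesis hsigmafin : forall n, (0 < n)%N -> {ae P, forall omega,
  (jump_number (sigma n ^~ omega) `]0%R, T] < +oo)%E}.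
Hypothesis hJ : forall n, (0 < n)%N -> cadlag_adapted T F (J n).
Hypothesis hJfin : forall n, (0 < n)%N -> {ae P, forall omega,
  (jump_number (J n ^~ omega) `]0%R, T] < +oo)%E}.
Variable kappa : nat -> nat.
Hypothesis hkappa : forall n, (0 < n)%N -> ((kappa n).*2 + 1 <= n)%N.

Definition quiet n a b : set Omega :=
  [set x | nojump (J n ^~ x) a b] `&` [set x | nojump (sigma n ^~ x) a b].

Lemma measurable_quiet n a b : (0 < n)%N -> 0 <= a -> a <= b -> b <= T ->
  measurable (quiet n a b).
Proof.
move=> n0 a0 ab bT; have bT' : 0 <= b <= T by rewrite (le_trans a0).
by apply: measurableI; apply: (filtration_sub hF bT'); apply: (nojump_wrt hF) => //;
  [exact: hJ|exact: hsigma].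
Qed.

Definition Dset n j := quiet n (grid T n j.-1) (grid T n j).

Definition wlo n j := grid T n (jlow n (kappa n) j).-1.
Definition whi n j := grid T n (jlow n (kappa n) j + (kappa n).*2).
Definition Wset n j := quiet n (wlo n j) (whi n j).

(** Near the ends of [0, T] the window is shifted and not shortened; it still contains cell j, and
    [hkappa] makes it fit. *)
Lemma jlow_bounds n j : (0 < j <= n)%N ->
  [/\ (0 < jlow n (kappa n) j)%N, (jlow n (kappa n) j <= j)%N,
   (j <= jlow n (kappa n) j + (kappa n).*2)%N & (jlow n (kappa n) j + (kappa n).*2 <= n)%N].
Proof.
move=> jn; have := hkappa (ord_gt0 jn); rewrite /jlow -addnn; move: (kappa n) jn => k jn kn.
by case: ifP => h1; [|case: ifP => h2]; split; lia.
Qed.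

Lemma window_itv n j : (0 < j <= n)%N -> [/\ 0 <= wlo n j, wlo n j <= grid T n j.-1,
  grid T n j <= whi n j & whi n j <= T].
Proof.
move=> jn; have [h1 h2 h3 h4] := jlow_bounds jn; rewrite /wlo /whi; split.
- by have /andP[] := @grid_itv R T hT n (jlow n (kappa n) j).-1 (ltac:(lia)).
- by apply: (grid_le hT); lia.
- exact: (grid_le hT).
- by have /andP[] := grid_itv hT h4.
Qed.

Lemma Wset_Dset n j : (0 < j <= n)%N -> Wset n j `<=` Dset n j.
Proof.
move=> jn x [nJ ns]; have [h1 h2 h3 h4] := window_itv jn.
split=> r ar rb; [apply: nJ|apply: ns]; by [exact: le_lt_trans ar|exact: le_trans h3].
Qed.

Lemma measurable_Dset n j : (0 < j <= n)%N -> measurable (Dset n j).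
Proof.
move=> jn; have [/andP[h1 _] /andP[_ h2]] := (tl_itv hT jn, tr_itv hT jn).
by apply: measurable_quiet => //; [exact: ord_gt0 jn|apply: ltW; exact: tl_lt_tr].
Qed.

Lemma measurable_Wset n j : (0 < j <= n)%N -> measurable (Wset n j).
Proof.
move=> jn; have [h1 h2 h3 h4] := window_itv jn.
apply: measurable_quiet => //; first exact: ord_gt0 jn.
by rewrite (le_trans h2)// (le_trans _ h3)// ltW// tl_lt_tr.
Qed.

Lemma in_frakL_Dset n : (0 < n)%N -> {ae P, forall x, forall j, (0 < j <= n)%N ->
  in_frakL T n (J n ^~ x) (sigma n ^~ x) j = (x \notin Dset n j)}.
Proof.
move=> n0; apply: filterS2 (hJfin n0) (hsigmafin n0) => x fJ fs j jn.
have [/andP[h1 _] /andP[_ h2]] := (tl_itv hT jn, tr_itv hT jn).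
rewrite in_frakLE//; last exact: ltW.
congr (~~ _); apply/eqP/idP; rewrite inE.
  by move/(Nbar_on_eq0 _ fs h1 h2).
by move=> H; apply/(Nbar_on_eq0 _ fs h1 h2).
Qed.

Lemma in_calL_Wset n : (0 < n)%N -> {ae P, forall x, forall j, (0 < j <= n)%N ->
  in_calL T n (kappa n) (J n ^~ x) (sigma n ^~ x) j = (x \notin Wset n j)}.
Proof.
move=> n0; apply: filterS2 (hJfin n0) (hsigmafin n0) => x fJ fs j jn.
have [h1 h2 h3 h4] := window_itv jn.
rewrite /in_calL; congr (~~ _); apply/eqP/idP; rewrite inE.
  by move/(Nbar_on_eq0 _ fs h1 h4).
by move=> H; apply/(Nbar_on_eq0 _ fs h1 h4).
Qed.

(** A measurable substitute for [card_frakL], almost surely equal to it. *)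
Definition cardD n x : R := \sum_(1 <= j < n.+1) \1_(~` Dset n j) x.

Lemma mom_cardD (xi : R) : (forall p : R, 1 < p ->
    is_bigO (fun n => 'N[P]_(p%:E)[EFin \o (fun omega =>
      (card_frakL T n (J n ^~ omega) (sigma n ^~ omega))%:R)%R]%E)
    (fun n => n%:R `^ xi)) ->
  mom_bound P (fun n _ x => cardD n x) xi.
Proof.
move=> h3; apply: mom_bound_of_norm => [n _ _|p p1].
  rewrite /cardD; under eq_fun do rewrite big_add1 big_mkord.
  apply: measurable_sum => i; apply: measurable_indic; apply: measurableC.
  by apply: measurable_Dset; rewrite ltn_ord.
have [C hC] := h3 p p1; exists C; near=> n => j jn.
exists (fun x => (card_frakL T n (J n ^~ x) (sigma n ^~ x))%:R); split; first by near: n.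
apply: filterS (in_frakL_Dset (ord_gt0 jn)) => x hx.
rewrite le_eqVlt; apply/orP; left; apply/eqP; congr (`|_|).
rewrite /cardD /card_frakL big_nat [X in X%:R]big_mkcond [X in X%:R]big_nat natr_sum.
apply: eq_bigr => i /andP[i0 i_n]; rewrite hx ?i0// indicE in_setC.
by case: (_ \in _).
Unshelve. all: by end_near. Qed.

Variables (c gamma0 : R) (S : nat -> nat -> Omega -> R).
Hypothesis hS : forall n j, (j < n)%N -> measurable_fun setT (S n j).
Hypothesis h2ii : forall p : R, 1 < p -> exists C : R,
     forall n j, (0 < j <= n)%N ->
       ((n%:R `^ gamma0)%:E *
        'N[P]_(p%:E)[EFin \o (fun omega =>
           (~~ in_calL T n (kappa n) (J n ^~ omega) (sigma n ^~ omega) j)%:R *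
           (sigma n (grid T n j.-1) omega ^+ 2 - c * S n j.-1 omega))%R]
        <= C%:E)%E.

(** The measurable indicator of [Wset] replaces that of the complement of calL_n, with which it
    agrees almost surely. *)
Definition Serr n j x :=
  \1_(Wset n j) x * (sigma n (grid T n j.-1) x ^+ 2 - c * S n j.-1 x).

Lemma mom_Serr : mom_bound P Serr (- gamma0).
Proof.
apply: mom_bound_of_norm => [n j jn|p p1].
  apply: measurable_funM; first by apply: measurable_indic; exact: measurable_Wset.
  apply: measurable_funB.
    apply: measurable_funX; apply: (measurable_sigma hF hsigma) (ord_gt0 jn) _.
    exact: tl_itv.
  apply: measurable_funM; first exact: measurable_cst.
  by apply: hS; case/andP: jn => j0; rewrite -ltnS prednK.
have [C hC] := h2ii p1; exists C; apply: nearW => n j jn.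
have n0 := ord_gt0 jn; have g0 := npow_gt0 gamma0 n0.
eexists; split.
  rewrite powRN mulrC EFinM lee_pdivlMl//.
  exact: hC jn.
apply: filterS (in_calL_Wset n0) => x hx.
by rewrite hx// negbK /Serr indicE.
Qed.

End QuietIntervals.

(** * The estimate along a path *)

Section Counting.
Context {R : realType}.
Implicit Types (n s : nat) (P Q N : pred nat) (u z : nat -> R).

Definition cnt n P : R := \sum_(1 <= j < n.+1) (P j)%:R.

Lemma cnt_le n P Q N : (forall j, (0 < j <= n)%N -> P j -> Q j || N j) ->
  cnt n P <= cnt n Q + cnt n N.
Proof.
move=> H; rewrite /cnt -big_split/= !big_nat; apply: ler_sum => j jn.
have := H j jn; case: (P j); case: (Q j); case: (N j) => //= h;
  by rewrite ?addr0 ?add0r ?lerDl ?addr_ge0//; have := h isT.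
Qed.

(** After sorting, the entries strictly below [v] lie among the first s - 1, and the first s entries
    are at most [v]; both facts survive ties. *)
Lemma order_stat_count (l : seq R) s : (0 < s <= size l)%N ->
  let v := nth 0 (sort <=%R l) s.-1 in
  (count (fun t : R => t < v)%R l < s)%N /\ (s <= count (fun t : R => t <= v)%R l)%N.
Proof.
move=> /andP[s0 sl] v; set l' := sort <=%R l.
have pl : perm_eq l l' by rewrite perm_sym perm_sort.
have sl' : size l' = size l by rewrite size_sort.
have so : sorted <=%R l' by apply: sort_sorted; exact: le_total.
have nle i j : (i <= j)%N -> (j < size l')%N -> nth 0 l' i <= nth 0 l' j.
  move=> ij jl; apply: (sorted_leq_nth le_trans lexx 0 so) => //.
  by rewrite inE (leq_ltn_trans ij).
rewrite !(permP pl); split.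
  rewrite -(cat_take_drop s.-1 l') count_cat.
  have -> : count (fun t : R => t < v) (drop s.-1 l') = 0%N.
    apply/eqP; rewrite -leqn0 leqNgt -has_count; apply/hasPn => u /(nthP 0)[i + <-].
    rewrite size_drop nth_drop => il; rewrite -leNgt; apply: nle; first exact: leq_addr.
    by move: il; rewrite ltn_subRL.
  rewrite addn0; apply: leq_ltn_trans (count_size _ _) _.
  by rewrite size_take sl'; case: ifP; lia.
rewrite -(cat_take_drop s l') count_cat; apply: leq_trans (leq_addr _ _).
rewrite -[X in (X <= _)%N](_ : size (take s l') = s); last by rewrite size_takel// sl'.
suff : all (fun t : R => t <= v) (take s l') by rewrite all_count => /eqP ->.
apply/allP => u /(nthP 0)[i + <-].
rewrite size_takel ?sl'// => is_; rewrite nth_take//; apply: nle; lia.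
Qed.

Lemma cnt_count n (p : pred R) u : cnt n (fun j => p (u j)) =
  (count p [seq u j | j <- iota 1 n])%:R.
Proof.
rewrite /cnt count_map -sum1_count natr_sum [RHS]big_mkcond /index_iota subn1 /=.
by apply: eq_bigr => j _ /=; case: (p _).
Qed.

Lemma ordV_count (T : R) n s (S : nat -> R) (x : R -> R) : (0 < s <= n)%N ->
  let v := ordV T n S x s in
  cnt n (fun j => Vstat T n S x j < v) <= s%:R - 1 /\
  s%:R <= cnt n (fun j => Vstat T n S x j <= v).
Proof.
move=> sn v.
have := @order_stat_count [seq Vstat T n S x j | j <- iota 1 n] s.
rewrite size_map size_iota => /(_ sn).
have -> : nth 0 (sort <=%R [seq Vstat T n S x j | j <- iota 1 n]) s.-1 = v.
  by rewrite /v /ordV /sorted_V; case: (s) sn.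
move=> /= [h1 h2].
rewrite (cnt_count n (fun t => t < v)) (cnt_count n (fun t => t <= v)) ler_nat; split=> //.
by rewrite lerBrDr natr1 ler_nat.
Qed.

End Counting.

(** * Location of the order statistic *)

Section Quantile.
Context {R : realType}.
(** In the application [u] and [us] are V_j and its order statistic, both divided by (c h)^(1/2);
    [rho] bounds the fluctuations of the empirical counts and [B] the number of windows with
    jumps. *)
Variables (n : nat) (u z : nat -> R) (W : pred nat) (us a al delta rho B c0 CL : R) (p : R -> R).
Hypotheses (a0 : 0 < a) (d0 : 0 < delta) (da : 4 * delta <= a) (d1 : 3 * delta <= 1).
Hypothesis hW : forall j, (0 < j <= n)%N -> W j -> `|u j - `|z j| | <= delta.
Hypotheses (hlt : cnt n (fun j => u j < us) <= n%:R * (1 - al))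
  (hle : n%:R * (1 - al) - 1 <= cnt n (fun j => u j <= us)).
(** The first two thresholds locate [us] within 2 delta of [a], the last two enclose the
    disagreements. The lower one needs 4 delta because u < us must be strict, while 3 delta suffices
    above, where us <= u is wanted. *)
Hypothesis hz : forall r, r \in [:: a + delta; a - delta; a + 3 * delta; a - 4 * delta] ->
  `|cnt n (fun j => `|z j| <= r) - n%:R * p r| <= rho.
Hypothesis hB : cnt n (fun j => ~~ W j) <= B.
Hypotheses (pa : p a = 1 - al)
  (plip : forall r s, 0 <= r -> r <= s -> p s - p r <= CL * (s - r))
  (plow : forall r s, 0 <= r -> r <= s -> s <= a + 1 -> c0 * (s - r) <= p s - p r).
Hypothesis big : rho + B + 1 < n%:R * (c0 * delta).

(** Otherwise every quiet index with |z| <= a + delta has u < us; by [plow] there are more of these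
    than n (1 - al), the surplus n c0 delta exceeding [rho] and [B]. *)
Lemma quantile_upper : us <= a + 2 * delta.
Proof.
move: a0 d0 da d1 hlt hle hB big => a0' d0' da' d1' hlt' hle' hB' big'.
rewrite leNgt; apply/negP => H.
have h1 : cnt n (fun j => `|z j| <= a + delta) <=
    cnt n (fun j => u j < us) + cnt n (fun j => ~~ W j) :> R.
  apply: cnt_le => j jn zj; case: (boolP (W j)) => [Wj|]; last by rewrite orbT.
  by have := hW jn Wj; rewrite ler_norml orbF => /andP[_]; lra.
have := hz (r := a + delta); rewrite !inE eqxx => /(_ isT); rewrite ler_norml => /andP[h2 _].
have h4 : c0 * (a + delta - a) <= p (a + delta) - (1 - al) by rewrite -pa; apply: plow; lra.
have n0 : 0 <= n%:R :> R by [].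
have h5 : n%:R * (c0 * delta) <= n%:R * (p (a + delta) - (1 - al)).
  by apply: ler_wpM2l => //; rewrite (le_trans _ h4)// addrAC subrr add0r.
move: hlt hB big h1 h2 h5; rewrite mulrBr; lra.
Qed.

(** Mirror image of the upper bound; the 1 in [big] pays for the rounding of the rank in [hle]. *)
Lemma quantile_lower : a - 2 * delta <= us.
Proof.
move: a0 d0 da d1 hlt hle hB big => a0' d0' da' d1' hlt' hle' hB' big'.
rewrite leNgt; apply/negP => H.
have h1 : cnt n (fun j => u j <= us) <=
    cnt n (fun j => `|z j| <= a - delta) + cnt n (fun j => ~~ W j) :> R.
  apply: cnt_le => j jn uj; case: (boolP (W j)) => [Wj|]; last by rewrite orbT.
  by have := hW jn Wj; rewrite ler_norml orbF => /andP[+ _]; lra.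
have := hz (r := a - delta); rewrite !inE eqxx orbT => /(_ isT); rewrite ler_norml => /andP[_ h2].
have h4 : c0 * (a - (a - delta)) <= (1 - al) - p (a - delta) by rewrite -pa; apply: plow; lra.
have n0 : 0 <= n%:R :> R by [].
have h5 : n%:R * (c0 * delta) <= n%:R * ((1 - al) - p (a - delta)).
  by apply: ler_wpM2l => //; rewrite (le_trans _ h4)// opprB addrC subrK.
move: hle hB big h1 h2 h5; rewrite mulrBr; lra.
Qed.

(** At a quiet index a disagreement forces a - 4 delta < |z| <= a + 3 delta, a range of width 7
    delta; its count is compared with [p] at the cost of two fluctuations. *)
Lemma disagreement_count :
  cnt n (fun j => W j && ((u j < us) != (`|z j| <= a))) <= n%:R * (7 * CL * delta) + 2 * rho.
Proof.
move: a0 d0 da d1 hlt hle hB big => a0' d0' da' d1' hlt' hle' hB' big'.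
have hu := quantile_upper; have hl := quantile_lower.
have h1 : cnt n (fun j => W j && ((u j < us) != (`|z j| <= a)))
    + cnt n (fun j => `|z j| <= a - 4 * delta) <= cnt n (fun j => `|z j| <= a + 3 * delta) :> R.
  rewrite /cnt -big_split/= !big_nat; apply: ler_sum => j jn.
  have [zl|zl] := leP `|z j| (a - 4 * delta).
    have -> : (`|z j| <= a + 3 * delta) = true by apply/idP; lra.
    case: (boolP (W j)) => [Wj|_] /=; last by rewrite add0r.
    have := hW jn Wj; rewrite ler_norml => /andP[_ h].
    have -> : (u j < us) = true by apply/idP; lra.
    have -> : (`|z j| <= a) = true by apply/idP; lra.
    by rewrite eqxx add0r.
  rewrite addr0; case: (boolP (W j)) => [Wj|_] //=.
  have := hW jn Wj; rewrite ler_norml => /andP[h h'].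
  case: (leP `|z j| (a + 3 * delta)) => [_|zu].
    by case: (_ != _).
  have -> : (u j < us) = false by apply/negP => ?; lra.
  have -> : (`|z j| <= a) = false by apply/negP => ?; lra.
  by rewrite eqxx.
have := hz (r := a + 3 * delta); rewrite !inE eqxx !orbT => /(_ isT).
rewrite ler_norml => /andP[_ h2].
have := hz (r := a - 4 * delta); rewrite !inE eqxx !orbT => /(_ isT).
rewrite ler_norml => /andP[h3 _].
have h4 : p (a + 3 * delta) - p (a - 4 * delta) <= CL * (a + 3 * delta - (a - 4 * delta)).
  by apply: plip; lra.
have n0 : 0 <= n%:R :> R by [].
have h5 : n%:R * (p (a + 3 * delta) - p (a - 4 * delta)) <= n%:R * (7 * CL * delta).
  apply: ler_wpM2l => //; apply: (le_trans h4); lra.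
move: h1 h2 h3 h5; rewrite mulrBr; lra.
Qed.

End Quantile.

(** * From truncated squared increments to quadratic variation *)

Section Truncation.
Context {R : realType}.
Variables (n : nat) (DX sg z qv : nat -> R) (D W inJ : pred nat).
Variables (H A a q k1 rho1 rho2 rho3 rho5 B1 B2 B3 : R).
Hypotheses (H0 : 0 <= H) (q0 : 0 < q) (r10 : 0 <= rho1) (r30 : 0 <= rho3) (r20 : 0 <= rho2).
Hypothesis hDX : forall j, (0 < j <= n)%N -> D j -> `|DX j - sg j * (H * z j)| <= rho1.
Hypothesis hsg : forall j, (0 < j <= n)%N -> `|sg j| <= A.
Hypothesis hz : forall j, (0 < j <= n)%N -> `|z j| <= A.
Hypothesis hq : forall j, (0 < j <= n)%N -> D j -> `|qv j - H ^+ 2 * sg j ^+ 2| <= rho2.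
Hypothesis hq3 : forall j, (0 < j <= n)%N -> `|qv j| <= rho3.
Hypothesis WD : forall j, (0 < j <= n)%N -> W j -> D j.
Hypothesis hk1 : A ^+ 2 * H + rho1 <= k1.
Hypothesis hB1 : cnt n (fun j => ~~ D j) <= B1.
Hypothesis hB2 : cnt n (fun j => ~~ W j) <= B2.
Hypothesis hB3 : cnt n (fun j => W j && (inJ j != (`|z j| <= a))) <= B3.
Hypothesis hfl : `|\sum_(1 <= j < n.+1) sg j ^+ 2 * (z j ^+ 2 * (`|z j| <= a)%R%:R - q)| <= rho5.

Let m1 := (A ^+ 2 * H + rho1) ^+ 2.

Let term j := DX j ^+ 2 * (`|DX j| <= k1)%R%:R * (inJ j)%:R.
(** The ideal version of [term]: the increment is replaced by its Wiener part, and the selection by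
    |z| <= a. *)
Let main j := H ^+ 2 * (sg j ^+ 2 * (z j ^+ 2 * (`|z j| <= a)%R%:R)).

(** Three kinds of indices: with a jump in the interval, the truncation bounds [term] by k1^2; with
    a bad window or a wrong selection, [term] and [main] are each at most [m1]; otherwise only the
    difference of two squares remains. By [hk1] the truncation is inactive on quiet intervals. *)
Lemma truncation_term j : (0 < j <= n)%N -> `|term j - main j| <=
  (~~ D j)%:R * (k1 ^+ 2 + m1) +
  ((~~ W j)%:R + (W j && (inJ j != (`|z j| <= a)))%:R) * (2 * m1) +
  rho1 * (rho1 + 2 * (A ^+ 2 * H)).
Proof.
move=> jn; pose e := sg j * (H * z j).
have A0 : 0 <= A := le_trans (normr_ge0 _) (hsg jn).
have G0 : 0 <= A ^+ 2 * H by rewrite mulr_ge0// exprn_ge0.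
have eG : `|e| <= A ^+ 2 * H.
  rewrite /e !normrM (ger0_norm H0) mulrCA mulrC expr2 ler_wpM2r//.
  by apply: ler_pM => //; [exact: hsg|exact: hz].
have m10 : 0 <= m1 by exact: sqr_ge0.
have k1m : m1 <= k1 ^+ 2 by rewrite lerXn2r ?nnegrE// ?(le_trans _ hk1)// addr_ge0.
have em : e ^+ 2 <= m1.
  rewrite -[e ^+ 2]real_normK ?num_real// lerXn2r ?nnegrE ?addr_ge0//.
  by rewrite (le_trans eG)// lerDl.
have mainE : main j = e ^+ 2 * (`|z j| <= a)%R%:R by rewrite /main /e; ring.
have R0 : 0 <= rho1 * (rho1 + 2 * (A ^+ 2 * H)) by rewrite mulr_ge0// addr_ge0// mulr_ge0.
rewrite mainE /term.
case: (boolP (D j)) => Dj /=; last first.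
  have -> : W j = false by apply/negP => /(WD jn); exact/negP.
  rewrite mul1r /= addr0 mul1r.
  have h1 : 0 <= DX j ^+ 2 * (`|DX j| <= k1)%R%:R * (inJ j)%:R <= k1 ^+ 2.
    case: (leP `|DX j| k1) => h; rewrite ?(mulr0, mul0r, mulr1); last by rewrite lexx sqr_ge0.
    have k10 : 0 <= k1 := le_trans (normr_ge0 _) h.
    case: (inJ j); rewrite ?(mulr1, mulr0) ?sqr_ge0 ?lexx//=.
    by rewrite -[DX j ^+ 2]real_normK ?num_real// lerXn2r ?nnegrE.
  have h2 : 0 <= e ^+ 2 * (`|z j| <= a)%R%:R <= m1.
    by case: (_ <= a); rewrite ?(mulr1, mulr0) ?sqr_ge0 ?lexx.
  by move: h1 h2 => /andP[? ?] /andP[? ?]; rewrite ler_norml; apply/andP; split; lra.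
have hd : `|DX j - e| <= rho1 by exact: hDX.
have DXG : `|DX j| <= A ^+ 2 * H + rho1.
  rewrite -[DX j](subrK e) addrC; apply: (le_trans (ler_normD _ _)).
  by rewrite addrC addrC lerD.
have DXm : DX j ^+ 2 <= m1.
  by rewrite -[DX j ^+ 2]real_normK ?num_real// lerXn2r ?nnegrE ?addr_ge0.
rewrite (le_trans DXG hk1) mulr1 mul0r add0r.
case: (boolP (W j && (inJ j != (`|z j| <= a)))) => [/andP[Wj dis]|agree] /=.
  rewrite Wj/= add0r mul1r.
  have := sqr_ge0 (DX j); have := sqr_ge0 e; move: dis.
  by case: (inJ j); case: (_ <= a) => //= _ ? ?; rewrite ?(mulr1, mulr0) ler_norml;
     apply/andP; split; lra.
rewrite addr0; case: (boolP (W j)) agree => [Wj|nW] /= agree; last first.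
  rewrite mul1r; have := sqr_ge0 (DX j); have := sqr_ge0 e.
  by case: (inJ j); case: (_ <= a) => //= ? ?; rewrite ?(mulr1, mulr0) ler_norml;
     apply/andP; split; lra.
rewrite mul0r add0r; move: agree; rewrite negbK => /eqP ->.
rewrite -mulrBl normrM; apply: (@le_trans _ _ `|DX j ^+ 2 - e ^+ 2|).
  by rewrite ler_piMr//; case: (_ <= a); rewrite ?normr1 ?normr0.
rewrite subr_sqr normrM; apply: ler_pM => //.
rewrite (_ : DX j + e = (DX j - e) + 2 * e); last by ring.
apply: (le_trans (ler_normD _ _)); apply: lerD => //.
by rewrite normrM ger0_norm// ler_wpM2l.
Qed.

Lemma truncation_bound :
  `|\sum_(1 <= j < n.+1 | inJ j) q^-1 * `|DX j| ^+ 2 * (`|DX j| <= k1)%R%:R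
     - \sum_(1 <= j < n.+1) qv j| <=
  q^-1 * (B1 * (k1 ^+ 2 + m1) + (B2 + B3) * (2 * m1) + n%:R * (rho1 * (rho1 + 2 * (A ^+ 2 * H)))
     + H ^+ 2 * rho5) + n%:R * rho2 + B1 * (H ^+ 2 * A ^+ 2 + rho3).
Proof.
have -> : \sum_(1 <= j < n.+1 | inJ j) q^-1 * `|DX j| ^+ 2 * (`|DX j| <= k1)%R%:R =
    q^-1 * \sum_(1 <= j < n.+1) term j.
  rewrite big_mkcond mulr_sumr; apply: eq_bigr => j _; rewrite /term real_normK ?num_real//.
  by case: (inJ j) => /=; ring.
have q1 : 0 <= q^-1 by rewrite invr_ge0 ltW.
(* Three errors are separated: individual terms, fluctuations of z^2 1_{|z| <= a} about its mean q,
   and the discretization of the quadratic variation. *)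
have sumE : q^-1 * (\sum_(1 <= j < n.+1) term j) - \sum_(1 <= j < n.+1) qv j =
    q^-1 * (\sum_(1 <= j < n.+1) (term j - main j)) +
    q^-1 * (H ^+ 2 * \sum_(1 <= j < n.+1) sg j ^+ 2 * (z j ^+ 2 * (`|z j| <= a)%R%:R - q)) -
    \sum_(1 <= j < n.+1) (qv j - H ^+ 2 * sg j ^+ 2).
  rewrite !mulr_sumr -big_split/= -!sumrB; apply: eq_bigr => j _; rewrite /main.
  by field; rewrite gt_eqF.
rewrite sumE.
have cntM (P : pred nat) (c : R) : \sum_(1 <= j < n.+1) (P j)%:R * c = cnt n P * c :> R by rewrite mulr_suml.
have sum_cst (c : R) : \sum_(1 <= j < n.+1) c = n%:R * c.
  by rewrite big_const_nat subn1 iter_addr_0 mulr_natl.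
have m10 : 0 <= m1 by exact: sqr_ge0.
have t1 : `|\sum_(1 <= j < n.+1) (term j - main j)| <=
    B1 * (k1 ^+ 2 + m1) + (B2 + B3) * (2 * m1) + n%:R * (rho1 * (rho1 + 2 * (A ^+ 2 * H))).
  apply: (le_trans (ler_norm_sum _ _ _)); rewrite big_nat.
  apply: (le_trans (ler_sum _ (fun j jn => truncation_term jn))); rewrite -big_nat.
  rewrite !big_split/= cntM sum_cst; under eq_bigr do rewrite mulrDl.
  rewrite big_split/= !cntM -mulrDl lerD2r.
  apply: lerD; apply: ler_wpM2r => //; first by rewrite addr_ge0 ?sqr_ge0.
    by rewrite mulr_ge0.
  exact: lerD.
have t3 : `|\sum_(1 <= j < n.+1) (qv j - H ^+ 2 * sg j ^+ 2)| <=
    n%:R * rho2 + B1 * (H ^+ 2 * A ^+ 2 + rho3).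
  apply: (le_trans (ler_norm_sum _ _ _)); rewrite big_nat.
  apply: (@le_trans _ _ (\sum_(1 <= j < n.+1 | (1 <= j < n.+1)%N)
     (rho2 + (~~ D j)%:R * (H ^+ 2 * A ^+ 2 + rho3)))).
    apply: ler_sum => j jn; case: (boolP (D j)) => Dj /=.
      by rewrite mul0r addr0; exact: hq.
    rewrite mul1r; apply: (le_trans (ler_normB _ _)).
    rewrite [leRHS]addrA [leRHS]addrC lerD ?hq3//.
    rewrite normrM !ger0_norm ?sqr_ge0// ler_wpDl// ler_wpM2l ?sqr_ge0//.
    have sA := hsg jn.
    by rewrite -[sg j ^+ 2]real_normK ?num_real// lerXn2r ?nnegrE// (le_trans (normr_ge0 _) sA).
  rewrite -big_nat big_split/= sum_cst cntM lerD2l; apply: ler_wpM2r => //.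
  by rewrite addr_ge0// mulr_ge0// sqr_ge0.
apply: (le_trans (ler_normB _ _)); rewrite -addrA; apply: lerD => //.
apply: (le_trans (ler_normD _ _)); rewrite mulrDr; apply: lerD.
  by rewrite normrM ger0_norm// ler_wpM2l.
rewrite normrM (ger0_norm q1) ler_wpM2l// normrM ger0_norm ?sqr_ge0//.
by rewrite ler_wpM2l ?sqr_ge0.
Qed.

End Truncation.

Section Windows.
Context {R : realType}.

Lemma sum_interval_le lo hi n : (\sum_(j < n) (lo <= j < hi : nat) <= hi - lo)%N.
Proof.
suff : (\sum_(j < n) (lo <= j < hi : nat) <= minn n hi - lo)%N by lia.
elim: n => [|n IH]; first by rewrite big_ord0.
rewrite big_ord_recr/=; apply: (leq_trans (leq_add IH (leqnn _))).
by case: (boolP (lo <= n < hi)%N) => /= h; lia.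
Qed.

(** Double counting: a cell with a jump spoils at most 4k + 1 windows. The distance is 2k and not k
    because a shifted window may have its own index at an end. *)
Lemma cnt_window n (k : nat) (D W : pred nat) :
  (forall j, (0 < j <= n)%N -> ~~ W j ->
     exists i, [/\ (0 < i <= n)%N, (j <= i + k.*2)%N, (i <= j + k.*2)%N & ~~ D i]) ->
  cnt n (fun j => ~~ W j) <= (4 * k%:R + 1) * cnt n (fun j => ~~ D j) :> R.
Proof.
move=> H.
have h1 : cnt n (fun j => ~~ W j) <= \sum_(1 <= j < n.+1) \sum_(1 <= i < n.+1)
    (~~ D i)%:R * (i - k.*2 <= j < (i + k.*2).+1)%N%:R :> R.
  rewrite /cnt big_nat [leRHS]big_nat; apply: ler_sum => j jn.
  case: (boolP (W j)) => Wj /=; first by apply: sumr_ge0 => i _; rewrite mulr_ge0.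
  have [i [i_n ji ij Di]] := H j jn Wj.
  rewrite (bigD1_seq i) ?mem_index_iota ?iota_uniq//= Di mul1r.
  have -> : (i - k.*2 <= j < (i + k.*2).+1)%N by lia.
  by rewrite lerDl; apply: sumr_ge0 => ? _; rewrite mulr_ge0.
apply: (le_trans h1); rewrite exchange_big/= mulrC /cnt mulr_suml.
apply: ler_sum => i _; rewrite -mulr_sumr ler_wpM2l//.
apply: (@le_trans _ _ (((i + k.*2).+1 - (i - k.*2))%N%:R)).
  rewrite -natr_sum ler_nat; apply: leq_trans (sum_interval_le _ _ n.+1).
  by rewrite -(big_mkord xpredT (fun j => (i - k.*2 <= j < (i + k.*2).+1)%N : nat))
    [leqRHS]big_ltn// leq_addl.
rewrite -natrM natr1 ler_nat; lia.
Qed.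

End Windows.

Section WindowJumps.
Context {R : realType} {d : measure_display} {Omega : measurableType d}.
Variables (T : R) (sigma J : nat -> R -> Omega -> R) (kappa : nat -> nat).
Hypotheses (hT : 0 < T) (hkappa : forall n, (0 < n)%N -> ((kappa n).*2 + 1 <= n)%N).

(** By contraposition: every time in the window lies in one of its cells, so quiet cells make a
    quiet window. *)
Lemma Wset_window n j x : (0 < j <= n)%N -> x \notin Wset T sigma J kappa n j ->
  exists i, [/\ (0 < i <= n)%N, (j <= i + (kappa n).*2)%N, (i <= j + (kappa n).*2)%N &
    x \notin Dset T sigma J n i].
Proof.
move=> jn; have [l0 lj jl ln] := jlow_bounds hT hkappa jn.
rewrite notin_setE; apply: contra_notP => H.
have D i : (jlow n (kappa n) j <= i <= jlow n (kappa n) j + (kappa n).*2)%N ->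
    Dset T sigma J n i x.
  move=> ij; apply: contrapT => nD; apply: H; exists i; split; [lia|lia|lia|].
  by rewrite notin_setE.
have loc r : wlo T kappa n j < r -> r <= whi T kappa n j -> exists i,
    [/\ (jlow n (kappa n) j <= i <= jlow n (kappa n) j + (kappa n).*2)%N,
     grid T n i.-1 < r & r <= grid T n i].
  move=> r1 r2; have ex : exists i, r <= grid T n i by exists (jlow n (kappa n) j + (kappa n).*2)%N.
  case: (ex_minnP ex) => i ri imin; exists i; split=> //.
    rewrite imin// andbT leqNgt; apply/negP => il.
    have : grid T n i <= wlo T kappa n j by apply: (grid_le hT); lia.
    by move=> h; have := le_lt_trans (le_trans ri h) r1; rewrite ltxx.
  rewrite ltNge; apply/negP => /imin.
  case: i ri imin => [r0|i ri _ /=]; last by rewrite ltnn.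
  move=> _ _; have := lt_le_trans r1 r0.
  rewrite ltNge => /negP; apply.
  by rewrite grid0; have /andP[] := @grid_itv R T hT n (jlow n (kappa n) j).-1 (ltac:(lia)).
by split=> r r1 r2; have [i [ij i1 i2]] := loc r r1 r2; have [h1 h2] := D i ij;
  [exact: h1|exact: h2].
Qed.

End WindowJumps.

Section Closeness.
Context {R : realType}.

(** The ratio t = |sg| / (c S)^(1/2) satisfies |t - 1| <= |t^2 - 1| since t >= 0, so the hypothesis
    on squares controls it; the rest is the error on DX divided by S^(1/2), with S^(-1/2) <= A
    because A >= 1. *)
Lemma close_one (DX sg z Sv c H A rho1 rho4 : R) : 0 < c -> 0 < H -> 0 < Sv -> 1 <= A ->
  Sv^-1 <= A -> `|z| <= A -> `|DX - sg * (H * z)| <= rho1 -> `|sg ^+ 2 - c * Sv| <= rho4 ->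
  `| `|(Num.sqrt Sv)^-1 * DX| / (Num.sqrt c * H) - `|z| |
    <= A * rho1 / (Num.sqrt c * H) + A ^+ 2 * rho4 / c.
Proof.
move=> c0 H0 S0 A1 SA zA hD hS.
have A0 : 0 <= A by apply: le_trans A1.
have r0 : 0 < Num.sqrt Sv by rewrite sqrtr_gt0.
have sc0 : 0 < Num.sqrt c by rewrite sqrtr_gt0.
set r := Num.sqrt Sv in r0 *; set s := Num.sqrt c in sc0 *.
have rA : r^-1 <= A.
  rewrite -ler_sqr ?nnegrE ?invr_ge0 ?(ltW r0)// exprVn sqr_sqrtr ?(ltW S0)//.
  by rewrite (le_trans SA)// expr2 ler_peMl.
have rho10 : 0 <= rho1 := le_trans (normr_ge0 _) hD.
pose t := `|sg| / (r * s).
have t0 : 0 <= t by rewrite divr_ge0// mulr_ge0// ltW.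
have tE : t ^+ 2 - 1 = (sg ^+ 2 - c * Sv) * (Sv^-1 / c).
  rewrite /t expr_div_n real_normK ?num_real// exprMn !sqr_sqrtr ?(ltW S0) ?(ltW c0)//.
  by field; rewrite !gt_eqF.
have tB : `|t - 1| <= A * rho4 / c.
  apply: (@le_trans _ _ `|t ^+ 2 - 1|).
    have -> : t ^+ 2 - 1 = (t - 1) * (t + 1) by ring.
    by rewrite normrM ler_peMr// ger0_norm ?addr_ge0// lerDr.
  rewrite tE normrM [A * _]mulrC -mulrA; apply: ler_pM => //.
  by rewrite ger0_norm ?divr_ge0 ?invr_ge0 ?(ltW S0) ?(ltW c0)// ler_pM2r ?invr_gt0.
have dB : `| `|DX| - `|sg| * (H * `|z|) | <= rho1.
  apply: le_trans hD; have := ler_dist_dist DX (sg * (H * z)).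
  by rewrite !normrM (gtr0_norm H0).
have -> : `|r^-1 * DX| / (s * H) - `|z| =
    r^-1 * (`|DX| - `|sg| * (H * `|z|)) / (s * H) + (t - 1) * `|z|.
  rewrite normrM ger0_norm ?invr_ge0 ?(ltW r0)// /t.
  by field; rewrite !gt_eqF.
apply: (le_trans (ler_normD _ _)); apply: lerD.
  rewrite normrM normfV [`|s * H|]gtr0_norm ?mulr_gt0// ler_pM2r ?invr_gt0 ?mulr_gt0//.
  by rewrite normrM; apply: ler_pM => //; rewrite ger0_norm ?invr_ge0 ?(ltW r0).
rewrite normrM normr_id; apply: (@le_trans _ _ (A * rho4 / c * A)); first exact: ler_pM.
by rewrite le_eqVlt; apply/orP; left; apply/eqP; ring.
Qed.

End Closeness.

(** * The deterministic estimate with explicit rates *)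

Section PathBound.
Context {R : realType}.
Variables (T al q c a c0 CL : R) (p : R -> R).
Hypotheses (hT : 0 < T) (q0 : 0 < q) (hc : 0 < c) (a0 : 0 < a) (c00 : 0 < c0).
Hypotheses (pa : p a = 1 - al)
  (plip : forall r s, 0 <= r -> r <= s -> p s - p r <= CL * (s - r))
  (plow : forall r s, 0 <= r -> r <= s -> s <= a + 1 -> c0 * (s - r) <= p s - p r).

(* With x = n^(-1/2), k1 = n^(-1/4), y = n^(xi - 1/2), g = n^(-gamma0), delta = n^(-beta) and
   A = n^eps, all the error rates are monomials in these quantities; the path estimate loses
   only a fixed power of A. *)
Variables (n : nat) (x k1 A delta y g : R) (DX sg z qv Sv : nat -> R) (D W : pred nat).
(** The square root of h = T / n, so that H z_j is the Wiener increment. *)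
Let H := Num.sqrt T * x.
Hypotheses (n0 : (0 < n)%N) (x0 : 0 < x) (xn : x ^+ 2 * n%:R = 1) (k10 : 0 < k1) (k1x : k1 ^+ 2 = x).
Hypotheses (Ak1 : A ^+ 4 * k1 <= 1) (xy : x <= y) (yd : y * A ^+ 5 <= delta) (gd : g * A ^+ 5 <= delta)
  (d0 : 0 < delta) (da : 4 * delta <= a) (d1 : 3 * delta <= 1) (g0 : 0 < g).
(** A tends to infinity with n and so dominates every fixed constant; below, each constant is traded
    for a factor A. *)
Hypotheses (A2 : 2 <= A) (AT : Num.sqrt T <= A) (Ac : 2 / c <= A) (AcT : 4 / (Num.sqrt c * Num.sqrt T) <= A)
  (Ac0 : 4 / c0 <= A) (Aq : q^-1 <= A) (ACL : 7 * CL <= A) (CL0 : 0 < CL).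
Hypothesis hDX : forall j, (0 < j <= n)%N -> D j -> `|DX j - sg j * (H * z j)| <= 2 * A * x ^+ 2.
Hypothesis hsg : forall j, (0 < j <= n)%N -> `|sg j| <= A.
Hypothesis hz : forall j, (0 < j <= n)%N -> `|z j| <= A.
Hypothesis hS : forall j, (0 < j <= n)%N -> 0 < Sv j /\ (Sv j)^-1 <= A.
Hypothesis hq : forall j, (0 < j <= n)%N -> D j -> `|qv j - H ^+ 2 * sg j ^+ 2| <= A * x ^+ 3.
Hypothesis hq3 : forall j, (0 < j <= n)%N -> `|qv j| <= A * x ^+ 2.
Hypothesis WD : forall j, (0 < j <= n)%N -> W j -> D j.
Hypothesis hWS : forall j, (0 < j <= n)%N -> W j -> `|sg j ^+ 2 - c * Sv j| <= A * g.
Hypothesis hB1 : cnt n (fun j => ~~ D j) <= A * y / x.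
Hypothesis hB2 : cnt n (fun j => ~~ W j) <= A ^+ 2 * y / x ^+ 2.
Hypothesis hfl : `|\sum_(1 <= j < n.+1) sg j ^+ 2 * (z j ^+ 2 * (`|z j| <= a)%R%:R - q)| <= A / x.
Hypothesis hcnt : forall r, r \in [:: a + delta; a - delta; a + 3 * delta; a - 4 * delta] ->
  `|cnt n (fun j => `|z j| <= r) - n%:R * p r| <= A / x.
Variables (V : nat -> R) (v : R).
Hypothesis hV : forall j, (0 < j <= n)%N -> V j = `|(Num.sqrt (Sv j))^-1 * DX j|.
Hypotheses (hlt : cnt n (fun j => V j < v) <= n%:R * (1 - al))
  (hle : n%:R * (1 - al) - 1 <= cnt n (fun j => V j <= v)).

Let A0 : 0 < A. Proof. by apply: lt_le_trans A2. Qed.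
Let A1 : 1 <= A. Proof. by apply: le_trans A2; rewrite ler1n. Qed.
Let H0 : 0 < H. Proof. by rewrite mulr_gt0// sqrtr_gt0. Qed.
Let y0 : 0 < y. Proof. exact: lt_le_trans xy. Qed.

Let powA i j : (i <= j)%N -> A ^+ i <= A ^+ j.
Proof. exact: ler_weXn2l. Qed.

Let yA i : (i <= 5)%N -> y * A ^+ i <= delta.
Proof. by move=> i5; apply: le_trans yd; rewrite ler_pM2l// powA. Qed.

Let xA i : (i <= 5)%N -> x * A ^+ i <= delta.
Proof. by move=> i5; apply: le_trans (yA i5); rewrite ler_pM2r ?exprn_gt0. Qed.

Let x1 : x <= 1.
Proof.
have := @xA 0 isT; rewrite expr0 mulr1 => h; apply: (le_trans h).
by move: d0 d1 => d0' d1'; lra.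
Qed.

Let sc0 : 0 < Num.sqrt c * H. Proof. by rewrite mulr_gt0// sqrtr_gt0. Qed.

Lemma path_close j : (0 < j <= n)%N -> W j -> `|V j / (Num.sqrt c * H) - `|z j| | <= delta.
Proof.
move=> jn Wj; have [S0 SA] := hS jn; rewrite hV//.
apply: le_trans (close_one hc H0 S0 A1 SA (hz jn) (hDX jn (WD jn Wj)) (hWS jn Wj)) _.
have s0 : 0 < Num.sqrt c * Num.sqrt T by rewrite mulr_gt0 ?sqrtr_gt0.
have h1 : A * (2 * A * x ^+ 2) / (Num.sqrt c * H) <= delta / 2.
  have -> : A * (2 * A * x ^+ 2) / (Num.sqrt c * H) =
      (4 / (Num.sqrt c * Num.sqrt T)) * (x * A ^+ 2) / 2.
    by rewrite /H; field; rewrite !gt_eqF ?sqrtr_gt0.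
  rewrite ler_pM2r// (le_trans _ (@xA 3 isT))//.
  apply: (@le_trans _ _ (A * (x * A ^+ 2))); first by rewrite ler_pM2r ?mulr_gt0 ?exprn_gt0.
  by rewrite le_eqVlt; apply/orP; left; apply/eqP; ring.
have h2 : A ^+ 2 * (A * g) / c <= delta / 2.
  have -> : A ^+ 2 * (A * g) / c = (2 / c) * (g * A ^+ 3) / 2 by field; rewrite gt_eqF.
  rewrite ler_pM2r// (le_trans _ gd)//.
  apply: (@le_trans _ _ (A * (g * A ^+ 3))); first by rewrite ler_pM2r ?mulr_gt0 ?exprn_gt0.
  rewrite (_ : A * _ = g * A ^+ 4); last by ring.
  by rewrite ler_pM2l// powA.
by rewrite (splitr delta) lerD.
Qed.

Let B2E : A ^+ 2 * y / x ^+ 2 = n%:R * (A ^+ 2 * y).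
Proof.
apply: (mulIf (x := x ^+ 2)); first by rewrite expf_neq0// gt_eqF.
rewrite divfK ?expf_neq0 ?gt_eqF// [RHS](_ : _ = x ^+ 2 * n%:R * (A ^+ 2 * y)); last by ring.
by rewrite xn mul1r.
Qed.

Let rho5E : A / x = n%:R * (A * x).
Proof.
apply: (mulIf (x := x)); first by rewrite gt_eqF.
rewrite divfK ?gt_eqF// [RHS](_ : _ = x ^+ 2 * n%:R * A); last by ring.
by rewrite xn mul1r.
Qed.

(** Dividing all V_j and the order statistic by the same positive number changes neither ranks nor
    selection, so the quantile estimate applies to the normalized values. *)
Lemma path_disagree :
  cnt n (fun j => W j && ((V j < v) != (`|z j| <= a))) <= n%:R * (7 * CL * delta) + 2 * (A / x).
Proof.
have -> : cnt n (fun j => W j && ((V j < v) != (`|z j| <= a))) = cnt n (fun j => W j &&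
    ((V j / (Num.sqrt c * H) < v / (Num.sqrt c * H)) != (`|z j| <= a))) :> R.
  by apply: eq_bigr => j _; rewrite ltr_pM2r ?invr_gt0.
apply: (@disagreement_count R n (fun j => V j / (Num.sqrt c * H)) z W (v / (Num.sqrt c * H))
  a al delta (A / x) (A ^+ 2 * y / x ^+ 2) c0 CL p a0 d0 da d1 path_close _ _ hcnt hB2 pa plip plow _).
- by apply: le_trans hlt; apply: ler_sum => j _; rewrite ltr_pM2r ?invr_gt0.
- by apply: (le_trans hle); apply: ler_sum => j _; rewrite ler_pM2r ?invr_gt0.
(* The condition [big] divided by n: after multiplication by A^3 each of the three terms on the left
   is at most delta, against at least 4 delta on the right. *)
rewrite rho5E B2E -[X in _ + X](_ : n%:R * x ^+ 2 = 1); last by rewrite mulrC.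
rewrite -!mulrDr ltr_pM2l ?ltr0n//.
have A3 : 0 < A ^+ 3 by rewrite exprn_gt0.
rewrite -(ltr_pM2r A3).
have h1 : A * x * A ^+ 3 <= delta by have := @xA 4 isT; apply: le_trans; rewrite le_eqVlt; apply/orP; left; apply/eqP; ring.
have h2 : A ^+ 2 * y * A ^+ 3 <= delta by have := @yA 5 isT; apply: le_trans; rewrite le_eqVlt; apply/orP; left; apply/eqP; ring.
have h3 : x ^+ 2 * A ^+ 3 <= delta.
  apply: le_trans (@xA 3 isT); rewrite ler_pM2r// expr2 ler_piMl//; exact: ltW.
have h4 : 4 * delta <= c0 * delta * A ^+ 3.
  rewrite mulrAC ler_pM2r// -ler_pdivrMl//; apply: (@le_trans _ _ A); first by rewrite mulrC.
  by rewrite -[leLHS]expr1 powA.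
move: d0 h1 h2 h3 h4 => d0'; rewrite !mulrDl; lra.
Qed.


(** Origin of the exponent 17: the four terms inside q^(-1) are at most A^13 delta each, their sum
    costs A^2, the factor q^(-1) costs A, and the discretization terms one more A. *)
Lemma path_bound : `|\sum_(1 <= j < n.+1 | V j < v) q^-1 * `|DX j| ^+ 2 * (`|DX j| <= k1)%R%:R
     - \sum_(1 <= j < n.+1) qv j| <= A ^+ 17 * delta.
Proof.
have A0' := ltW A0; have x0' := ltW x0; have y0' := ltW y0; have d0' := ltW d0.
have xn0 : x != 0 by rewrite gt_eqF.
have dA i : delta <= A ^+ i * delta by rewrite ler_peMl// exprn_ege1.
have A2' : 2 <= A by [].
have AA i : 2 * A ^+ i <= A ^+ i.+1 by rewrite exprS ler_pM2r ?exprn_gt0.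
have rhoA : 2 * A * x ^+ 2 <= A ^+ 2 * x ^+ 2.
  by rewrite ler_pM2r ?exprn_gt0// expr2 ler_pM2r.
have x2 : x ^+ 2 <= x by rewrite expr2 ler_piMl.
have rhoA' : 2 * A * x ^+ 2 <= A ^+ 2 * x.
  by apply: (le_trans rhoA); rewrite ler_pM2l ?exprn_gt0.
have rho0 : 0 <= 2 * A * x ^+ 2 by rewrite mulr_ge0 ?sqr_ge0// mulr_ge0.
have HA : H <= A * x by rewrite /H ler_pM2r.
have HA2 : H ^+ 2 <= A ^+ 2 * x ^+ 2.
  by rewrite -exprMn lerXn2r ?nnegrE ?mulr_ge0// ltW.
have G1 : A ^+ 2 * H <= A ^+ 3 * x.
  by rewrite (exprSr A 2) -mulrA ler_pM2l ?exprn_gt0.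
have G0 : 0 <= A ^+ 2 * H by rewrite mulr_ge0 ?exprn_ge0// ltW.
have GA : A ^+ 2 * H + 2 * A * x ^+ 2 <= A ^+ 4 * x.
  apply: (@le_trans _ _ (2 * A ^+ 3 * x)); last by rewrite ler_pM2r.
  have : 2 * A * x ^+ 2 <= A ^+ 3 * x by rewrite (le_trans rhoA')// ler_pM2r// powA.
  by move: G1; lra.
(* The square of [Ak1]; it lets [m1], of order A^8 x^2, be bounded by x. *)
have A8 : A ^+ 8 * x <= 1.
  have -> : A ^+ 8 * x = (A ^+ 4 * k1) ^+ 2 by rewrite -k1x; ring.
  by rewrite expr_le1// mulr_ge0 ?exprn_ge0// ltW.
have hk1 : A ^+ 2 * H + 2 * A * x ^+ 2 <= k1.
  apply: (le_trans GA); rewrite -k1x expr2 mulrA ler_piMl//; exact: ltW.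
have m1A : (A ^+ 2 * H + 2 * A * x ^+ 2) ^+ 2 <= A ^+ 8 * x ^+ 2.
  rewrite (_ : A ^+ 8 * x ^+ 2 = (A ^+ 4 * x) ^+ 2); last by ring.
  by rewrite lerXn2r ?nnegrE ?addr_ge0 ?mulr_ge0 ?exprn_ge0.
have r30 : 0 <= A * x ^+ 2 by rewrite mulr_ge0 ?sqr_ge0.
have r20 : 0 <= A * x ^+ 3 by rewrite mulr_ge0 ?exprn_ge0.
have := truncation_bound (ltW H0) q0 rho0 r30 r20 hDX hsg hz hq hq3 WD hk1 hB1 hB2 path_disagree hfl.
set m1 := (_ + _) ^+ 2 in m1A *.
have m10 : 0 <= m1 by exact: sqr_ge0.
move=> /le_trans; apply.
(* Intervals with jumps: at most A y / x of them, each contributing about k1^2 = x, which gives the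
   rate y = n^(xi - 1/2). *)
have T1 : A * y / x * (k1 ^+ 2 + m1) <= A ^+ 13 * delta.
  apply: le_trans (dA 13%N); apply: (@le_trans _ _ (A * y / x * (2 * x))).
    rewrite ler_wpM2l ?divr_ge0 ?mulr_ge0// k1x.
    have : m1 <= x by rewrite (le_trans m1A)// expr2 mulrA ler_piMl.
    by lra.
  rewrite (_ : _ * (2 * x) = y * (2 * A ^+ 1)); last by field.
  by apply: le_trans (@yA 2 isT); rewrite ler_pM2l.
(* Wrong selections: about n delta indices, each costing about 1/n. *)
have T2 : (A ^+ 2 * y / x ^+ 2 + (n%:R * (7 * CL * delta) + 2 * (A / x))) * (2 * m1) <= A ^+ 13 * delta.
  rewrite B2E rho5E.
  have -> : n%:R * (A ^+ 2 * y) + (n%:R * (7 * CL * delta) + 2 * (n%:R * (A * x))) =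
     n%:R * (A ^+ 2 * y + 7 * CL * delta + 2 * A * x) by ring.
  apply: (@le_trans _ _ (n%:R * (3 * A * delta) * (2 * (A ^+ 8 * x ^+ 2)))).
    have CL0' := ltW CL0.
    apply: ler_pM; rewrite ?mulr_ge0// ?addr_ge0 ?mulr_ge0 ?exprn_ge0//; last by rewrite ler_pM2l.
    rewrite ler_wpM2l//.
    have h1 : A ^+ 2 * y <= A * delta.
      by rewrite mulrC (le_trans (@yA 2 isT))// (dA 1%N).
    have h2 : 7 * CL * delta <= A * delta by rewrite ler_pM2r.
    have h3 : 2 * A * x <= A * delta.
      apply: (@le_trans _ _ delta); last exact: (dA 1%N).
      by apply: le_trans (@xA 2 isT); rewrite mulrC ler_pM2l// expr2 ler_pM2r.
    by move: h1 h2 h3; lra.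
  rewrite (_ : _ * (2 * _) = x ^+ 2 * n%:R * (6 * A ^+ 9) * delta); last by ring.
  rewrite xn mul1r ler_pM2r//.
  have := AA 9%N; have := AA 10%N; have := AA 11%N; have := AA 12%N.
  have A9 : 0 < A ^+ 9 by rewrite exprn_gt0.
  by lra.
(* Replacing quiet increments by their Wiener parts costs order n^(-3/2) per index, hence n^(-1/2)
   in total. *)
have T3 : n%:R * (2 * A * x ^+ 2 * (2 * A * x ^+ 2 + 2 * (A ^+ 2 * H))) <= A ^+ 13 * delta.
  apply: (@le_trans _ _ (n%:R * (A ^+ 2 * x ^+ 2 * (A ^+ 5 * x)))).
    rewrite ler_wpM2l// ler_pM// ?addr_ge0 ?mulr_ge0//.
    apply: (@le_trans _ _ (A ^+ 4 * x + A ^+ 4 * x)).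
      apply: lerD; first by rewrite (le_trans rhoA')// ler_pM2r// powA.
      apply: (@le_trans _ _ (2 * (A ^+ 3 * x))); first by rewrite ler_pM2l.
      by rewrite mulrA ler_pM2r.
    rewrite (_ : _ + _ = 2 * A ^+ 4 * x); last by ring.
    by rewrite ler_pM2r.
  rewrite (_ : _ * _ = x ^+ 2 * n%:R * A ^+ 2 * (x * A ^+ 5)); last by ring.
  rewrite xn mul1r; apply: ler_pM => //; rewrite ?exprn_ge0 ?mulr_ge0 ?exprn_ge0//; [exact: powA|exact: xA].
(* Fluctuations of order n^(1/2), weighted by the step h. *)
have T4 : H ^+ 2 * (A / x) <= A ^+ 13 * delta.
  apply: le_trans (dA 13%N); apply: le_trans (@xA 3 isT).
  apply: (@le_trans _ _ (A ^+ 2 * x ^+ 2 * (A / x))).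
    by rewrite ler_wpM2r// divr_ge0.
  by rewrite le_eqVlt; apply/orP; left; apply/eqP; field.
have T5 : n%:R * (A * x ^+ 3) <= delta.
  rewrite (_ : _ * _ = x ^+ 2 * n%:R * (x * A ^+ 1)); last by ring.
  by rewrite xn mul1r; exact: xA.
have T6 : A * y / x * (H ^+ 2 * A ^+ 2 + A * x ^+ 2) <= 2 * delta.
  apply: (@le_trans _ _ (A * y / x * (2 * A ^+ 4 * x ^+ 2))).
    rewrite ler_wpM2l ?divr_ge0 ?mulr_ge0//.
    have h1 : H ^+ 2 * A ^+ 2 <= A ^+ 4 * x ^+ 2.
      rewrite (_ : A ^+ 4 * x ^+ 2 = A ^+ 2 * x ^+ 2 * A ^+ 2); last by ring.
      by rewrite ler_pM2r ?exprn_gt0.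
    have h2 : A * x ^+ 2 <= A ^+ 4 * x ^+ 2 by rewrite ler_pM2r ?exprn_gt0// -[leLHS]expr1 powA.
    by move: h1 h2; lra.
  rewrite (_ : _ * _ = 2 * (y * A ^+ 5) * x); last by field.
  rewrite -[leRHS]mulr1 ler_pM// ?mulr_ge0 ?exprn_ge0// ler_pM2l//.
have q1 : 0 <= q^-1 by rewrite invr_ge0 ltW.
have S4 : q^-1 * (A * y / x * (k1 ^+ 2 + m1) + (A ^+ 2 * y / x ^+ 2 + (n%:R * (7 * CL * delta) + 2 * (A / x))) * (2 * m1)
   + n%:R * (2 * A * x ^+ 2 * (2 * A * x ^+ 2 + 2 * (A ^+ 2 * H))) + H ^+ 2 * (A / x)) <= A ^+ 16 * delta.
  rewrite (_ : A ^+ 16 * delta = A * (A ^+ 15 * delta)); last by ring.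
  have m1_2 : 0 <= 2 * m1 by rewrite mulr_ge0.
  have CL0' := ltW CL0.
  apply: (@le_trans _ _ (q^-1 * (A ^+ 15 * delta))).
    rewrite ler_wpM2l//.
    have : 4 * (A ^+ 13 * delta) <= A ^+ 15 * delta.
      rewrite mulrA ler_pM2r//; have := AA 13%N; have := AA 14%N; lra.
    by move: T1 T2 T3 T4; lra.
  by rewrite ler_wpM2r// mulr_ge0// exprn_ge0.
have h17 : 2 * (A ^+ 16 * delta) <= A ^+ 17 * delta by rewrite mulrA ler_pM2r.
have h2 : 4 * delta <= A ^+ 16 * delta.
  rewrite ler_pM2r//; apply: (@le_trans _ _ (A ^+ 2)); last exact: powA.
  by have := AA 1%N; move: A2'; rewrite expr1; lra.
move: S4 T5 T6 h17 h2; lra.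
Qed.

End PathBound.

(** * From paths to norms *)

Section Conclusion.
Context {R : realType} {d : measure_display} {Omega : measurableType d}.
Variable P : probability Omega R.

(* On the exceptional set N, 1_N u <= lam 1_N + lam^-1 u^2, and P N beats every power of n. *)
Lemma wop_bigO (Y W : nat -> Omega -> R) (b0 b : R) :
  wop P (fun n => [set x | `|Y n x| <= n%:R `^ (- b0)]) ->
  (forall n x, (0 < n)%N -> `|Y n x| <= `|W n x|) ->
  mom_bound P (fun n _ => W n) b ->
  forall p : R, 1 < p ->
    is_bigO (fun n => 'N[P]_(p%:E)[EFin \o Y n])%E (fun n => n%:R `^ (- b0)).
Proof.
move=> wY YW mW p p1; have p0 : 0 < p by apply: lt_trans p1.
pose k := (Num.truncn p).+1; pose b' := Num.max b 0.
have pk : p <= k.*2%:R.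
  by apply: ltW; apply: (lt_le_trans (truncnS_gt _)); rewrite ler_nat -addnn leq_addl.
have b'0 : 0 <= b' by rewrite le_max lexx orbT.
have mZ : mom_bound P (fun n _ x => 1 + `|W n x|) b'.
  have m1 : mom_bound P (fun n _ _ => 1 * n%:R `^ 0) b' :> Prop.
    by apply: mom_bound_le (mom_bound_cst P 1 0).
  have mN : mom_bound P (fun n _ x => `|W n x|) b'.
    apply: (@mom_bound_norm_le _ _ _ P _ (fun n _ => W n)).
    - move=> n j jn; apply: measurableT_comp; first exact: normr_measurable.
      exact: (mW.1 n j jn).
    - by move=> n j jn x; rewrite normr_id.
    - by apply: mom_bound_le mW; rewrite le_max lexx.
  have := mom_boundD m1 mN; apply: mom_bound_norm_le.
    move=> n j jn; apply: measurable_funD; first exact: measurable_cst.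
    exact: (mN.1 n j jn).
  by move=> n j jn x; rewrite powRr0 mulr1.
have [C hC] := mZ.2 k.*2.
(* The exponent of [lam] is fixed so that lam^(-1) times the second moment of [U] is O(n^(-b0 p));
   [L] is then large enough for lam P(N) to be of the same order. *)
pose l := b' * k.*2.*2%:R + b0 * p.
pose L := (Num.truncn `|l + b0 * p|).+1.
have LE : l + b0 * p <= L%:R.
  by apply: (le_trans (ler_norm _)); apply: ltW; exact: truncnS_gt.
exists ((2 + `|C|) `^ p^-1); near=> n.
have n0 : (0 < n)%N by near: n; exact: nbhs_infty_gt.
have [N [mN PN hN]] : exists N : set Omega, [/\ measurable N, (P N <= (n%:R ^- L)%:E)%E &
  forall x, ~ N x -> [set x | `|Y n x| <= n%:R `^ (- b0)] x] by near: n; exact: wY.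
have hCn : (moment P k.*2.*2 (fun x => 1 + `|W n x|)%R <= (C * n%:R `^ b' ^+ k.*2.*2)%:E)%E.
  have : forall j, (0 < j <= n)%N ->
    (moment P k.*2.*2 (fun x => 1 + `|W n x|)%R <= (C * n%:R `^ b' ^+ k.*2.*2)%:E)%E by near: n.
  by move=> /(_ n); apply; rewrite n0 leqnn.
have mWn : measurable_fun setT (W n) by apply: (mW.1 n n); rewrite n0 leqnn.
pose U x := (1 + `|W n x|) ^+ k.*2.
have U0 x : 0 <= U x by rewrite exprn_ge0// addr_ge0.
have mU : measurable_fun setT U.
  by apply: measurable_funX; apply: measurable_funD => //; exact: measurableT_comp.
pose lam := n%:R `^ l : R; have lam0 : 0 < lam by exact: npow_gt0.
have bnd x : `|Y n x| `^ p <= n%:R `^ (- (b0 * p)) + (lam * \1_N x + lam^-1 * U x ^+ 2).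
  have lU : 0 <= lam^-1 * U x ^+ 2 by rewrite mulr_ge0 ?invr_ge0 ?sqr_ge0// ltW.
  rewrite indicE; case: (boolP (x \in N)) => xN; last first.
    have := hN x; rewrite -notin_setE => /(_ xN) /= h.
    rewrite mulr0 add0r ler_wpDr//.
    have := ge0_ler_powR (ltW p0) _ _ h; rewrite !nnegrE normr_ge0 powR_ge0 => /(_ isT isT).
    by rewrite -powRrM mulNr.
  rewrite mulr1 ler_wpDl ?powR_ge0//.
  have h1 : `|Y n x| `^ p <= U x.
    have h : `|Y n x| <= 1 + `|W n x| by rewrite (le_trans (YW n x n0))// lerDr.
    have := ge0_ler_powR (ltW p0) _ _ h; rewrite !nnegrE normr_ge0 addr_ge0// => /(_ isT isT).
    move=> /le_trans; apply; rewrite /U -powR_mulrn ?addr_ge0//.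
    by apply: ler_powR => //; rewrite lerDl.
  apply: (le_trans h1); rewrite -subr_ge0.
  have -> : lam + lam^-1 * U x ^+ 2 - U x = lam^-1 * ((lam - U x / 2) ^+ 2 + 3 / 4 * U x ^+ 2).
    by field; rewrite gt_eqF.
  by rewrite mulr_ge0 ?invr_ge0 ?(ltW lam0)// addr_ge0 ?sqr_ge0// mulr_ge0// sqr_ge0.
have int : (\int[P]_x (`|Y n x| `^ p)%:E <= ((2 + `|C|) * n%:R `^ (- (b0 * p)))%:E)%E.
  apply: (@le_trans _ _ (\int[P]_x (n%:R `^ (- (b0 * p)) + (lam * \1_N x + lam^-1 * U x ^+ 2))%:E)%E).
    apply: le_lower_integral => x; first by rewrite lee_fin powR_ge0.
    by rewrite lee_fin.
  have mI : measurable_fun setT (\1_N : Omega -> R) by exact: measurable_indic.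
  have mU2 : measurable_fun setT (fun x => U x ^+ 2) by exact: measurable_funX.
  have lam0' := ltW lam0.
  have lamV : 0 <= lam^-1 by rewrite invr_ge0.
  rewrite ge0_expectD; last 4 first.
  - exact: measurable_cst.
  - by apply: measurable_funD; apply: measurable_funM.
  - by move=> x; exact: powR_ge0.
  - by move=> x; have h := sqr_ge0 (U x); rewrite addr_ge0// mulr_ge0.
  rewrite expect_cst ge0_expectD; last 4 first.
  - exact: measurable_funM.
  - exact: measurable_funM.
  - by move=> x; rewrite mulr_ge0.
  - by move=> x; rewrite mulr_ge0// sqr_ge0.
  rewrite !ge0_expectZ//; last by move=> x; exact: sqr_ge0.
  have -> : (\int[P]_x (\1_N x)%:E = P N)%E by rewrite integral_indic// setIT.
  have -> : (\int[P]_x (U x ^+ 2)%:E = moment P k.*2.*2 (fun x => 1 + `|W n x|)%R)%E.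
    apply: eq_integral => x _; congr EFin.
    by rewrite /U -exprM (ger0_norm (_ : 0 <= 1 + `|W n x|)) ?addr_ge0// muln2.
  have h2 : (lam%:E * P N <= (n%:R `^ (- (b0 * p)))%:E)%E.
    apply: (@le_trans _ _ (lam%:E * (n%:R ^- L)%:E)%E); first by rewrite lee_wpmul2l// lee_fin.
    rewrite -EFinM lee_fin /lam -powR_mulrn// -powRN -npowD//; apply: npow_le => //.
    by move: LE; lra.
  have h3 : (lam^-1%:E * moment P k.*2.*2 (fun x => 1 + `|W n x|)%R <=
      (`|C| * n%:R `^ (- (b0 * p)))%:E)%E.
    apply: (@le_trans _ _ (lam^-1%:E * (`|C| * n%:R `^ b' ^+ k.*2.*2)%:E)%E).
      rewrite lee_wpmul2l ?lee_fin//; apply: (le_trans hCn); rewrite lee_fin.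
      by rewrite ler_wpM2r ?ler_norm// exprn_ge0// powR_ge0.
    rewrite -EFinM lee_fin mulrCA ler_wpM2l// npow_exp /lam -powRN -npowD//.
    by apply: npow_le => //; rewrite /l; lra.
  have := leeD (lexx (n%:R `^ (- (b0 * p)))%:E) (leeD h2 h3).
  move=> /le_trans; apply; rewrite -!EFinD lee_fin; lra.
rewrite unlock.
have -> : (n%:R `^ (- b0) : R) = (n%:R `^ (- (b0 * p))) `^ p^-1.
  by rewrite -powRrM mulNr mulfK// gt_eqF.
rewrite -powRM ?addr_ge0 ?powR_ge0// -poweR_EFin.
apply: gt0_ler_poweR.
- by rewrite invr_ge0 ltW.
- rewrite in_itv/= leey andbT.
  have I0 : (0 <= \int[P]_x (`|(EFin \o Y n) x| `^ p))%E.
    by apply: integral_ge0 => x _; rewrite poweR_ge0.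
  exact: I0.
- by rewrite in_itv/= leey andbT lee_fin mulr_ge0 ?addr_ge0 ?powR_ge0.
- apply: le_trans int; rewrite le_eqVlt; apply/orP; left; apply/eqP.
  exact: eq_integral.
Unshelve. all: by end_near. Qed.

End Conclusion.

(** * Empirical counts, crude bounds and conclusion *)

Section Assembly.
Context {R : realType} {d : measure_display} {Omega : measurableType d}.
Variable P : probability Omega R.
Variables (T : R) (F : R -> set (set Omega)) (w : R -> Omega -> R).
Hypotheses (hT : 0 < T) (hF : filtration T F) (hw : wiener_process P T F w).

Lemma indic_le (A : Type) (Z : A -> R) (r : R) y :
  (`|Z y| <= r)%R%:R = \1_[set y | `|Z y| <= r] y :> R.
Proof. by rewrite indicE; congr (nat_of_bool _)%:R; apply/idP/idP; rewrite inE. Qed.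

(** [mom_fluct] with unit weights and an indicator. The thresholds are deterministic, so four such
    statements suffice and no uniformity over thresholds is required. *)
Lemma mom_count (r : nat -> R) : mom_bound P
  (fun n _ x => cnt n (fun j => `|zeta T w n j x| <= r n) - n%:R * normal_cdf_abs (r n)) (2^-1).
Proof.
have H := @mom_fluct _ _ _ P T F w hT hF hw (fun n z => (`|z| <= r n)%R%:R)
  (fun n => normal_cdf_abs (r n)) (fun _ _ _ => 1) _ _ _ _ _ _.
have -> : (fun (n _ : nat) x => cnt n (fun j => `|zeta T w n j x| <= r n) - n%:R * normal_cdf_abs (r n)) =
   (fun n _ x => \sum_(1 <= j < n.+1) 1 * ((`|zeta T w n j x| <= r n)%R%:R - normal_cdf_abs (r n))).
  apply/funext => n; apply/funext => _; apply/funext => x.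
  under [RHS]eq_bigr do rewrite mul1r.
  by rewrite sumrB big_const_nat subn1 iter_addr_0 mulr_natl.
have ind n (z : R) : (`|z| <= r n)%R%:R = \1_[set y : R | `|y| <= r n] z :> R.
  exact: (indic_le id).
apply: H.
- move=> n; under eq_fun do rewrite ind; apply: measurable_indic; exact: measurable_absle.
- by move=> n z.
- move=> n z; apply: (@le_trans _ _ 1); last by rewrite lerDl sqr_ge0.
  by case: (`|z| <= _).
- move=> n Z nZ; rewrite -(standard_normal_cdf (r n) nZ).
  have mZ := nZ.1.
  have mE : measurable [set y | `|Z y| <= r n].
    rewrite -[X in measurable X]setTI; apply: measurable_fun_le => //.
    by apply: measurableT_comp; first exact: normr_measurable.
  have -> : (P [set y | (`|Z y| <= r n)%R] = \int[P]_y (\1_[set y | (`|Z y| <= r n)%R] y)%:E)%E.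
    by rewrite integral_indic// setIT.
  apply: eq_integral => y _.
  by rewrite indic_le.
- move=> n j jn; have sF := filtration_sigma hF (tl_itv hT jn).
  by apply/(measurable_wrtP _ sF); exact: measurable_cst.
- by move=> k; exists 1 => n j _; rewrite /moment expect_cst normr1 expr1n.
Qed.

Variable sigma : nat -> R -> Omega -> R.
Hypothesis hsigma : forall n, (0 < n)%N -> cadlag_adapted T F (sigma n).
Hypothesis h1i : forall p : R, 1 < p -> exists C : R,
  forall n t, (0 < n)%N -> 0 <= t <= T ->
    ('N[P]_(p%:E)[EFin \o sigma n t] <= C%:E)%E.

(** [mom_fluct] with weights sigma^2 at left ends, which are adapted; the truncated square has mean
    [q_of_c c]. *)
Lemma mom_truncated_square (c : R) : mom_bound P
  (fun n _ x => \sum_(1 <= j < n.+1) sigma n (grid T n j.-1) x ^+ 2 *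
    (zeta T w n j x ^+ 2 * (`|zeta T w n j x| <= Num.sqrt c)%R%:R - q_of_c c)) (2^-1).
Proof.
have ind (z : R) : (`|z| <= Num.sqrt c)%R%:R = \1_[set y : R | `|y| <= Num.sqrt c] z :> R.
  exact: (indic_le id).
have mf : measurable_fun setT (fun z : R => z ^+ 2 * (`|z| <= Num.sqrt c)%R%:R).
  apply: measurable_funM; first exact: measurable_funX.
  under eq_fun do rewrite ind; apply: measurable_indic; exact: measurable_absle.
have f0 (z : R) : 0 <= z ^+ 2 * (`|z| <= Num.sqrt c)%R%:R by rewrite mulr_ge0 ?sqr_ge0.
apply: (@mom_fluct _ _ _ P T F w hT hF hw (fun _ z => z ^+ 2 * (`|z| <= Num.sqrt c)%R%:R)
  (fun=> q_of_c c) (fun n j x => sigma n (grid T n j.-1) x ^+ 2)).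
- by [].
- by [].
- move=> _ z; case: (`|z| <= _); rewrite ?mulr1 ?mulr0; first by rewrite lerDr.
  by rewrite addr_ge0// sqr_ge0.
- move=> n Z nZ.
  rewrite (standard_normal_expect (f := fun z => z ^+ 2 * (`|z| <= Num.sqrt c)%R%:R) nZ)//.
  rewrite -q_of_cE; apply: eq_integral => z _.
  by rewrite ind.
- move=> n j jn; have tT := tl_itv hT jn; have sF := filtration_sigma hF tT.
  have ms := (hsigma (ord_gt0 jn)).1 _ tT.
  have -> : (fun x => sigma n (grid T n j.-1) x ^+ 2) =
     (fun x => sigma n (grid T n j.-1) x * sigma n (grid T n j.-1) x).
    by apply/funext => x; rewrite expr2.
  exact: measurable_wrtM.
- move=> k; have [C C0 hC] := moment_sigma2 hF hsigma h1i k; exists C => n j jn.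
  by apply: hC; [exact: ord_gt0 jn|exact: tl_itv].
Qed.

(** The truncation bounds each of at most n squares by n^(-1/2), whatever the path. *)
Lemma global_RV_bounds n (alpha q : R) (S : nat -> R) (x : R -> R) : (0 < n)%N -> 0 < q ->
  0 <= global_RV T n alpha q S x <= q^-1 * n%:R `^ 2^-1.
Proof.
move=> n0 q0; have q1 : 0 <= q^-1 by rewrite invr_ge0 ltW.
rewrite /global_RV; apply/andP; split.
  by apply: sumr_ge0 => j _; rewrite !mulr_ge0// ?exprn_ge0// /Ktrunc.
rewrite big_mkcond; apply: (@le_trans _ _ (\sum_(1 <= j < n.+1) q^-1 * n%:R `^ (- 2^-1))).
  apply: ler_sum => j _.
  have b0 : 0 <= q^-1 * n%:R `^ (- 2^-1) by rewrite mulr_ge0 ?powR_ge0.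
  case: ifP => _ //; rewrite -mulrA ler_wpM2l// /Ktrunc.
  case: (boolP (`|increment T n x j| <= _)) => h; rewrite ?mulr1 ?mulr0 ?powR_ge0//.
  have -> : n%:R `^ (- 2^-1) = (n%:R `^ (- 4^-1)) ^+ 2 :> R.
    by rewrite npow_exp; congr (_ `^ _); lra.
  by rewrite lerXn2r ?nnegrE ?powR_ge0.
rewrite big_const_nat subn1 iter_addr_0 -mulrnAr -[X in _ * X <= _]mulr_natr ler_wpM2l// -{2}[n%:R]npow1.
by rewrite -npowD// npow_le//; lra.
Qed.

End Assembly.

Unset Implicit Arguments.

Theorem theorem4p11 (R : realType) (d : measure_display)
  (Omega : measurableType d) (P : probability Omega R)
  (T : R) (hT : 0 < T)
  (F : R -> set (set Omega)) (hF : filtration T F)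
  (* the processes; those indexed by nat may depend on n >= 1 *)
  (w : R -> Omega -> R) (hw : wiener_process P T F w)
  (X0 : Omega -> R) (hX0 : measurable_wrt (F 0) X0)
  (b : R -> Omega -> R) (hb : cadlag_adapted T F b)
  (sigma : nat -> R -> Omega -> R)
  (hsigma : forall n, (0 < n)%N -> cadlag_adapted T F (sigma n))
  (M : nat -> R -> Omega -> R)
  (hM : forall n, (0 < n)%N -> ito_integral P T F w (sigma n) (M n))
  (J : nat -> R -> Omega -> R)
  (hJ : forall n, (0 < n)%N -> cadlag_adapted T F (J n))
  (hJfin : forall n, (0 < n)%N -> {ae P, forall omega,
     (jump_number (J n ^~ omega) `]0%R, T] < +oo)%E})
  (hJsum : forall n, (0 < n)%N -> {ae P, forall omega,
     forall t, 0 <= t <= T -> J n t omega = jump_sum (J n ^~ omega) t})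
  (X : nat -> R -> Omega -> R)
  (hX : forall n, (0 < n)%N -> cadlag_adapted T F (X n))
  (hXdec : forall n, (0 < n)%N -> {ae P, forall omega,
     forall t, 0 <= t <= T ->
       X n t omega = X0 omega + \int[lebesgue_measure]_(s in `[0, t]) b s omega
                     + M n t omega + J n t omega})
  (hsigmafin : forall n, (0 < n)%N -> {ae P, forall omega,
     (jump_number (sigma n ^~ omega) `]0%R, T] < +oo)%E})
  (sigmat : R -> Omega -> R)
  (hsigmat : forall n, (0 < n)%N -> {ae P, forall omega,
     forall t, 0 <= t <= T ->
       sigmat t omega = sigma n t omega - jump_sum (sigma n ^~ omega) t})
  (* windows and normalizing variables; S n j is S_{n,j} for j < n *)
  (kappa : nat -> nat)
  (hkappa : forall n, (0 < n)%N -> ((kappa n).*2 + 1 <= n)%N)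
  (S : nat -> nat -> Omega -> R)
  (hS : forall n j, (j < n)%N -> measurable_fun setT (S n j))
  (alpha : R) (halpha : 0 < alpha < 1)
  (calpha : R) (hcalpha : is_c_alpha alpha calpha)
  (h1i : forall p : R, 1 < p -> exists C : R,
     forall n t, (0 < n)%N -> 0 <= t <= T ->
       ('N[P]_(p%:E)[EFin \o sigma n t] <= C%:E)%E)
  (h1i' : forall p : R, 1 < p -> exists C : R,
     forall s t, 0 <= s <= T -> 0 <= t <= T ->
       ('N[P]_(p%:E)[EFin \o (sigmat t \- sigmat s)%R]
          <= (C * `|t - s| `^ 2^-1)%:E)%E)
  (h1ii : forall p : R, 1 < p -> exists C : R,
     forall t, 0 <= t <= T -> ('N[P]_(p%:E)[EFin \o b t] <= C%:E)%E)
  (h1iii : forall n t, (0 < n)%N -> 0 <= t <= T ->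
     {ae P, forall omega, sigma n t omega != 0})
  (h1iii' : forall p : R, 1 < p -> exists C : R,
     forall n t, (0 < n)%N -> 0 <= t <= T ->
       ('N[P]_(p%:E)[EFin \o (fun omega => (sigma n t omega)^-1)%R] <= C%:E)%E)
  (h2i : forall n j, (0 < j <= n)%N -> {ae P, forall omega, 0 < S n j.-1 omega})
  (h2i' : forall p : R, 1 < p -> exists C : R,
     forall n j, (0 < j <= n)%N ->
       ('N[P]_(p%:E)[EFin \o (fun omega => (S n j.-1 omega)^-1)%R] <= C%:E)%E)
  (gamma0 c : R) (hgamma0 : 0 < gamma0) (hc : 0 < c)
  (h2ii : forall p : R, 1 < p -> exists C : R,
     forall n j, (0 < j <= n)%N ->
       ((n%:R `^ gamma0)%:E *
        'N[P]_(p%:E)[EFin \o (fun omega =>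
           (~~ in_calL T n (kappa n) (J n ^~ omega) (sigma n ^~ omega) j)%:R *
           (sigma n (grid T n j.-1) omega ^+ 2 - c * S n j.-1 omega))%R]
        <= C%:E)%E)
  (xi : R) (hxi0 : 0 <= xi)
  (h3 : forall p : R, 1 < p ->
     is_bigO (fun n => 'N[P]_(p%:E)[EFin \o (fun omega =>
                (card_frakL T n (J n ^~ omega) (sigma n ^~ omega))%:R)%R]%E)
             (fun n => n%:R `^ xi))
  (hxi : xi < 2^-1)
  (hkappaO : is_bigO (fun n => ((kappa n)%:R : R)%:E) (fun n => n%:R `^ 2^-1))
  (beta0 : R) (hbeta0 : beta0 < Num.min gamma0 (2^-1 - xi)) :
  forall p : R, 1 < p ->
    is_bigO (fun n => 'N[P]_(p%:E)[EFin \o (fun omega =>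
               global_RV T n alpha (q_of_c calpha) (S n ^~ omega) (X n ^~ omega)
               - \int[lebesgue_measure]_(t in `[0, T]) (sigma n t omega ^+ 2))%R]%E)
            (fun n => n%:R `^ (- beta0)).
Proof.
move=> p p1.
have [a0 pa] := c_alpha_gt0 halpha hcalpha.
have q0 := q_of_c_gt0 a0.
have [/andP[al0 al1] T0] := (halpha, ltW hT).
set a := Num.sqrt calpha in a0 pa; set q := q_of_c calpha in q0 *.
have [CL CL0 plip] := @normal_cdf_abs_lip R.
have [c0 c00 plow] := @normal_cdf_abs_lower R (a + 1).
pose m := Num.min gamma0 (2^-1 - xi).
have m0 : 0 < m by rewrite lt_min hgamma0 subr_gt0.
have mg : m <= gamma0 by rewrite ge_min lexx.
have mx : m <= 2^-1 - xi by rewrite ge_min lexx orbT.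
(* [beta] is positive even if [beta0] is not, so that [delta] tends to 0 as the quantile estimate
   requires; the gaps on both sides leave room for factors n^eps. *)
have [beta [b0 bm bb]] : exists beta, [/\ 0 < beta, beta < m & beta0 < beta].
  have M0 : 0 <= Num.max beta0 0 by rewrite le_max lexx orbT.
  have Mb : beta0 <= Num.max beta0 0 by rewrite le_max lexx.
  have Mm : Num.max beta0 0 < m by rewrite gt_max hbeta0 m0.
  by exists ((Num.max beta0 0 + m) / 2); split; lra.
(* 17 is the power of A lost in [path_bound] and 5 the one in [yd] and [gd]; 16 eps <= 1 makes A^4
   n^(-1/4) at most 1. *)
have [eps [e0 e17 e5 e16]] : exists eps, [/\ 0 < eps, 17 * eps <= beta - beta0,
    5 * eps <= m - beta & 16 * eps <= 1].
  pose e := Num.min ((beta - beta0) / 17) (Num.min ((m - beta) / 5) 16^-1).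
  have h1 : e <= (beta - beta0) / 17 by rewrite ge_min lexx.
  have h2 : e <= (m - beta) / 5 by rewrite !ge_min lexx orbT.
  have h3' : e <= 16^-1 by rewrite !ge_min lexx !orbT.
  exists e; split; [|lra|lra|lra].
  by rewrite /e !lt_min; apply/and3P; split; lra.
have mS : mom_bound P (fun n j x => `|S n j.-1 x|^-1) 0.
  apply: (mom_inv _ h2i') => n j /andP[j1 jn].
  by apply: hS; rewrite prednK.
pose delta (n : nat) : R := n%:R `^ (- beta).
(* Almost sure identities are put in the same form as the moment bounds, so that all of them can be
   intersected. *)
have W15 : wop P (fun n => [set x | [/\ forall t, 0 <= t <= T ->
      X n t x = X0 x + \int[lebesgue_measure]_(s in `[0, t]) b s x + M n t x + J n t x,
    forall t, 0 <= t <= T -> J n t x = jump_sum (J n ^~ x) t &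
    forall j, (0 < j <= n)%N -> 0 < S n j.-1 x]]).
  apply: wop_ae => n n0.
  have hSn : {ae P, forall x, forall j, (0 < j <= n)%N -> 0 < S n j.-1 x}.
    apply: ae_foralln => j; case: (boolP (0 < j <= n)%N) => jn.
      by apply: filterS (h2i n j jn) => x.
    by apply: aeW.
  by apply: filterS3 (hXdec n n0) (hJsum n n0) hSn => x ? ? ?; split.
have [W1 W2] := (mom_wop e0 (mom_sigma hT hF hsigma h1i), mom_wop e0 (mom_zeta hT hF hw)).
have W3 := mom_wop e0 mS.
have W4 := mom_wop e0 (mom_ito_err hT hF hw hsigma hsigmafin hsigmat h1i' hM).
have W5 := mom_wop e0 (mom_drift hT hF hb h1ii).
have W6 := mom_wop e0 (mom_qerr hT hF hsigma h1i hsigmat h1i').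
have W7 := mom_wop e0 (mom_qvar hT hF hsigma h1i).
have W8 := mom_wop e0 (mom_cardD hT hF hsigma hsigmafin hJ hJfin h3).
have W9 := mom_wop e0 (mom_Serr hT hF hsigma hsigmafin hJ hJfin hkappa hS h2ii).
have W10 := mom_wop e0 (mom_truncated_square hT hF hw hsigma h1i calpha).
have W11 := mom_wop e0 (mom_count hT hF hw (fun n => a + delta n)).
have W12 := mom_wop e0 (mom_count hT hF hw (fun n => a - delta n)).
have W13 := mom_wop e0 (mom_count hT hF hw (fun n => a + 3 * delta n)).
have W14 := mom_wop e0 (mom_count hT hF hw (fun n => a - 4 * delta n)).
have W := wopI W1 (wopI W2 (wopI W3 (wopI W4 (wopI W5 (wopI W6 (wopI W7 (wopI W8 (wopI W9
  (wopI W10 (wopI W11 (wopI W12 (wopI W13 (wopI W14 W15))))))))))))).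
move=> {W1 W2 W3 W4 W5 W6 W7 W8 W9 W10 W11 W12 W13 W14 W15}.
(* The dominating variable is the deterministic bound on [global_RV] plus Theta; it is needed only
   on the exceptional event. *)
apply: (@wop_bigO R d Omega P
  (fun n omega => global_RV T n alpha q (S n ^~ omega) (X n ^~ omega)
               - \int[lebesgue_measure]_(t in `[0, T]) (sigma n t omega ^+ 2))
  (fun n x => q^-1 * n%:R `^ 2^-1 + Theta T sigma n x) beta0 2^-1 _ _ _ p p1); last 2 first.
- move=> n x n0.
  have /andP[v0 v1] := global_RV_bounds T alpha (S n ^~ x) (X n ^~ x) n0 q0.
  have th0 : 0 <= Theta T sigma n x by apply: Rintegral_ge0 => t _; exact: sqr_ge0.
  rewrite [leRHS]ger0_norm; last by rewrite addr_ge0// (le_trans v0).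
  apply: (le_trans (ler_normB _ _)); rewrite !ger0_norm//.
  exact: lerD.
- apply: mom_boundD (mom_bound_cst P q^-1 2^-1) _.
  by apply: mom_bound_le (mom_Theta hT hF hsigma h1i).
have dom (e C : R) : 0 < e -> \forall n \near \oo, C <= n%:R `^ e.
  by move=> ep; have := npow_dom C ep; apply: filterS => n [].
have [Ck hCk] := hkappaO.
apply: wop_sub W; near=> n.
have n0 : (0 < n)%N by near: n; exact: nbhs_infty_gt.
pose x : R := n%:R `^ (- 2^-1); pose k1 : R := n%:R `^ (- 4^-1); pose A : R := n%:R `^ eps.
pose y : R := n%:R `^ (xi - 2^-1); pose g : R := n%:R `^ (- gamma0).
have x0 : 0 < x by exact: npow_gt0.
have k10 : 0 < k1 by exact: npow_gt0.
have A0 : 0 < A by exact: npow_gt0.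
have y0 : 0 < y by exact: npow_gt0.
have g0 : 0 < g by exact: npow_gt0.
have d0 : 0 < delta n by exact: npow_gt0.
have xV : x^-1 = n%:R `^ 2^-1 by rewrite /x -powRN opprK.
have x2 : x ^+ 2 = n%:R^-1 by rewrite /x npow_exp -[n%:R^-1]npowN1; congr (_ `^ _); lra.
have xn : x ^+ 2 * n%:R = 1 by rewrite x2 mulVf// pnatr_eq0 -lt0n.
have k1x : k1 ^+ 2 = x by rewrite /k1 npow_exp /x; congr (_ `^ _); lra.
have Ak1 : A ^+ 4 * k1 <= 1.
  apply: (@le_trans _ _ (n%:R `^ 0)); last by rewrite powRr0.
  by rewrite /A npow_exp /k1 -npowD//; apply: npow_le => //; lra.
have xy : x <= y by apply: npow_le => //; lra.
have yd : y * A ^+ 5 <= delta n.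
  by rewrite /A npow_exp /y -npowD//; apply: npow_le => //; lra.
have gd : g * A ^+ 5 <= delta n.
  by rewrite /A npow_exp /g -npowD//; apply: npow_le => //; lra.
have dV : delta n = (n%:R `^ beta)^-1 by rewrite /delta powRN.
have nb : 0 < n%:R `^ beta :> R by exact: npow_gt0.
have da : 4 * delta n <= a.
  have : 4 / a <= n%:R `^ beta by near: n; exact: dom.
  by rewrite dV ler_pdivrMr// ler_pdivrMr// mulrC.
have d1 : 3 * delta n <= 1.
  have : 3 <= n%:R `^ beta :> R by near: n; exact: dom.
  by rewrite dV ler_pdivrMr// mul1r.
have A2 : 2 <= A by rewrite /A; near: n; exact: dom.
have AT : Num.sqrt T <= A by rewrite /A; near: n; exact: dom.
have Ac : 2 / c <= A by rewrite /A; near: n; exact: dom.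
have AcT : 4 / (Num.sqrt c * Num.sqrt T) <= A by rewrite /A; near: n; exact: dom.
have Ac0 : 4 / c0 <= A by rewrite /A; near: n; exact: dom.
have Aq : q^-1 <= A by rewrite /A; near: n; exact: dom.
have ACL : 7 * CL <= A by rewrite /A; near: n; exact: dom.
have ACk : 4 * `|Ck| + 1 <= A by rewrite /A; near: n; exact: dom.
have nal : 1 <= n%:R * (1 - alpha).
  have : (1 - alpha)^-1 <= n%:R `^ 1 by near: n; exact: dom.
  by rewrite npow1 -[(1 - alpha)^-1]mul1r ler_pdivrMr ?subr_gt0.
(* This is where kappa_n = O(n^(1/2)) enters: it bounds the number of windows spoilt by one cell. *)
have kA : 4 * (kappa n)%:R + 1 <= A / x.
  have : ((kappa n)%:R%:E <= (Ck * n%:R `^ 2^-1)%:E)%E by near: n.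
  rewrite lee_fin -xV => hk.
  have x1 : 1 <= x^-1 by rewrite xV -[leLHS](powRr0 (n%:R : R)); apply: npow_le.
  apply: (@le_trans _ _ ((4 * `|Ck| + 1) * x^-1)); last by rewrite ler_pM2r ?invr_gt0.
  have h1 : Ck * x^-1 <= `|Ck| * x^-1 by rewrite ler_pM2r ?invr_gt0// ler_norm.
  by rewrite mulrDl mul1r; lra.
have sT : Num.sqrt (T / n%:R) = Num.sqrt T * x.
  by rewrite sqrtrM// -x2 sqrtr_sqr ger0_norm// ltW.
have HT : (Num.sqrt T * x) ^+ 2 = T / n%:R by rewrite exprMn sqr_sqrtr// x2.
have eA0 : n%:R `^ (0 + eps) = A by rewrite add0r.
have eA1 : n%:R `^ (- 1 + eps) = A * x ^+ 2.
  by rewrite /x npow_exp /A -npowD//; congr (_ `^ _); lra.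
have eA3 : n%:R `^ (- (3 / 2) + eps) = A * x ^+ 3.
  by rewrite /x npow_exp /A -npowD//; congr (_ `^ _); lra.
have eAxi : n%:R `^ (xi + eps) = A * y / x.
  by rewrite xV /A /y -!npowD//; congr (_ `^ _); lra.
have eAg : n%:R `^ (- gamma0 + eps) = A * g by rewrite npowD// mulrC.
have eA2 : n%:R `^ (2^-1 + eps) = A / x by rewrite npowD// xV mulrC.
move=> omega /= [h1 [h2 [hS3 [h4 [h5 [h6 [h7 [h8 [h9 [h10 [h11 [h12 [h13 [h14
  [hX1 hJ1 hSp]]]]]]]]]]]]]]].
rewrite eA0 in h1 h2 hS3; rewrite eA1 in h4 h5 h7; rewrite eA3 in h6.
rewrite eAxi in h8; rewrite eAg in h9; rewrite eA2 in h10 h11 h12 h13 h14.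
(* The global quantities carry a dummy index, read off at j = 1. *)
have j1 : (0 < 1 <= n)%N by rewrite n0.
have Theta_sum : \int[lebesgue_measure]_(t in `[0, T]) (sigma n t omega ^+ 2) =
    \sum_(1 <= j < n.+1) qvar T sigma n j omega.
  exact: (cadlag_integral_grid hT (cadlag_sigma2 hsigma omega n0) n0).
(* For large n the rank is at least 1, which keeps the order statistic away from the default V_(0) =
   0. *)
have [s1 s2] : (0 < s_trunc n alpha)%N /\ (s_trunc n alpha <= n)%N.
  have n1 : 0 <= n%:R * (1 - alpha) by apply: le_trans nal.
  have /andP[t1 t2] := truncn_itv n1; rewrite -/(s_trunc n alpha) in t1 t2.
  split.
    have : 1 < (s_trunc n alpha).+1%:R :> R by apply: le_lt_trans t2.
    by rewrite ltr1n.
  rewrite -(ler_nat R); apply: (le_trans t1); rewrite ler_piMr//; lra.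
have n1 : 0 <= n%:R * (1 - alpha) by apply: le_trans nal.
have /andP[t1 t2] := truncn_itv n1; rewrite -/(s_trunc n alpha) in t1 t2.
have [cl ch] := @ordV_count R T n (s_trunc n alpha) (S n ^~ omega) (X n ^~ omega) (ltac:(by rewrite s1 s2)).
apply: (@le_trans _ _ (A ^+ 17 * delta n)); last first.
  by rewrite /A npow_exp /delta -npowD//; apply: npow_le => //; clear - e17; lra.
rewrite Theta_sum.
apply: (@path_bound R T alpha q c a c0 CL (@normal_cdf_abs R) hT q0 hc a0 c00 pa plip plow n x k1 A
  (delta n) y g (increment T n (X n ^~ omega)) (fun j => sigma n (grid T n j.-1) omega)
  (fun j => zeta T w n j omega) (fun j => qvar T sigma n j omega) (fun j => S n j.-1 omega)
  (fun j => omega \in Dset T sigma J n j) (fun j => omega \in Wset T sigma J kappa n j)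
  n0 x0 xn k10 k1x Ak1 xy yd gd d0 da d1 g0 A2 AT Ac AcT Ac0 Aq ACL CL0 _ h1 h2 _ _ h7 _ _ _ _ _ _
  (Vstat T n (S n ^~ omega) (X n ^~ omega)) (ordV T n (S n ^~ omega) (X n ^~ omega) (s_trunc n alpha))).
(* On a quiet interval the jump part cancels, leaving the drift and the Ito error, each at most A
   x^2; hence the factor 2. *)
- move=> j jn; rewrite inE => -[nJ ns].
  have tl := tl_itv hT jn; have tr := tr_itv hT jn; have tlr := ltW (tl_lt_tr hT jn).
  have [/andP[tl0 _] /andP[_ trT]] := (tl, tr).
  have := h4 j jn; rewrite /ito_err indicE mem_set// mul1r => hM'.
  have hd := h5 j jn; rewrite /drift in hd.
  have bE := cadlag_integral_increment (hb.2 omega) tl0 tlr trT.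
  have -> : Num.sqrt T * x * zeta T w n j omega = w (grid T n j) omega - w (grid T n j.-1) omega.
    rewrite /zeta sT mulrA divff ?mul1r// mulf_neq0// gt_eqF//.
    by rewrite sqrtr_gt0.
  have JE : J n (grid T n j) omega = J n (grid T n j.-1) omega.
    by rewrite !hJ1// (jump_sum_nojump tlr nJ).
  rewrite /increment !hX1// JE.
  set b1 := \int[lebesgue_measure]_(s in `[0, grid T n j]) b s omega in bE *.
  set b2 := \int[lebesgue_measure]_(s in `[0, grid T n j.-1]) b s omega in bE *.
  rewrite -bE in hd.
  set M1 := M n (grid T n j) omega in hM' *; set M2 := M n (grid T n j.-1) omega in hM' *.
  set I1 := sigma n _ omega * _ in hM' *; set J1 := J n _ _.
  have -> : X0 omega + b1 + M1 + J1 - (X0 omega + b2 + M2 + J1) - I1 = (b1 - b2) + (M1 - M2 - I1).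
    by ring.
  apply: (le_trans (ler_normD _ _)); apply: (le_trans (lerD hd hM')).
  by rewrite -mulrA mulr_natl mulr2n.
- move=> j jn; split; first exact: hSp.
  have := hS3 j jn; rewrite normfV normr_id ger0_norm//.
  by apply: ltW; exact: hSp.
- move=> j jn; rewrite inE => -[_ ns].
  have := h6 j jn; rewrite /qerr indicE mem_set// mul1r.
  by rewrite HT.
- move=> j jn; rewrite !inE; exact: (Wset_Dset hT hkappa jn).
- move=> j jn Wj; have := h9 j jn; rewrite /Serr indicE Wj mul1r.
  by [].
- have := h8 1%N j1; apply: le_trans; apply: le_trans (ler_norm _).
  rewrite le_eqVlt; apply/orP; left; apply/eqP; rewrite /cnt /cardD.
  by apply: eq_bigr => j _; rewrite indicE in_setC.
(* The window count is the cell count times 4 kappa_n + 1, that is, A y / x times at most A / x. *)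
- have hB1 : cnt n (fun j => omega \notin Dset T sigma J n j) <= A * y / x.
    have := h8 1%N j1; apply: le_trans; apply: le_trans (ler_norm _).
    rewrite le_eqVlt; apply/orP; left; apply/eqP; rewrite /cnt /cardD.
    by apply: eq_bigr => j _; rewrite indicE in_setC.
  apply: le_trans (cnt_window (k := kappa n) (D := fun j => omega \in Dset T sigma J n j) _) _.
    by move=> j jn; exact: (Wset_window hT hkappa jn).
  rewrite (_ : A ^+ 2 * y / x ^+ 2 = A / x * (A * y / x)); last by field; rewrite gt_eqF.
  apply: ler_pM => //.
  by rewrite /cnt; apply: sumr_ge0.
- exact: (h10 1%N j1).
- move=> r; rewrite !inE => /or4P[]/eqP->;
    [exact: (h11 1%N j1)|exact: (h12 1%N j1)|exact: (h13 1%N j1)|exact: (h14 1%N j1)].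
- by [].
- apply: (le_trans cl); apply: le_trans t1; by rewrite gerBl.
- apply: le_trans ch; rewrite lerBlDr natr1; exact: ltW.
Unshelve. all: by end_near. Qed.
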